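(* Let $(\Sigma,g)=(\mathbb S^2,g_0)$ be the standard sphere, let $m=1$ and let $p_1\in\mathbb S^2$. For a function $K$ on $\mathbb S^2$ write $(\mathbb S^2)^+=\{\xi\in\mathbb S^2:K(\xi)>0\}$. (i) For any integer $N\geq1$ there exists a nonempty class of functions $K\in C^2(\mathbb S^2)$, each of which is sign-changing, satisfies $\nabla K\neq0$ on $\partial(\mathbb S^2)^+$ and $p_1\notin\overline{(\mathbb S^2)^+}$, and has $(\mathbb S^2)^+$ contractible, such that, for each $K$ in the class, if $$(0<)\ \alpha_1=2(N-1)+\frac{\varepsilon}{4\pi}\quad\text{with }\varepsilon>0\text{ small enough},$$ then $( * )_{\rho_{geo}}$ admits a solution, with $\rho_{geo}=8\pi N+\varepsilon$. (ii) For any integer $N\geq2$ there exists a nonempty class of functions $K\in C^2(\mathbb S^2)$, each of which is sign-changing, satisfies $\nabla K\neq0$ on $\partial(\mathbb S^2)^+$ and $p_1\notin\overline{(\mathbb S^2)^+}$, and has $(\mathbb S^2)^+$ contractible, such that, for each $K$ in the class, if $$(0<)\ \alpha_1=2(N-1)-\frac{\varepsilon}{4\pi}\quad\text{with }\varepsilon>0\text{ small enough},$$ then $( * )_{\rho_{geo}}$ admits a solution, with $\rho_{geo}=8\pi N-\varepsilon$.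
   Context: Let $(\Sigma,g)$ be a compact orientable surface without boundary, with Gauss curvature $\kappa_g$, area element $dV_g$, total area $|\Sigma|$, Euler characteristic $\chi(\Sigma)$, Laplace–Beltrami operator $\Delta_g$; let $K$ be a Lipschitz function on $\Sigma$, $p_1,\dots,p_m\in\Sigma$ distinct points and $\alpha_1,\dots,\alpha_m>-1$. $K$ is sign-changing if $K(\xi)K(\eta)<0$ for some $\xi,\eta\in\Sigma$. $G(x,p)$ is the Green's function: $-\Delta_gG(\cdot,p)=\delta_p-\frac1{|\Sigma|}$, $\int_\Sigma G(x,p)\,dV_g(x)=0$. $f_g$ is the unique solution of $-\Delta_gf_g=\frac{4\pi\chi(\Sigma)}{|\Sigma|}-2\kappa_g$, $\int_\Sigma f_g\,dV_g=0$. Put $\tilde K(x)=K(x)e^{f_g(x)-4\pi\sum_{i=1}^m\alpha_iG(x,p_i)}$. Problem $( * )_{\rho_{geo}}$ is $$-\Delta_gv=\rho_{geo}\Big(\frac{\tilde K(x)e^v}{\int_\Sigma\tilde K(x)e^v\,dV_g}-\frac1{|\Sigma|}\Big)\quad\text{on }\Sigma,\qquad \rho_{geo}=4\pi\Big(\chi(\Sigma)+\sum_{i=1}^m\alpha_i\Big);$$ a solution is a weak solution $v\in H^1(\Sigma)$ with $\int_\Sigma\tilde Ke^v\,dV_g>0$. ''$\varepsilon>0$ small enough'' means $\varepsilon\in(0,\delta)$ for some $\delta>0$ that may depend on $K$ (and on $N$, $p_1$). On the standard sphere $\chi(\mathbb S^2)=2$ and $\kappa_{g_0}\equiv1$. 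*)

(* Defs.v *)
From HB Require Import structures.
From mathcomp Require Import all_boot all_order all_algebra.
From mathcomp Require Import all_classical all_reals all_analysis.

Set Implicit Arguments.
Unset Strict Implicit.
Unset Printing Implicit Defensive.

Import Order.TTheory GRing.Theory Num.Theory.
Import numFieldNormedType.Exports.

Local Open Scope classical_set_scope.
Local Open Scope ring_scope.

Section sphere.
Variable R : realType.
Local Notation V := 'rV[R]_3.

(* MathComp-Analysis norms row vectors by the sup norm, which induces the usual
   topology; the Euclidean structure of R^3 is given by [dot]. *)
Definition dot (x y : V) : R := \sum_(i < 3) x 0 i * y 0 i.

Definition sphere : set V := [set x | dot x x = 1].

Definition S2 : Type := set_type sphere.

HB.instance Definition _ := Topological.on S2.

Lemma dot_delta : dot (delta_mx 0 ord_max) (delta_mx 0 ord_max) = 1.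
Proof.
rewrite /dot (bigD1 ord_max) //= big1 ?addr0 ?mxE ?eqxx ?mulr1 // => i /negPf i2.
by rewrite mxE i2 andbF mulr0.
Qed.

Definition north : S2 := exist _ (delta_mx 0 ord_max) (mem_set dot_delta).

HB.instance Definition _ := isPointed.Build S2 north.

Lemma dot_ge0 x : 0 <= dot x x.
Proof. by apply: sumr_ge0 => i _; rewrite -expr2 sqr_ge0. Qed.

Lemma dot_eq0 x : (dot x x == 0) = (x == 0).
Proof.
apply/idP/eqP => [|->]; last first.
  by rewrite /dot big1 // => i _; rewrite mxE mulr0.
rewrite psumr_eq0 => [/allP xx|i _]; last by rewrite -expr2 sqr_ge0.
apply/rowP => i; rewrite mxE; apply/eqP.
by have := xx i (mem_index_enum i); rewrite mulf_eq0 orbb.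
Qed.

(* The radial projection x |-> x / |x|; its value at 0 is irrelevant. *)
Definition radial (x : V) : S2 :=
  insubd (north : set_type sphere) ((Num.sqrt (dot x x))^-1 *: x).

Lemma val_radial x : x != 0 -> val (radial x) = (Num.sqrt (dot x x))^-1 *: x.
Proof.
move=> x0; rewrite /radial insubdK // inE /sphere /= /dot.
under eq_bigr do rewrite !mxE mulrACA.
rewrite -mulr_sumr -/(dot x x) -invfM -expr2 sqr_sqrtr ?dot_ge0 //.
by rewrite mulVf // dot_eq0.
Qed.

(* Cylindrical coordinates q = (z, phi). In this chart of the sphere the round
   metric is dz^2 / (1 - z^2) + (1 - z^2) dphi^2, whose determinant is 1, so
   that the area element is dz dphi. The vector below is a unit vector when
   |z| <= 1, and [radial] does not change it then. *)
Definition cyl_vec (q : R * R) : V :=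
  \row_(i < 3) [:: Num.sqrt (1 - q.1 ^+ 2) * cos q.2;
                   Num.sqrt (1 - q.1 ^+ 2) * sin q.2;
                   q.1]`_i.

Definition cyl (q : R * R) : S2 := radial (cyl_vec q).

Lemma cyl_vec_neq0 q : cyl_vec q != 0.
Proof.
apply/eqP => /rowP q0.
have /= := q0 ord_max; have /= := q0 0; have /= := q0 1.
rewrite !mxE /= => /eqP + /eqP + q1; rewrite q1 expr0n subr0 sqrtr1 !mul1r.
move=> /eqP s0 /eqP c0; have := cos2Dsin2 q.2.
by rewrite s0 c0 expr0n addr0 => /eqP; rewrite eq_sym oner_eq0.
Qed.

Lemma continuous_row (T : topologicalType) (f : T -> V) :
  (forall i, continuous (fun t => f t 0 i)) -> continuous f.
Proof.
move=> cf t A [P Pt PA].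
have nP : \forall s \near t, forall i : 'I_3, P 0 i (f s 0 i).
  apply: filter_forall => i.
  exact: (cf i t _ (Pt 0 i)).
apply: filterS nP => s Ps; apply: PA => a i.
by rewrite (ord1 a); exact: Ps.
Qed.

Lemma cyl_continuous : continuous cyl.
Proof.
have cz : continuous (fun q : R * R => Num.sqrt (1 - q.1 ^+ 2)).
  move=> q; apply: (@continuous_comp _ _ _ (fun q : R * R => 1 - q.1 ^+ 2)).
    apply: cvgB; first exact: cvg_cst.
    by apply: (@continuous_comp _ _ _ fst (fun z : R => z ^+ 2));
      [exact: cvg_fst|exact: exprn_continuous].
  exact: sqrt_continuous.
have cv i : continuous (fun q => cyl_vec q 0 i).
  move=> q; rewrite /continuous_at.
  under eq_fun do rewrite mxE; rewrite mxE.
  case: i => -[|[|[|//]]] i3 /=; last exact: cvg_fst.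
    apply: cvgM; first exact: cz.
    by apply: (@continuous_comp _ _ _ snd (@cos R));
      [exact: cvg_snd|exact: continuous_cos].
  apply: cvgM; first exact: cz.
  by apply: (@continuous_comp _ _ _ snd (@sin R));
    [exact: cvg_snd|exact: continuous_sin].
have cn : continuous (fun q => dot (cyl_vec q) (cyl_vec q)).
  move=> q; apply: (@cvg_big _ _ +%R 0); first exact: add_continuous.
  by move=> i _; apply: cvgM; exact: cv.
apply: (@continuous_comp_initial _ _ _ (set_val : S2 -> V)).
have -> : set_val \o cyl =
    fun q => (Num.sqrt (dot (cyl_vec q) (cyl_vec q)))^-1 *: cyl_vec q.
  by apply/funext => q /=; rewrite -val_radial ?cyl_vec_neq0.
apply: continuous_row => i q; rewrite /continuous_at.
under eq_fun do rewrite mxE; rewrite mxE.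
apply: cvgM; last exact: cv.
apply: cvgV.
  by rewrite gt_eqF // sqrtr_gt0 lt_neqAle dot_ge0 eq_sym dot_eq0 cyl_vec_neq0.
apply: (@continuous_comp _ _ _ (fun q => dot (cyl_vec q) (cyl_vec q))).
  exact: cn.
exact: sqrt_continuous.
Qed.

Lemma open_measurable_prod (W : set (R * R)) : open W -> measurable W.
Proof.
move=> oW.
pose B (t : rat * rat * rat) : set (R * R) :=
  ball (ratr t.1.1 : R) (ratr t.2) `*` ball (ratr t.1.2 : R) (ratr t.2).
have -> : W = \bigcup_t (if `[< B t `<=` W >] then B t else set0).
  apply/seteqP; split => [[x y] Wxy|[x y] [t _]]; last first.
    by case: asboolP => // + /= Bxy; exact.
  have /nbhs_ballP[e /= e0 eW] : nbhs (x, y) W by exact: open_nbhs_nbhs.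
  have e40 : 0 < e / 4 by rewrite divr_gt0.
  have [r] := @rat_in_itvoo R (e / 4) (e / 2) ltac:(by
    rewrite ltr_pM2l // ltf_pV2 ?posrE // ltr_nat).
  move=> /itvP re.
  have r0 : 0 < ratr r :> R by rewrite (lt_trans e40) ?re.
  have near z : exists q : rat, ball (ratr q : R) (ratr r) z.
    have [q /itvP qz] := @rat_in_itvoo R (z - ratr r) (z + ratr r) ltac:(by
      rewrite ltrD2l gtrN).
    by exists q; rewrite /ball /= ltr_distl ltrBlDr -ltrBlDr !qz.
  have [a ax] := near x; have [b yb] := near y.
  exists (a, b, r) => //; rewrite asboolT //= => -[u v] [/= au bv].
  apply: eW; split => /=.
    apply: (@le_ball _ _ _ (ratr r + ratr r)).
      by rewrite (splitr e) lerD // ltW // re.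
    by apply: ball_triangle au; exact: ball_sym.
  apply: (@le_ball _ _ _ (ratr r + ratr r)).
    by rewrite (splitr e) lerD // ltW // re.
  by apply: ball_triangle bv; exact: ball_sym.
apply: countable_bigcupT_measurable => // t.
by case: ifP => // _; apply: measurableX; rewrite ball_itv; exact: measurable_itv.
Qed.

HB.instance Definition _ :=
  Measurable.copy S2 (g_sigma_algebraType (@open S2)).

Lemma measurable_cyl : measurable_fun setT (cyl : R * R -> S2).
Proof.
apply: (@measurability _ _ _ _ _ _ (@open S2)) => //.
move=> _ [A oA <-]; rewrite setTI; apply: open_measurable_prod.
by apply: open_comp => // q _; exact: cyl_continuous.
Qed.

Definition cyl_dom : set (R * R) := `[(-1 : R), 1] `*` `[(0 : R), 2 * pi].

Lemma measurable_cyl_dom : measurable cyl_dom.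
Proof. by apply: measurableX; exact: measurable_itv. Qed.

Local Notation leb := (@lebesgue_measure R).

Definition area : set S2 -> \bar R :=
  pushforward (mrestr (leb \x leb)%E measurable_cyl_dom) cyl.

HB.instance Definition _ := Measure.copy area
  (measure_function_pushforward__canonical__measure_function_Measure
    (mrestr (leb \x leb)%E measurable_cyl_dom) measurable_cyl).

End sphere.

Section calculus.
Variable R : realType.
Local Notation V := 'rV[R]_3.
Local Notation S2 := (S2 R).
Local Notation e i := (delta_mx 0 i : V).

(* [Ck k U F]: F has continuous partial derivatives up to order k on the open
   set U. *)
Fixpoint Ck (k : nat) (U : set V) (F : V -> R) : Prop :=
  (forall x, U x -> {for x, continuous F}) /\
  if k is k'.+1 then
    forall i : 'I_3,
      (forall x, U x -> derivable F x (e i)) /\ Ck k' U ('D_(e i) F)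
  else True.

(* Functions on the sphere are differentiated through their extension
   x |-> f (x / |x|), constant along rays. As the radial projection is a smooth
   submersion, f is C^k on the sphere iff its extension is C^k away from 0; and
   the Euclidean gradient of the extension at a point of the sphere is the
   gradient of f for the induced metric. *)
Definition ext (f : S2 -> R) : V -> R := f \o @radial R.

Definition CkS2 (k : nat) (f : S2 -> R) : Prop :=
  Ck k [set x | x != 0] (ext f).

Definition smooth (f : S2 -> R) : Prop := forall k, CkS2 k f.

Definition grad (f : S2 -> R) (x : S2) : V :=
  \row_i 'D_(e i) (ext f) (val x).

Definition tangent (X : S2 -> V) : Prop := forall x, dot (X x) (val x) = 0.

(* For a tangent field X this is the Riemannian divergence, i.e. the trace of
   the tangential derivative of X: the radial derivative of the extension
   vanishes. *)
Definition div (X : S2 -> V) (x : S2) : R :=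
  \sum_(i < 3) 'D_(e i) (ext (fun y => X y 0 i)) (val x).

Definition laplace_beltrami (f : S2 -> R) : S2 -> R := div (grad f).

Definition smooth_field (X : S2 -> V) : Prop :=
  tangent X /\ forall i, smooth (fun x => X x 0 i).

Local Notation dV := (@area R).

Definition total_area : R := fine (dV setT).

(* u is in H^1 iff it has a weak gradient, in the following sense. *)
Definition weak_gradient (u : S2 -> R) (w : S2 -> V) : Prop :=
  [/\ u \in Lfun dV 2%:E,
      forall i, (fun x => w x 0 i) \in Lfun dV 2%:E,
      tangent w &
      forall X, smooth_field X ->
        \int[dV]_x (u x * div X x) = - \int[dV]_x dot (w x) (X x)].

Definition euler_char : R := 2.
Definition gauss_curv : R := 1.

(* -Delta G(., p) = delta_p - 1 / |S^2| in the sense of distributions, with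
   zero mean; G p p is irrelevant. *)
Definition green_function (G : S2 -> S2 -> R) : Prop :=
  forall p,
    [/\ dV.-integrable setT (fun x => (G x p)%:E),
        forall phi, smooth phi ->
          \int[dV]_x (G x p * - laplace_beltrami phi x) =
          phi p - total_area^-1 * \int[dV]_x phi x &
        \int[dV]_x G x p = 0].

(* The zero-mean solution f_g of -Delta f = 4 pi chi / |S^2| - 2 kappa. *)
Definition conformal_factor (f : S2 -> R) : Prop :=
  [/\ CkS2 2 f,
      forall x,
        - laplace_beltrami f x = 4 * pi * euler_char / total_area - 2 * gauss_curv &
      \int[dV]_x f x = 0].

Section problem.
Variables (G : S2 -> S2 -> R) (fg : S2 -> R) (K : S2 -> R).
Variables (m : nat) (p : 'I_m -> S2) (alpha : 'I_m -> R).

Definition Ktilde (x : S2) : R :=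
  K x * expR (fg x - 4 * pi * \sum_(i < m) alpha i * G x (p i)).

Definition rho_geo : R := 4 * pi * (euler_char + \sum_(i < m) alpha i).

(* v is a weak solution, with H^1 test functions, of
   -Delta v = rho (Ktilde e^v / int Ktilde e^v - 1 / |S^2|). *)
Definition solution (rho : R) (v : S2 -> R) : Prop :=
  let Kev x := Ktilde x * expR (v x) in
  let I := \int[dV]_x Kev x in
  [/\ dV.-integrable setT (EFin \o Kev), 0 < I &
      exists2 w, weak_gradient v w &
        forall phi z, weak_gradient phi z ->
          \int[dV]_x dot (w x) (z x) =
          rho * \int[dV]_x ((Kev x / I - total_area^-1) * phi x)].

End problem.

Definition sign_changing (K : S2 -> R) : Prop := exists x y, K x * K y < 0.

Definition positive_set (K : S2 -> R) : set S2 := [set x | 0 < K x].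

Definition boundary (T : topologicalType) (A : set T) : set T :=
  closure A `\` interior A.

Definition contractible (T : topologicalType) (A : set T) : Prop :=
  exists2 a, A a & exists H : T * R -> T,
    [/\ {within A `*` `[(0 : R), 1], continuous H},
        forall x (t : R), A x -> 0 <= t <= 1 -> A (H (x, t)),
        forall x, A x -> H (x, 0) = x &
        forall x, A x -> H (x, 1) = a].

Definition admissible (p : S2) (K : S2 -> R) : Prop :=
  [/\ CkS2 2 K, sign_changing K,
      forall x, boundary (positive_set K) x -> grad K x != 0,
      ~ closure (positive_set K) p &
      contractible (positive_set K)].

End calculus.

(* Main.v *)
Require Import Defs.
From HB Require Import structures.
From mathcomp Require Import all_boot all_order all_algebra.
From mathcomp Require Import all_classical all_reals all_analysis.
From mathcomp Require Import measurable_realfun.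
From mathcomp Require Import ring lra.

(** On the sphere every ingredient can be taken symmetric about the axis of p1,
and then the mean field equation becomes an ordinary differential equation in
the height s = x.p1, which is solved by a contraction.

The curvature is K(x) = (1 - s)^2 kappa(s) exp(- fg x), where kappa is C^2,
positive exactly for s < 0, and zero for s >= h. So the set where K > 0 is a
hemisphere, and K vanishes near p1. Nearly all the mass of kappa lies in
(- h, 0), and h is small compared with 1 / N. The same K serves for all alpha
in a range that contains the values needed for both signs of eps, so the class
consists of this K alone ([admissible_curv]).

Let lam = 2 (2 + alpha) = rho / (2 pi), and look for Z with
Z' = lam M / (1 - s^2) on (-1, h) and Z(h) = 0, where M is the share of the
mass of kappa e^(-Z) that lies below s. Here M is of order h below - h, and of
order 1 only on (- h, h), an interval of length 2h. So the map that defines Z is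
a contraction with constant O(lam h) on a small ball of continuous functions
([picard_map_contr], [mean_field_fixpoint]).

Now let m be kappa e^(-Z) divided by its integral over [-1, 1], and let
a(s) (1 - s^2) be the primitive of - lam (m - 1/2) that vanishes at both ends. If
V' = a, the function v(x) = V(s) satisfies
- Lap v = rho (m / (2 pi) - 1 / (4 pi)). On (-1, h) the definitions give
V + Z + (lam / 2) ln (1 - s) = const ([mean_field_profile]). On the other hand
G(x, p1) = - ln (1 - s) / (4 pi) + const, so that
Ktilde e^v = const (1 - s)^(2 + alpha) kappa e^V = const kappa e^(-Z) below h,
as lam / 2 = 2 + alpha; above h both sides vanish. Hence Ktilde e^v divided by
its integral is m / (2 pi), and v is a solution ([mean_field_solution]).

On the sphere this needs the divergence theorem for C^1 tangent fields, from
Fubini in cylindrical coordinates ([divergence_theorem]); the integral of a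
zonal function ([zonal_int]); the weak equation against H^1 test functions for a
field that is only continuous, by polynomial approximation
([zonal_weak]); and the formula for G. As G is only given as a distribution with
an integrable density, that formula holds almost everywhere, and it is enough
to have it where s < 1/2. It follows by testing with the Green function whose
pole is moved outside the sphere ([green_poisson]): its Laplacian is an
approximate identity, and Fubini turns pointwise information about the pole into
the pairing of G with continuous functions ([green_pairing], [green_near]). *)

Set Implicit Arguments.
Unset Strict Implicit.
Unset Printing Implicit Defensive.

Import Order.TTheory GRing.Theory Num.Theory.
Import numFieldNormedType.Exports.

Local Open Scope classical_set_scope.
Local Open Scope ring_scope.

(** * Functions of class C^k on open sets of R^3 *)

Lemma ord3_ind (P : 'I_3 -> Prop) : P 0 -> P 1 -> P 2 -> forall i, P i.
Proof.
move=> P0 P1 P2 i; have : i \in [:: 0; 1; 2] by rewrite -[i]natr_Zp; case: i => -[|[|[|]]].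
by rewrite !inE => /or3P[] /eqP ->.
Qed.

Lemma sum3E (R : realType) (F : 'I_3 -> R) : \sum_(i < 3) F i = F 0 + F 1 + F 2.
Proof.
rewrite !big_ord_recl big_ord0 addr0 addrA.
have -> : (lift ord0 ord0 : 'I_3) = 1 by exact: val_inj.
have -> : (lift ord0 (lift ord0 ord0) : 'I_3) = 2 by exact: val_inj.
by have -> : (ord0 : 'I_3) = 0 by exact: val_inj.
Qed.

Section Ck.
Variable R : realType.
Local Notation V := 'rV[R]_3.
Local Notation e i := (delta_mx 0 i : V).
Implicit Types (U : set V) (F G : V -> R).

Let FF := @nbhs_filter V.

Lemma Ck0P U F : Ck 0 U F <-> forall x, U x -> {for x, continuous F}.
Proof. by split=> [[]|]. Qed.

Lemma CkSP k U F : Ck k.+1 U F <-> (forall x, U x -> {for x, continuous F}) /\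
  forall i, (forall x, U x -> derivable F x (e i)) /\ Ck k U ('D_(e i) F).
Proof. by []. Qed.

Lemma CkS k U F : Ck k.+1 U F -> Ck k U F.
Proof.
elim: k F => [|k ih] F [cF dF]; split => // i.
by split; [exact: (dF i).1|exact/ih/(dF i).2].
Qed.

Lemma Ck_cont k U F : Ck k U F -> forall x, U x -> {for x, continuous F}.
Proof. by case: k => [|k] []. Qed.

Lemma Ck_eq k U F G : open U -> (forall x, U x -> F x = G x) ->
  Ck k U F -> Ck k U G.
Proof.
move=> oU; elim: k F G => [|k ih] F G FG.
  move=> /Ck0P cF; apply/Ck0P => x Ux; have FFx := FF x.
  have nFG : \forall y \near x, F y = G y by apply: filterS (FG) _; exact: open_nbhs_nbhs.
  rewrite /prop_for /continuous_at -FG //; apply: cvg_trans (cF x Ux).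
  by apply: near_eq_cvg; exact: nFG.
move=> /CkSP[cF dF]; apply/CkSP.
have nFG x : U x -> \forall y \near x, F y = G y.
  by move=> Ux; apply: filterS (FG) _; exact: open_nbhs_nbhs.
split.
  move=> x Ux; rewrite /prop_for /continuous_at -FG //; apply: cvg_trans (cF x Ux).
  have FFx := FF x; by apply: near_eq_cvg; exact: nFG.
move=> i; split.
  move=> x Ux.
  have := near_eq_derivable (nFG x Ux); apply.
  exact: (dF i).1.
apply: ih (dF i).2 => x Ux.
exact: near_eq_derive (nFG x Ux).
Qed.

Lemma Ck_cst k U c : Ck k U (cst c).
Proof.
elim: k c => [|k ih] c; first by apply/Ck0P => x _; have FFx := FF x; exact: cvg_cst.
apply/CkSP; split=> [x _|i]; first by have FFx := FF x; exact: cvg_cst.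
split=> [x _|]; first exact: derivable_cst.
have -> : 'D_(e i) (cst c : V -> R) = cst 0 by apply/funext => x; rewrite derive_cst.
exact: ih.
Qed.

Lemma Ck_add k U F G : open U -> Ck k U F -> Ck k U G ->
  Ck k U (fun x => F x + G x).
Proof.
move=> oU; elim: k F G => [|k ih] F G.
  by move=> /Ck0P cF /Ck0P cG; apply/Ck0P => x Ux; have FFx := FF x; apply: cvgD; [exact: cF|exact: cG].
move=> /CkSP[cF dF] /CkSP[cG dG]; apply/CkSP.
split; first by move=> x Ux; have FFx := FF x; apply: cvgD; [exact: (cF x Ux)|exact: (cG x Ux)].
move=> i; split; first by move=> x Ux; apply: derivableD; [exact: (dF i).1|exact: (dG i).1].
apply: (Ck_eq (F := fun x => 'D_(e i) F x + 'D_(e i) G x)) => //; last first.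
  by apply: ih; [exact: (dF i).2|exact: (dG i).2].
by move=> x Ux; rewrite deriveD //; [exact: (dF i).1|exact: (dG i).1].
Qed.

Lemma Ck_mul k U F G : open U -> Ck k U F -> Ck k U G ->
  Ck k U (fun x => F x * G x).
Proof.
move=> oU; elim: k F G => [|k ih] F G.
  by move=> /Ck0P cF /Ck0P cG; apply/Ck0P => x Ux; have FFx := FF x; apply: cvgM; [exact: cF|exact: cG].
move=> CF CG; have /CkSP[cF dF] := CF; have /CkSP[cG dG] := CG; apply/CkSP.
split; first by move=> x Ux; have FFx := FF x; apply: cvgM; [exact: (cF x Ux)|exact: (cG x Ux)].
move=> i; split; first by move=> x Ux; apply: derivableM; [exact: (dF i).1|exact: (dG i).1].
apply: (Ck_eq (F := fun x => F x * 'D_(e i) G x + G x * 'D_(e i) F x)) => //.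
  by move=> x Ux; rewrite deriveM //; [exact: (dF i).1|exact: (dG i).1].
by apply: Ck_add => //; apply: ih; (try exact: CkS); [exact: (dG i).2|exact: (dF i).2].
Qed.

Lemma Ck_opp k U F : open U -> Ck k U F -> Ck k U (fun x => - F x).
Proof.
move=> oU CF; apply: (Ck_eq (F := fun x => (cst (-1) x) * F x)) => //.
  by move=> x _; rewrite mulN1r.
by apply: Ck_mul => //; exact: Ck_cst.
Qed.

Lemma Ck_sub k U F G : open U -> Ck k U F -> Ck k U G ->
  Ck k U (fun x => F x - G x).
Proof. by move=> oU CF CG; apply: Ck_add => //; exact: Ck_opp. Qed.

Lemma Ck_sum k U n (F : 'I_n -> V -> R) : open U -> (forall i, Ck k U (F i)) ->
  Ck k U (fun x => \sum_(i < n) F i x).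
Proof.
move=> oU CF; elim: n F CF => [|n ih] F CF.
  by apply: Ck_eq (Ck_cst k U 0) => // x _; rewrite big_ord0.
apply: (Ck_eq (F := fun x => F ord0 x + \sum_(i < n) F (lift ord0 i) x)) => //.
  by move=> x _; rewrite big_ord_recl.
by apply: Ck_add => //; exact: ih.
Qed.

Lemma derive_coord (x v : V) i : is_derive x v (fun y : V => y 0 i) (v 0 i).
Proof.
have cvgv : (fun h : R => h^-1 *: ((h *: v + x) 0 i - x 0 i)) @ 0^' --> v 0 i.
  have ev : \forall h \near (0:R)^', v 0 i = h^-1 *: ((h *: v + x) 0 i - x 0 i).
    near=> h; have h0 : h != 0 by near: h; exact: nbhs_dnbhs_neq.
    by rewrite !mxE addrK scalerA mulVf // scale1r.
  by apply: (cvg_trans (near_eq_cvg ev)); exact: cvg_cst.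
split; first by apply/cvg_ex; exists (v 0 i).
by apply/cvg_lim.
Unshelve. all: by end_near. Qed.

Lemma Ck_coord k U i : open U -> Ck k U (fun x => x 0 i).
Proof.
move=> oU; case: k => [|k]; split=> //; try by move=> x _; exact: coord_continuous.
move=> j; split=> [x _|]; first by have [] := derive_coord x (e j) i.
have -> : 'D_(e j) (fun x : V => x 0 i) = cst ((e j) 0 i).
  by apply/funext => x; have [] := derive_coord x (e j) i.
exact: Ck_cst.
Qed.

Lemma is_derive_dir F x v d :
  is_derive x v F d <-> is_derive (0 : R) 1 (fun t => F (t *: v + x)) d.
Proof.
have E : (fun h : R => h^-1 *: ((fun t : R => F (t *: v + x)) (h *: 1 + 0) - F (0 *: v + x))) =
    (fun h : R => h^-1 *: (F (h *: v + x) - F x)).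
  by apply/funext => h; rewrite scale0r add0r addr0 /GRing.scale /= mulr1.
split=> -[]; rewrite /derivable /derive => dF dFE; split; rewrite /derivable /derive.
- by rewrite /= E.
- by rewrite /= E.
- by rewrite /= E in dF.
- by rewrite /= E in dFE.
Qed.

Lemma is_derive_dir_comp F (h : R -> R) x v a b : is_derive x v F a ->
  is_derive (F x) 1 h b -> is_derive x v (fun y => h (F y)) (a * b).
Proof.
move=> /is_derive_dir dF dh; apply/is_derive_dir; rewrite mulrC.
apply: (@is_derive1_comp _ h (fun t => F (t *: v + x))) => //.
by rewrite scale0r add0r.
Qed.

(** The derivatives of the outer function are given as a sequence, [h n.+1]
being the derivative of [h n]; the induction then passes from h to its shift. *)
Lemma Ck_comp k U (h : nat -> R -> R) F : open U -> Ck k U F ->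
  (forall n x, (n < k)%N -> U x -> is_derive (F x) 1 (h n) (h n.+1 (F x))) ->
  (forall n x, (n <= k)%N -> U x -> {for F x, continuous (h n)}) ->
  Ck k U (fun x => h 0 (F x)).
Proof.
move=> oU; elim: k h F => [|k ih] h F CF hd hc.
  split=> // x Ux; apply: continuous_comp; first exact: (Ck_cont CF Ux).
  exact: hc.
have dF i x : U x -> derivable F x (e i) by move=> Ux; exact: (CF.2 i).1.
have CdF i : Ck k U ('D_(e i) F) by exact: (CF.2 i).2.
have D i x : U x -> is_derive x (e i) (fun x => h 0 (F x)) ('D_(e i) F x * h 1%N (F x)).
  move=> Ux; apply: is_derive_dir_comp; last exact: hd.
  by apply: derivableP; exact: dF.
split.
  move=> x Ux; apply: continuous_comp; first exact: (Ck_cont CF Ux).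
  exact: hc.
move=> i; split; first by move=> x Ux; have [] := D i x Ux.
apply: (Ck_eq (F := fun x => 'D_(e i) F x * h 1%N (F x))) => //.
  by move=> x Ux; have [] := D i x Ux.
apply: Ck_mul => //.
apply: (ih (fun n => h n.+1)); first exact: CkS.
  by move=> n x nk; exact: hd.
by move=> n x nk; exact: hc.
Qed.

(** One coordinate step in the proof that C^1 functions are differentiable,
by the mean value theorem. *)
Lemma Ck1_increment U F x (eps : R) i (y w : V) (t d : R) : Ck 1 U F ->
  (forall z, `|z - x| < d -> U z /\ `|'D_(e i) F z - 'D_(e i) F x| <= eps) ->
  w = t *: e i + y -> `|y - x| < d -> `|w - x| < d ->
  `|F w - F y - t * 'D_(e i) F x| <= eps * `|t|.
Proof.
move=> CF near_x -> yd ytd.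
have segd s : 0 <= s <= 1 -> `|(s * t) *: e i + y - x| < d.
  move=> /andP[s0 s1].
  have -> : (s * t) *: e i + y - x = s *: (t *: e i + y - x) + (1 - s) *: (y - x).
    by apply/rowP => j; rewrite !mxE; ring.
  apply: (le_lt_trans (ler_normD _ _)); rewrite !normrZ (ger0_norm s0) ger0_norm ?subr_ge0 //.
  have -> : d = s * d + (1 - s) * d by ring.
  have [->|sn0] := eqVneq s 0; first by rewrite !mul0r !add0r subr0 !mul1r.
  apply: ltr_leD; first by rewrite ltr_pM2l // lt_def sn0.
  by apply: ler_wpM2l; [rewrite subr_ge0|exact: ltW].
pose g s := F ((s * t) *: e i + y).
have dg (s : R) : 0 <= s <= 1 -> is_derive s 1 g (t * 'D_(e i) F ((s * t) *: e i + y)).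
  move=> /segd /near_x [Us _].
  have [dF dFE] : is_derive ((s * t) *: e i + y) (e i) F ('D_(e i) F ((s * t) *: e i + y)).
    by apply: derivableP; exact: (CF.2 i).1.
  have -> : g = (fun u => F (u *: e i + ((s * t) *: e i + y))) \o (fun s' => (s' - s) * t).
    apply/funext => s'; rewrite /g /=; congr F.
    by apply/rowP => j; rewrite !mxE; ring.
  rewrite [X in is_derive _ _ _ X]mulrC; apply: is_derive1_comp.
    rewrite subrr mul0r; apply/is_derive_dir; split=> //.
  have -> : (fun s' => (s' - s) * t) = (fun s' => t * s' - t * s) by apply/funext => u; ring.
  have := @is_deriveB R R R (fun u => t * u) (cst (t * s)) s 1 _ _ (is_deriveZ t (is_derive_id s 1)) (is_derive_cst _ _ _).
  by rewrite subr0 /GRing.scale /= mulr1.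
have [c c01] := MVT_segment ler01 (fun s s01 => dg s (ltac:(move: s01; rewrite in_itv /= => /andP[? ?]; by rewrite !ltW))) (ltac:(
   apply: derivable_within_continuous => s; rewrite in_itv /= => s01; by have [] := dg s s01)).
rewrite /g mul1r mul0r scale0r add0r subr0 mulr1 => ->.
rewrite -mulrBr normrM mulrC ler_wpM2r //.
apply: (near_x _ _).2; apply: segd.
by move: c01; rewrite in_itv.
Qed.
End Ck.

Section grad_lin.
Variables (R : realType) (c : 'I_3 -> R).
Definition gradlin (h : 'rV[R]_3) : R := \sum_(i < 3) h 0 i * c i.
Lemma gradlin_is_linear : linear gradlin.
Proof.
move=> k u v; rewrite /gradlin scaler_sumr -big_split /=; apply: eq_bigr => i _.
by rewrite !mxE mulrDl /GRing.scale /= mulrA.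
Qed.
HB.instance Definition _ := GRing.isLinear.Build R 'rV[R]_3 R _ gradlin gradlin_is_linear.
Lemma gradlin_continuous : continuous gradlin.
Proof.
have H (x : 'rV[R]_3) : gradlin y @[y --> x] --> gradlin x.
  have FF := @nbhs_filter 'rV[R]_3 x.
  apply: (@cvg_big _ _ +%R 0); first exact: add_continuous.
  by move=> i _; apply: cvgM; [exact: coord_continuous|exact: cvg_cst].
exact: H.
Qed.
End grad_lin.

Lemma coord_le_norm (R : realType) n (h : 'rV[R]_n) i : `|h 0 i| <= `|h|.
Proof.
have -> : `|h| = mx_norm h by [].
rewrite mx_normrE; apply: le_trans; last exact: (le_bigmax _ (fun i => `|h i.1 i.2|) (0, i)).
by [].
Qed.

(** The point moves from x to x + h one coordinate at a time. *)
Lemma Ck1_frechet (R : realType) (U : set 'rV[R]_3) F x : open U -> Ck 1 U F -> U x ->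
  F \o shift x = cst (F x) + gradlin (fun i => 'D_(delta_mx 0 i) F x) +o_ (0 : 'rV[R]_3) id.
Proof.
move=> oU CF Ux; apply/eqaddoP => eps eps0 /=.
pose D i := 'D_(delta_mx 0 i) F : 'rV[R]_3 -> R.
have nDi i : \forall z \near x, `|D i z - D i x| <= eps / 3.
  have cD : {for x, continuous (D i)} by have /CkSP[_ /(_ i) [_ CD]] := CF; exact: (Ck_cont CD).
  have /cvgrPdist_le /(_ (eps / 3)) := cD.
  by rewrite divr_gt0 // => /(_ isT); apply: filterS => z; rewrite distrC.
have nD : \forall z \near x, U z /\ forall i, `|D i z - D i x| <= eps / 3.
  have FFx : Filter (nbhs x) := @nbhs_filter 'rV[R]_3 x.
  apply: (@filterS _ _ FFx _ _ _ (@filterI _ _ FFx _ _ (open_nbhs_nbhs (conj oU Ux))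
    (@filterI _ _ FFx _ _ (nDi 0) (@filterI _ _ FFx _ _ (nDi 1) (nDi 2))))) => z [Uz [z0 [z1 z2]]].
  by split; [exact: Uz|apply: ord3_ind; [exact: z0|exact: z1|exact: z2]].
have /nbhs_normP[d /= d0 dD] := nD.
have : \forall h \near (0 : 'rV[R]_3), `|h| < d.
  by apply/nbhs_normP; exists d => // h; rewrite /ball_ /= sub0r normrN.
apply: filterS => h hd.
have hi i : `|h 0 i| <= `|h| by exact: coord_le_norm.
have near_d i z : `|z - x| < d -> U z /\ `|'D_(delta_mx 0 i) F z - 'D_(delta_mx 0 i) F x| <= eps / 3.
  move=> zd; have [] := dD z; first by rewrite /ball_ /= distrC.
  by move=> Uz Dz; split=> //; exact: Dz.
pose h1 : 'rV[R]_3 := h 0 0 *: delta_mx 0 0.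
pose h2 : 'rV[R]_3 := h 0 1 *: delta_mx 0 1 + h1.
have h3E : h = h 0 2 *: delta_mx 0 2 + h2.
  by apply/rowP => -[[|[|[|//]]] i3]; rewrite !mxE /=;
    rewrite ?(mulr0, mulr1, addr0, add0r); congr (h _ _); exact: val_inj.
have normle (u : 'rV[R]_3) : (forall i, `|u 0 i| <= `|h|) -> `|u| < d.
  move=> uh; apply: le_lt_trans hd.
  have -> : `|u| = mx_norm u by [].
  by rewrite mx_normrE bigmax_le // => -[i j] _ /=; rewrite (ord1 i).
have h1d : `|h1| < d.
  apply: normle => -[[|[|[|//]]] i3]; rewrite !mxE /= ?(mulr0, mulr1, normr0) //.
have h2d : `|h2| < d.
  by apply: normle => -[[|[|[|//]]] i3]; rewrite !mxE /= ?(mulr0, mulr1, addr0, add0r, normr0).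
have sub0 : `|x - x| < d by rewrite subrr normr0.
have sub1 : `|h1 + x - x| < d by rewrite addrK.
have sub2 : `|h2 + x - x| < d by rewrite addrK.
have sub3 : `|h + x - x| < d by rewrite addrK.
have A1 := Ck1_increment (eps := eps / 3) CF (near_d 0) (erefl (h1 + x)) sub0 sub1.
have A2 := Ck1_increment (eps := eps / 3) CF (near_d 1) (esym (addrA (h 0 1 *: delta_mx 0 1) h1 x)) sub1 sub2.
have E3 : h + x = h 0 2 *: delta_mx 0 2 + (h2 + x) by rewrite addrA {1}h3E.
have A3 := Ck1_increment (eps := eps / 3) CF (near_d 2) E3 sub2 sub3.
rewrite !fctE /= /gradlin sum3E -addrA.
set d0' := 'D__ F x in A1 *; set d1' := 'D__ F x in A2 *; set d2' := 'D__ F x in A3 *.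
have -> : F (h + x) - (F x + (h 0 0 * d0' + (h 0 1 * d1' + h 0 2 * d2'))) =
  (F (h1 + x) - F x - h 0 0 * d0') + (F (h2 + x) - F (h1 + x) - h 0 1 * d1')
  + (F (h + x) - F (h2 + x) - h 0 2 * d2') by ring.
apply: (le_trans (ler_normD _ _)).
have -> : eps * `|h| = eps / 3 * `|h| + eps / 3 * `|h| + eps / 3 * `|h| by field.
apply: lerD; last by apply: (le_trans A3); rewrite ler_pM2l ?divr_gt0.
apply: (le_trans (ler_normD _ _)).
by apply: lerD; [apply: (le_trans A1)|apply: (le_trans A2)]; rewrite ler_pM2l ?divr_gt0.
Qed.

Lemma Ck1_diff (R : realType) (U : set 'rV[R]_3) F x : open U -> Ck 1 U F -> U x ->
  'd F x = gradlin (fun i => 'D_(delta_mx 0 i) F x) :> ('rV[R]_3 -> R).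
Proof.
move=> oU CF Ux; apply/diff_unique; first exact: gradlin_continuous.
exact: Ck1_frechet CF Ux.
Qed.

Lemma Ck1_differentiable (R : realType) (U : set 'rV[R]_3) F x : open U -> Ck 1 U F -> U x ->
  differentiable F x.
Proof.
move=> oU CF Ux; apply/diff_locallyP; rewrite (Ck1_diff oU CF Ux).
split; first exact: gradlin_continuous.
exact: Ck1_frechet CF Ux.
Qed.

(** [Ck] gives partial derivatives only; a chain rule along curves that are not
parallel to the axes needs differentiability. *)
Lemma Ck1_chain (R : realType) (U : set 'rV[R]_3) F (g : R -> 'rV[R]_3) (dg : 'I_3 -> R) (t : R) :
  open U -> Ck 1 U F -> U (g t) -> (forall i, is_derive t 1 (fun s => g s 0 i) (dg i)) ->
  is_derive t 1 (fun s => F (g s)) (\sum_(i < 3) dg i * 'D_(delta_mx 0 i) F (g t)).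
Proof.
move=> oU CF Ugt dgi.
have Dg : derivable g t 1.
  apply/derivable_mxP => i j; rewrite (ord1 i); by have [] := dgi j.
have dg1 : differentiable g t by apply/derivable1_diffP.
have dF := Ck1_differentiable oU CF Ugt.
have dFg : differentiable (F \o g) t by apply: differentiable_comp.
split; first exact: diff_derivable.
rewrite deriveE // diff_comp //= (Ck1_diff oU CF Ugt) /gradlin.
apply: eq_bigr => i _; congr (_ * _).
rewrite -deriveE // derive_mx // mxE; by have [] := dgi i.
Qed.

(** * Differential calculus on the sphere *)

Section sphere_calculus.
Variable R : realType.
Local Notation V := 'rV[R]_3.
Local Notation S2 := (S2 R).
Local Notation e i := (delta_mx 0 i : V).
Implicit Types (x y : S2) (p : V).

Definition punctured : set V := [set x | x != 0].

Lemma open_punctured : open punctured.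
Proof.
have -> : punctured = ~` [set 0] by apply/seteqP; split=> x /= /eqP.
by apply: closed_openC; exact: accessible_closed_set1 (@hausdorff_accessible _ (@norm_hausdorff _ V)) 0.
Qed.

Lemma dot_gt0 p : p != 0 -> 0 < dot p p.
Proof. by move=> p0; rewrite lt_neqAle dot_ge0 andbT eq_sym dot_eq0. Qed.

Lemma dotC p q : dot p q = dot q p :> R.
Proof. by apply: eq_bigr => i _; rewrite mulrC. Qed.

Lemma dotDl p q s : dot (p + q) s = dot p s + dot q s :> R.
Proof. by rewrite /dot -big_split; apply: eq_bigr => i _; rewrite mxE mulrDl. Qed.

Lemma dotZl c p s : dot (c *: p) s = c * dot p s :> R.
Proof. by rewrite /dot mulr_sumr; apply: eq_bigr => i _; rewrite mxE mulrA. Qed.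

Lemma dotNl p s : dot (- p) s = - dot p s :> R.
Proof. by rewrite -scaleN1r dotZl mulN1r. Qed.

Lemma dotBl p q s : dot (p - q) s = dot p s - dot q s :> R.
Proof. by rewrite dotDl dotNl. Qed.

Lemma dotZr c p s : dot s (c *: p) = c * dot s p :> R.
Proof. by rewrite dotC dotZl dotC. Qed.

Lemma dotBr p q s : dot s (p - q) = dot s p - dot s q :> R.
Proof. by rewrite dotC dotBl dotC (dotC q). Qed.

Lemma dot3E p q : dot p q = p 0 0 * q 0 0 + p 0 1 * q 0 1 + p 0 2 * q 0 2 :> R.
Proof.
exact: sum3E.
Qed.

Lemma dot_val x : dot (val x) (val x) = 1.
Proof. by have := valP x; rewrite inE. Qed.

Lemma val_neq0 x : val x != 0.
Proof. by rewrite -dot_eq0 dot_val oner_eq0. Qed.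

Lemma radial_val x : radial (val x) = x.
Proof. by apply: val_inj; rewrite val_radial ?val_neq0 // dot_val sqrtr1 invr1 scale1r. Qed.

(** 1 / |p|. The extensions of the coordinates are p_i / |p|, so smoothness on
the sphere reduces to that of this function. *)
Definition rinv p : R := (Num.sqrt (dot p p))^-1.

Lemma rinv_gt0 p : p != 0 -> 0 < rinv p.
Proof. by move=> p0; rewrite invr_gt0 sqrtr_gt0 dot_gt0. Qed.

Lemma is_derive_congr (W : normedModType R) (f : W -> R) (u v : W) (d d' : R) :
  d = d' -> is_derive u v f d -> is_derive u v f d'.
Proof. by move=> ->. Qed.

Lemma is_derive_dotxx p i :
  is_derive p (e i) (fun p => dot p p) (2 * p 0 i).
Proof.
rewrite /dot.
have -> : (fun p : V => \sum_(j < 3) p 0 j * p 0 j) = \sum_(j < 3) ((fun p : V => p 0 j) * (fun p : V => p 0 j)).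
  by apply/funext => u; rewrite fct_sumE; apply: eq_bigr.
have := @is_derive_sum _ _ _ _ (fun j => (fun p : V => p 0 j) * (fun p : V => p 0 j)) p (e i) _
  (fun j => is_deriveM (derive_coord p (e i) j) (derive_coord p (e i) j)).
apply: is_derive_congr.
rewrite (bigD1 i) //= big1; last by move=> j ji; rewrite mxE eqxx /= (negPf ji) scaler0 addr0.
by rewrite mxE !eqxx addr0 /GRing.scale /= mulr1 mulr_natl mulr2n.
Qed.

Lemma is_derive_invsqrt (u : R) : 0 < u ->
  is_derive u 1 (fun u => (Num.sqrt u)^-1) (- (2^-1 * (Num.sqrt u)^-1 ^+ 3)).
Proof.
move=> u0; have s0 : Num.sqrt u != 0 by rewrite gt_eqF ?sqrtr_gt0.
have [ds dsE] := is_derive1_sqrt u0.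
split; first exact: derivableV.
rewrite deriveV // dsE /GRing.scale /=; field.
exact: s0.
Qed.

Lemma is_derive_rinv p i : p != 0 ->
  is_derive p (e i) rinv (- (p 0 i * rinv p ^+ 3)).
Proof.
move=> p0.
have := is_derive_dir_comp (is_derive_dotxx p i) (is_derive_invsqrt (dot_gt0 p0)).
by apply: is_derive_congr; rewrite /rinv; field; rewrite gt_eqF ?sqrtr_gt0 ?dot_gt0.
Qed.

Lemma Ck_dotxx k : Ck k punctured (fun p => dot p p).
Proof.
have op := open_punctured.
by apply: Ck_sum => // i; apply: Ck_mul => //; exact: Ck_coord.
Qed.

Lemma rinv_cont p : p != 0 -> {for p, continuous rinv}.
Proof.
move=> p0.
have c1 : {for p, continuous (fun p : V => dot p p)} by exact: (Ck_cont (Ck_dotxx 0)).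
apply: (@continuous_comp _ _ _ (fun p : V => dot p p) (fun u => (Num.sqrt u)^-1)) => //.
apply: cvgV; first by rewrite gt_eqF ?sqrtr_gt0 ?dot_gt0.
exact: sqrt_continuous.
Qed.

Lemma Ck_rinv k : Ck k punctured rinv.
Proof.
elim: k => [|k ih].
  by apply/Ck0P => p p0; exact: rinv_cont.
apply/CkSP; split; first by move=> p p0; exact: rinv_cont.
move=> i; split; first by move=> p p0; have [] := is_derive_rinv i p0.
apply: (@Ck_eq _ _ _ (fun p => - (p 0 i * (rinv p * (rinv p * rinv p))))).
- exact: open_punctured.
- by move=> p p0; have [_ ->] := is_derive_rinv i p0.
apply: Ck_opp; first exact: open_punctured.
have op := open_punctured.
by apply: Ck_mul => //; [exact: Ck_coord|apply: Ck_mul => //; exact: Ck_mul].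
Qed.

Lemma ext_coord p i : p != 0 -> ext (fun x : S2 => val x 0 i) p = p 0 i * rinv p.
Proof. by move=> p0; rewrite /ext /= val_radial // mxE mulrC. Qed.

Lemma CkS2_coord k i : CkS2 k (fun x : S2 => val x 0 i).
Proof.
have op := open_punctured.
apply: (@Ck_eq _ _ _ (fun p => p 0 i * rinv p)) => //.
  by move=> p p0; rewrite ext_coord.
by apply: Ck_mul => //; [exact: Ck_coord|exact: Ck_rinv].
Qed.

Lemma CkS2_cst k (c : R) : CkS2 k (fun _ : S2 => c).
Proof. exact: Ck_cst. Qed.

Lemma CkS2_mul k (f g : S2 -> R) : CkS2 k f -> CkS2 k g -> CkS2 k (fun x => f x * g x).
Proof. by move=> cf cg; apply: (Ck_mul open_punctured cf cg). Qed.

Lemma CkS2_add k (f g : S2 -> R) : CkS2 k f -> CkS2 k g -> CkS2 k (fun x => f x + g x).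
Proof. by move=> cf cg; apply: (Ck_add open_punctured cf cg). Qed.

Lemma CkS2_sub k (f g : S2 -> R) : CkS2 k f -> CkS2 k g -> CkS2 k (fun x => f x - g x).
Proof. by move=> cf cg; apply: (Ck_sub open_punctured cf cg). Qed.

Lemma CkS2_comp k (h : nat -> R -> R) (f : S2 -> R) : CkS2 k f ->
  (forall n x, (n < k)%N -> is_derive (f x) 1 (h n) (h n.+1 (f x))) ->
  (forall n x, (n <= k)%N -> {for f x, continuous (h n)}) ->
  CkS2 k (fun x => h 0%N (f x)).
Proof.
move=> cf hd hc; apply: (Ck_comp open_punctured cf).
  by move=> n p nk p0; exact: hd.
by move=> n p nk p0; exact: hc.
Qed.

Definition sdot (p : V) (x : S2) : R := dot (val x) p.

Lemma CkS2_sdot k p : CkS2 k (sdot p).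
Proof.
apply: (Ck_sum (F := fun i => ext (fun x : S2 => val x 0 i * p 0 i))); first exact: open_punctured.
by move=> i; apply: CkS2_mul; [exact: CkS2_coord|exact: CkS2_cst].
Qed.

Lemma ext_val (f : S2 -> R) x : ext f (val x) = f x.
Proof. by rewrite /ext /= radial_val. Qed.

Lemma CkS2_derivable (f : S2 -> R) x i : CkS2 1 f -> derivable (ext f) (val x) (e i).
Proof. by move=> cf; have /CkSP [_ /(_ i) [+ _]] := cf : Ck 1 _ _; apply; exact: val_neq0. Qed.

Lemma is_derive_ext (f : S2 -> R) x i : CkS2 1 f ->
  is_derive (val x) (e i) (ext f) (grad f x 0 i).
Proof. by move=> cf; rewrite mxE; split=> //; exact: CkS2_derivable. Qed.

Lemma grad_mul (f g : S2 -> R) x : CkS2 1 f -> CkS2 1 g ->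
  grad (fun x => f x * g x) x = f x *: grad g x + g x *: grad f x.
Proof.
move=> cf cg; apply/rowP => i; rewrite !mxE.
have -> : ext (fun x => f x * g x) = ext f * ext g by [].
by rewrite deriveM ?ext_val //; exact: CkS2_derivable.
Qed.

Lemma grad_cst (c : R) x : grad (fun _ : S2 => c) x = 0.
Proof.
apply/rowP => i; rewrite !mxE.
by have -> : ext (fun _ : S2 => c) = cst c by []; rewrite derive_cst.
Qed.

Lemma grad_add (f g : S2 -> R) x : CkS2 1 f -> CkS2 1 g ->
  grad (fun x => f x + g x) x = grad f x + grad g x.
Proof.
move=> cf cg; apply/rowP => i; rewrite !mxE.
have -> : ext (fun x => f x + g x) = ext f + ext g by [].
by rewrite deriveD //; exact: CkS2_derivable.
Qed.

Lemma grad_comp (h : R -> R) (d : R) (f : S2 -> R) x : CkS2 1 f ->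
  is_derive (f x) 1 h d -> grad (fun x => h (f x)) x = d *: grad f x.
Proof.
move=> cf hd; apply/rowP => i; rewrite !mxE.
have hd' : is_derive (ext f (val x)) 1 h d by rewrite ext_val.
have [_ E] := is_derive_dir_comp (is_derive_ext x i cf) hd'.
have -> : ext (fun x => h (f x)) = (fun y : V => h (ext f y)) by [].
by rewrite E mxE mulrC.
Qed.

(** The projection of a basis vector onto the tangent plane. *)
Lemma grad_coord x i : grad (fun x : S2 => val x 0 i) x = e i - val x 0 i *: val x.
Proof.
apply/rowP => j; rewrite !mxE.
have nE : {near (val x : V), ext (fun x : S2 => val x 0 i) =1 (fun p => p 0 i * rinv p)}.
  have : \forall p \near (val x : V), punctured p.
    by apply: open_nbhs_nbhs; split; [exact: open_punctured|exact: val_neq0].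
  by apply: filterS => p p0; rewrite ext_coord.
rewrite (near_eq_derive _ nE).
have [_ ->] := is_deriveM (derive_coord (val x) (e j) i) (is_derive_rinv j (val_neq0 x)).
have -> : rinv (val x) = 1 by rewrite /rinv dot_val sqrtr1 invr1.
have -> : (e j : V) 0 i = (j == i)%:R by rewrite mxE eqxx eq_sym.
by rewrite /GRing.scale /= expr1n; ring.
Qed.

Lemma grad_sdot p x : grad (sdot p) x = p - sdot p x *: val x.
Proof.
pose c j := fun x : S2 => val x 0 j.
have -> : sdot p = fun x => (c 0 x * p 0 0 + c 1 x * p 0 1) + c 2 x * p 0 2.
  by apply/funext => y; rewrite /sdot dot3E.
have C j : CkS2 1 (fun x : S2 => c j x * p 0 j).
  by apply: CkS2_mul; [exact: CkS2_coord|exact: CkS2_cst].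
have C1 := CkS2_coord 1.
rewrite grad_add; [|exact: CkS2_add|exact: C].
rewrite grad_add; [|exact: C..].
rewrite !grad_mul ?grad_cst ?scaler0 ?add0r; try exact: CkS2_cst; try exact: C1.
rewrite !grad_coord.
by apply/rowP; apply: ord3_ind; rewrite !mxE /= /c; ring.
Qed.

Lemma div_mul (f : S2 -> R) (X : S2 -> V) x : CkS2 1 f ->
  (forall i, CkS2 1 (fun x => X x 0 i)) ->
  div (fun x => f x *: X x) x = f x * div X x + dot (grad f x) (X x).
Proof.
move=> cf cX; rewrite /div /dot mulr_sumr -big_split /=; apply: eq_bigr => i _.
have -> : (fun y => (f y *: X y) 0 i) = (fun y => f y * X y 0 i) by apply/funext => y; rewrite mxE.
have := congr1 (fun v : V => v 0 i) (grad_mul x cf (cX i)).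
by rewrite !mxE => ->; rewrite mulrC [in RHS]mulrC; congr (_ + _); rewrite mulrC.
Qed.

(** The gradient of x |-> f(x.p) when a = f'. *)
Definition zonal (a : R -> R) (p : V) (x : S2) : V :=
  a (sdot p x) *: (p - sdot p x *: val x).

Lemma zonal_tangent a p : tangent (zonal a p).
Proof. by move=> x; rewrite dotZl dotBl dotZl dot_val mulr1 /sdot dotC subrr mulr0. Qed.

(** The Laplacian of the first spherical harmonic x.p, whence the eigenvalue 2. *)
Lemma div_proj p x : div (fun x => p - sdot p x *: val x) x = - 2 * sdot p x.
Proof.
have E i : grad (fun x : S2 => (p - sdot p x *: val x) 0 i) x =
   - (sdot p x *: (e i - val x 0 i *: val x) + val x 0 i *: (p - sdot p x *: val x)).
  have -> : (fun x : S2 => (p - sdot p x *: val x) 0 i) =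
      (fun x => p 0 i + (-1) * (sdot p x * val x 0 i)).
    by apply/funext => y; rewrite !mxE mulN1r.
  have C1 : CkS2 1 (fun x => sdot p x * val x 0 i).
    by apply: CkS2_mul; [exact: CkS2_sdot|exact: CkS2_coord].
  rewrite (grad_add x (CkS2_cst 1 (p 0 i)) (CkS2_mul (CkS2_cst 1 (-1)) C1)).
  rewrite (grad_mul x (CkS2_cst 1 (-1)) C1).
  rewrite !grad_cst scaler0 addr0 add0r scaleN1r; congr (- _).
  rewrite grad_mul; [|exact: CkS2_sdot|exact: CkS2_coord].
  by rewrite grad_coord grad_sdot.
rewrite /div.
have {}E i : 'D_(e i) (ext (fun x : S2 => (p - sdot p x *: val x) 0 i)) (val x) =
   - (sdot p x *: (e i - val x 0 i *: val x) + val x 0 i *: (p - sdot p x *: val x)) 0 i.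
  have -> : forall g : S2 -> R, 'D_(e i) (ext g) (val x) = grad g x 0 i by move=> g; rewrite mxE.
  by rewrite E mxE.
under eq_bigr do rewrite E !mxE !eqxx /=.
rewrite sumrN big_split /= -!mulr_sumr.
under [X in _ * X + _]eq_bigr do rewrite -expr2.
rewrite sumrB sumr_const card_ord.
under [X in _ + X]eq_bigr do rewrite mulrBr mulrCA.
rewrite sumrB -mulr_sumr.
have H := dot_val x; rewrite /dot in H.
under eq_bigr do rewrite expr2.
rewrite H.
have -> : \sum_i val x 0 i * p 0 i = sdot p x by [].
ring.
Qed.

Lemma CkS2_zonal k (h : nat -> R -> R) p i :
  (forall n x, (n < k)%N -> is_derive (sdot p x) 1 (h n) (h n.+1 (sdot p x))) ->
  (forall n x, (n <= k)%N -> {for sdot p x, continuous (h n)}) ->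
  CkS2 k (fun x => zonal (h 0%N) p x 0 i).
Proof.
move=> hd hc.
have -> : (fun x => zonal (h 0%N) p x 0 i) =
   (fun x => h 0%N (sdot p x) * (p 0 i - sdot p x * val x 0 i)).
  by apply/funext => x; rewrite /zonal !mxE.
apply: CkS2_mul; first by apply: CkS2_comp => //; exact: CkS2_sdot.
apply: CkS2_sub; first exact: CkS2_cst.
by apply: CkS2_mul; [exact: CkS2_sdot|exact: CkS2_coord].
Qed.

(** The right-hand side is the derivative of (1 - s^2) a(s), where s = x.p. *)
Lemma div_zonal (a : R -> R) (d : R) p x : dot p p = 1 ->
  CkS2 1 (fun x => a (sdot p x)) -> is_derive (sdot p x) 1 a d ->
  div (zonal a p) x = (1 - sdot p x ^+ 2) * d - 2 * sdot p x * a (sdot p x).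
Proof.
move=> pp ca da.
have cX i : CkS2 1 (fun x => (p - sdot p x *: val x) 0 i).
  have -> : (fun x : S2 => (p - sdot p x *: val x) 0 i) = (fun x => p 0 i - sdot p x * val x 0 i).
    by apply/funext => y; rewrite !mxE.
  apply: CkS2_sub; first exact: CkS2_cst.
  by apply: CkS2_mul; [exact: CkS2_sdot|exact: CkS2_coord].
rewrite /zonal (div_mul x ca cX) div_proj (grad_comp (CkS2_sdot 1 p) da) grad_sdot dotZl.
rewrite !(dotBl, dotBr, dotZl, dotZr) pp dot_val [dot p (val x)]dotC -/(sdot p x).
by ring.
Qed.
End sphere_calculus.

(** * The area integral and the divergence theorem *)

Section sphere_measure.
Variable R : realType.
Local Notation V := 'rV[R]_3.
Local Notation S2 := (S2 R).
Local Notation e i := (delta_mx 0 i : V).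
Local Notation leb := (@lebesgue_measure R).
Local Notation dV := (@area R).
Implicit Types (x : S2) (p : V).

Lemma val_continuous : continuous (val : S2 -> V).
Proof. exact: initial_continuous. Qed.

Lemma CkS2_continuous (f : S2 -> R) : CkS2 0 f -> continuous f.
Proof.
move=> cf x.
have -> : f = ext f \o val by apply/funext => y /=; rewrite ext_val.
apply: continuous_comp; first exact: val_continuous.
by apply: (Ck_cont (cf : Ck 0 _ _)); exact: val_neq0.
Qed.

Lemma continuous_measurable_S2 (f : S2 -> R) : continuous f -> measurable_fun setT f.
Proof.
move=> /continuousP cf; apply: (measurability _ (RGenOpens.measurableE R)).
move=> _ [_ [a [b ->] <-]]; rewrite setTI; apply: sub_sigma_algebra.
by apply: cf; exact: interval_open.
Qed.

Lemma CkS2_measurable (f : S2 -> R) : CkS2 0 f -> measurable_fun setT f.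
Proof. by move=> cf; apply: continuous_measurable_S2; exact: CkS2_continuous. Qed.

Lemma compact_sphere : compact (@sphere R).
Proof.
apply: bounded_closed_compact.
  exists 1; split; first by rewrite num_real.
  move=> M M1 p sp; apply: le_trans (ltW M1).
  have -> : `|p| = mx_norm p by [].
  rewrite mx_normrE bigmax_le // => -[i j] _ /=; rewrite (ord1 i).
  rewrite -[_ <= 1](@ler_pXn2r _ 2) ?nnegrE // expr1n real_normK ?num_real //.
  rewrite -[leRHS](sp : dot p p = 1) /dot (bigD1 j) //= -expr2 lerDl.
  by apply: sumr_ge0 => k _; rewrite -expr2 sqr_ge0.
have -> : @sphere R = (fun p => dot p p) @^-1` [set 1] by [].
have cd : continuous (fun p : V => dot p p).
  move=> p; have FF := @nbhs_filter V p.
  apply: (@cvg_big _ _ +%R 0); first exact: add_continuous.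
  by move=> i _; apply: cvgM; exact: coord_continuous.
apply: (closed_comp (f := fun p : V => dot p p)) => [p _|]; first exact: cd.
exact: accessible_closed_set1 (@hausdorff_accessible _ (@Rhausdorff R)) 1.
Qed.

Lemma CkS2_bounded (f : S2 -> R) : CkS2 0 f -> exists2 M, 0 < M & forall x, `|f x| <= M.
Proof.
move=> cf.
have cn : {within @sphere R, continuous (fun p => `|ext f p|)}.
  apply: continuous_in_subspaceT => p; rewrite inE => sp.
  have FF := @nbhs_filter V p.
  apply: cvg_norm; apply: (Ck_cont (cf : Ck 0 _ _)).
  by rewrite /punctured /= -dot_eq0 (sp : dot p p = 1) oner_eq0.
have sn0 : @sphere R !=set0 by exists (val (north R)); exact: dot_val.
have [p sp pmax] := compact_EVT_max sn0 compact_sphere cn.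
exists (`|ext f p| + 1); first by rewrite ltr_wpDl.
move=> x; apply: (@le_trans _ _ `|ext f p|); last by rewrite lerDl.
rewrite -[f x]ext_val; apply: (pmax (val x)); rewrite inE; exact: dot_val.
Qed.

Lemma area_finite : (dV setT < +oo)%E /\ fine (dV setT) = 4 * pi.
Proof.
have E : dV setT = (4 * pi)%:E.
  rewrite /area /= /pushforward /mrestr preimage_setT setTI /cyl_dom.
  rewrite product_measure1E; [|exact: measurable_itv..].
  have E1 : leb `[(-1), 1]%classic = 2%:E.
    rewrite lebesgue_measure_itv /= lte_fin (lt_trans (ltrN10 _) ltr01) -EFinB.
    by congr (_%:E); ring.
  have E2 : leb `[0, 2 * pi]%classic = (2 * pi)%:E.
    by rewrite lebesgue_measure_itv /= lte_fin mulr_gt0 ?pi_gt0 // -EFinB subr0.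
  transitivity (leb `[(-1)%R, 1%R]%classic * leb `[0%R, (2 * pi)%R]%classic)%E => //.
  by rewrite E1 E2 -EFinM; congr (_%:E); ring.
by rewrite E ltry.
Qed.

Lemma total_areaE : total_area R = 4 * pi.
Proof. by have [_] := area_finite. Qed.

Lemma area_fin_num : dV setT \is a fin_num.
Proof. by rewrite ge0_fin_numE // area_finite.1. Qed.

Lemma bounded_integrable (f : S2 -> R) M : measurable_fun setT f -> (forall x, `|f x| <= M) ->
  dV.-integrable setT (EFin \o f).
Proof.
move=> mf fM; apply: measurable_bounded_integrable => //; first exact: area_finite.1.
exists M; split; first by rewrite num_real.
by move=> N MN x _; apply: (le_trans (fM x)); exact: ltW.
Qed.

Lemma CkS2_integrable (f : S2 -> R) : CkS2 0 f -> dV.-integrable setT (EFin \o f).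
Proof.
move=> cf; have [M _ fM] := CkS2_bounded cf.
exact: bounded_integrable (CkS2_measurable cf) fM.
Qed.

Lemma continuous_cyl_t (f : S2 -> R) z : continuous f -> continuous (fun t => f (cyl (z, t))).
Proof.
move=> cf t; apply: (@continuous_comp _ _ _ (fun t : R => cyl (z, t)) f); last exact: cf.
apply: (@continuous_comp _ _ _ (fun t : R => (z, t)) (@cyl R)); last exact: cyl_continuous.
exact: (@cvg_pair _ _ _ (nbhs t) (nbhs z) (nbhs t) _ _ _ (fun _ => z) id (cvg_cst z) cvg_id).
Qed.

Lemma continuous_cyl_z (f : S2 -> R) t : continuous f -> continuous (fun z => f (cyl (z, t))).
Proof.
move=> cf z; apply: (@continuous_comp _ _ _ (fun z : R => cyl (z, t)) f); last exact: cf.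
apply: (@continuous_comp _ _ _ (fun z : R => (z, t)) (@cyl R)); last exact: cyl_continuous.
exact: (@cvg_pair _ _ _ (nbhs z) (nbhs z) (nbhs t) _ _ _ id (fun _ => t) cvg_id (cvg_cst t)).
Qed.

Lemma continuous_integrable_seg (f : R -> R) a b : continuous f ->
  leb.-integrable `[a, b] (EFin \o f).
Proof.
move=> cf; apply: continuous_compact_integrable; first exact: segment_compact.
exact: continuous_subspaceT.
Qed.

Local Notation leb2 := (leb \x leb)%E.

(** Fubini in cylindrical coordinates, in which the area density is 1. *)
Lemma area_integralE (f : S2 -> R) : CkS2 0 f ->
  \int[dV]_x f x = \int[leb]_(z in `[-1, 1]) \int[leb]_(t in `[0, 2 * pi]) f (cyl (z, t)).
Proof.
move=> cf; have mf := CkS2_measurable cf.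
have [M M0 fM] := CkS2_bounded cf.
have mfc : measurable_fun (setT : set (R * R)) (f \o @cyl R).
  apply: measurableT_comp => //; exact: measurable_cyl.
have mD := @measurable_cyl_dom R.
set D := @cyl_dom R in mD.
have Dfin : (leb2 D < +oo)%E.
  have := area_finite.1; by rewrite /area /= /pushforward /mrestr preimage_setT setTI.
have intD : leb2.-integrable D (fun q : R * R => (f (cyl q))%:E).
  apply: measurable_bounded_integrable => //.
    by apply: measurable_funTS; exact: mfc.
  exists M; split; first by rewrite num_real.
  by move=> N MN q _; apply: (le_trans (fM _)); exact: ltW.
have intR : (mrestr leb2 mD).-integrable setT (fun q : R * R => (f (cyl q))%:E).
  apply: measurable_bounded_integrable => //.
  - by rewrite /= /mrestr setTI.
  exists M; split; first by rewrite num_real.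
  by move=> N MN q _; apply: (le_trans (fM _)); exact: ltW.
rewrite /Rintegral.
have -> : (\int[dV]_x (f x)%:E = \int[leb2]_(q in D) (f (cyl q))%:E)%E.
  transitivity (\int[mrestr leb2 mD]_q (f (cyl q))%:E)%E.
    have mfE : measurable_fun setT (EFin \o f) by exact/measurable_EFinP.
    have mc : measurable_fun [set: (measurableTypeR R * measurableTypeR R)%type] (@cyl R).
      exact: measurable_cyl.
    have H := integral_pushforward mc (D := setT) mfE intR measurableT.
    exact: H.
  have N0 : mrestr leb2 mD (~` D) = 0%E by rewrite /mrestr setICl measure0.
  have mDC : measurable (~` D : set (measurableTypeR R * measurableTypeR R)).
    by apply: measurableC; exact: mD.
  rewrite (negligible_integral mDC measurableT intR N0).
  rewrite setTD setCK; apply: eq_measure_integral => A mA AD.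
  by rewrite /= /mrestr setIidl.
have intDr : leb2.-integrable setT ((fun q : R * R => (f (cyl q))%:E) \_ D).
  have mDX : measurable (D : set (measurableTypeR R * measurableTypeR R)) by exact: mD.
  exact: (integrable_mkcond _ mDX).1 intD.
have F12 := integral12_prod_meas1 intDr.
have -> : (\int[leb2]_(q in D) (f (cyl q))%:E =
    \int[leb]_z fubini_F leb ((fun q : R * R => (f (cyl q))%:E) \_ D) z)%E.
  by rewrite integral_mkcond; exact: (esym F12).
congr fine; rewrite [RHS]integral_mkcond; apply: eq_integral => z _.
rewrite /fubini_F patchE; case: ifPn => [zI|zI].
  transitivity (\int[leb]_(t in `[0%R, (2 * pi)%R]) (f (cyl (z, t)))%:E)%E.
    rewrite [RHS]integral_mkcond; apply: eq_integral => t _.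
    rewrite !patchE; congr (if _ then _ else _).
    apply/idP/idP; rewrite !inE /D /cyl_dom /=; first by case.
    by move=> tI; split=> //; rewrite inE in zI.
  rewrite fineK //; apply: integrable_fin_num => //.
  apply: continuous_integrable_seg.
  by apply: continuous_cyl_t; exact: CkS2_continuous.
rewrite integral0_eq // => t _; rewrite patchE ifN //.
by apply: contra zI; rewrite !inE /D /cyl_dom /= => -[].
Qed.

(** The partial derivatives of ext f are homogeneous of degree -1, whereas the
extension of the gradient is homogeneous of degree 0; they are related by the
projection p |-> p / |p|. *)
Lemma CkS2_grad (f : S2 -> R) i : CkS2 1 f -> CkS2 0 (fun x => grad f x 0 i).
Proof.
move=> cf; have /CkSP[_ /(_ i) [_ cdf]] := cf : Ck 1 _ _.
apply/Ck0P => p p0.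
have np : \forall q \near p, (fun q => 'D_(e i) (ext f) (rinv q *: q)) q = ext (fun x => grad f x 0 i) q.
  have : \forall q \near p, q != 0.
    by apply: open_nbhs_nbhs; split; [exact: open_punctured|exact: p0].
  by apply: filterS => q q0; rewrite /ext /= mxE val_radial.
have FFp := @nbhs_filter V p.
rewrite /prop_for /continuous_at -(nbhs_singleton np).
apply: (cvg_trans (near_eq_cvg np)).
apply: (@continuous_comp _ _ _ (fun q => rinv q *: q) ('D_(e i) (ext f))).
  by apply: cvgZ; [exact: rinv_cont|exact: cvg_id].
apply: (Ck_cont cdf).
rewrite /punctured /= scaler_eq0 negb_or p0 andbT gt_eqF //; exact: rinv_gt0.
Qed.

Lemma div3E (X : S2 -> V) x : div X x =
  grad (fun x => X x 0 0) x 0 0 + grad (fun x => X x 0 1) x 0 1 + grad (fun x => X x 0 2) x 0 2.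
Proof.
by rewrite /div sum3E !mxE.
Qed.

Lemma CkS2_div (X : S2 -> V) : (forall i, CkS2 1 (fun x => X x 0 i)) -> CkS2 0 (div X).
Proof.
move=> cX.
have -> : div X = (fun x => grad (fun x => X x 0 0) x 0 0 + grad (fun x => X x 0 1) x 0 1
    + grad (fun x => X x 0 2) x 0 2).
  by apply/funext => x; exact: div3E.
by apply: CkS2_add; [apply: CkS2_add|]; exact: CkS2_grad.
Qed.

Lemma Rintegral_FTC2 (F f : R -> R) (a b : R) : a < b -> continuous f -> continuous F ->
  (forall x : R, a < x < b -> is_derive x 1 F (f x)) ->
  \int[leb]_(x in `[a, b]) f x = F b - F a.
Proof.
move=> ab cf cF dF; rewrite /Rintegral (@continuous_FTC2 _ f F) //.
- exact: continuous_subspaceT.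
- split; first by move=> x; rewrite in_itv /= => xab; have [] := dF x xab.
  + by apply: cvg_at_right_filter; exact: cF.
  + by apply: cvg_at_left_filter; exact: cF.
- by move=> x; rewrite in_itv /= => xab; rewrite derive1E; have [_ ->] := dF x xab.
Qed.

Lemma continuous_parallel_integral (f : S2 -> R) : CkS2 0 f ->
  continuous (fun z => \int[leb]_(t in `[0, 2 * pi]) f (cyl (z, t))).
Proof.
move=> cf z; have [M M0 fM] := CkS2_bounded cf.
have cfS := CkS2_continuous cf.
have zI : z \in `](z - 1), (z + 1)[%classic.
  by rewrite inE /= in_itv /= ltrBlDr ltrDl ltr01.
apply: (@continuity_under_integral R _ _ leb (fun z t => f (cyl (z, t))) `[0, 2 * pi]
   (measurable_itv _) (z - 1) (z + 1) _ _ (cst M)) => //.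
- by move=> y _; apply: continuous_integrable_seg; exact: continuous_cyl_t.
- by apply: aeW => t _ y _; exact: continuous_cyl_z.
- by apply: continuous_integrable_seg => t; exact: cvg_cst.
- by move=> y _; apply: aeW => t _; exact: fM.
Qed.

Lemma sqrt_1B_gt0 (z : R) : -1 < z < 1 -> 0 < Num.sqrt (1 - z ^+ 2).
Proof.
move=> /andP[z1 z2]; rewrite sqrtr_gt0.
have -> : 1 - z ^+ 2 = (1 - z) * (1 + z) by ring.
by rewrite mulr_gt0 ?subr_gt0 // -ltrBlDl sub0r.
Qed.

Lemma cyl_vec_unit (z t : R) : -1 <= z <= 1 -> dot (cyl_vec (z, t)) (cyl_vec (z, t)) = 1.
Proof.
move=> /andP[z1 z2]; rewrite dot3E !mxE /=.
have s0 : 0 <= 1 - z ^+ 2.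
  have -> : 1 - z ^+ 2 = (1 - z) * (1 + z) by ring.
  by rewrite mulr_ge0 ?subr_ge0 // -lerBlDl sub0r.
have := sqr_sqrtr s0; have := cos2Dsin2 t.
set s := Num.sqrt _; move=> cs ss.
transitivity (s ^+ 2 * (cos t ^+ 2 + sin t ^+ 2) + z ^+ 2); first by ring.
by rewrite cs ss; ring.
Qed.

Lemma val_cyl (z t : R) : -1 <= z <= 1 -> val (cyl (z, t)) = cyl_vec (z, t).
Proof.
move=> z1; rewrite /cyl val_radial ?cyl_vec_neq0 // cyl_vec_unit //.
by rewrite sqrtr1 invr1 scale1r.
Qed.

Lemma is_derive_sqrt_1B (z : R) : -1 < z < 1 ->
  is_derive z 1 (fun z => Num.sqrt (1 - z ^+ 2)) (- z / Num.sqrt (1 - z ^+ 2)).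
Proof.
move=> z1; have s0 := sqrt_1B_gt0 z1.
have dz : is_derive z 1 (fun z : R => 1 - z ^+ 2) (- (2 * z)).
  have -> : (fun z : R => 1 - z ^+ 2) = cst 1 - (@id R) * (@id R).
    by apply/funext => y; rewrite !fctE.
  have := is_deriveB (is_derive_cst (1 : R) z 1) (is_deriveM (is_derive_id z 1) (is_derive_id z 1)).
  by apply: is_derive_congr; rewrite /GRing.scale /=; ring.
have s1 : 0 < 1 - z ^+ 2 by rewrite sqrtr_gt0 in s0.
have := @is_derive1_comp _ _ (fun z : R => 1 - z ^+ 2) _ _ _ (is_derive1_sqrt s1) dz.
apply: is_derive_congr; field; exact: lt0r_neq0.
Qed.

Lemma is_derive_meridian (f : S2 -> R) (z t : R) : CkS2 1 f -> -1 < z < 1 ->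
  let s := Num.sqrt (1 - z ^+ 2) in let D i := grad f (cyl (z, t)) 0 i in
  is_derive z 1 (fun z => f (cyl (z, t)))
    (- (z / s * cos t) * D 0 - z / s * sin t * D 1 + D 2).
Proof.
move=> cf z1 s D.
have zle : -1 <= z <= 1 by case/andP: z1 => ? ?; rewrite !ltW.
pose dg (i : 'I_3) : R := [:: - (z / s * cos t); - (z / s * sin t); 1]`_i.
have ds := is_derive_sqrt_1B z1; rewrite -/s in ds.
have dgi i : is_derive z 1 (fun z => cyl_vec (z, t) 0 i) (dg i).
  move: i; apply: ord3_ind; rewrite /dg /=.
  - have -> : (fun z => cyl_vec (z, t) 0 0) = cos t \*: (fun z : R => Num.sqrt (1 - z ^+ 2)).
      by apply/funext => y; rewrite mxE /= mulrC.
    by apply: is_derive_congr (is_deriveZ _ ds); rewrite /GRing.scale /=; ring.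
  - have -> : (fun z => cyl_vec (z, t) 0 1) = sin t \*: (fun z : R => Num.sqrt (1 - z ^+ 2)).
      by apply/funext => y; rewrite mxE /= mulrC.
    by apply: is_derive_congr (is_deriveZ _ ds); rewrite /GRing.scale /=; ring.
  - have -> : (fun z => cyl_vec (z, t) 0 2) = id by apply/funext => y; rewrite mxE.
    exact: is_derive_id.
have := Ck1_chain (@open_punctured R) cf (cyl_vec_neq0 (z, t)) dgi.
apply: is_derive_congr.
have DE i : 'D_(e i) (ext f) (cyl_vec (z, t)) = D i by rewrite /D /grad mxE val_cyl.
rewrite sum3E !DE /dg /= -!/(D _).
move: (D 0) (D 1) (D 2) => D0 D1 D2; ring.
Qed.

Lemma is_derive_parallel (f : S2 -> R) (z t : R) : CkS2 1 f -> -1 <= z <= 1 ->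
  let s := Num.sqrt (1 - z ^+ 2) in let D i := grad f (cyl (z, t)) 0 i in
  is_derive t 1 (fun t => f (cyl (z, t))) (s * (- sin t * D 0 + cos t * D 1)).
Proof.
move=> cf z1 s D.
pose dg (i : 'I_3) : R := [:: - (s * sin t); s * cos t; 0]`_i.
have dgi i : is_derive t 1 (fun t => cyl_vec (z, t) 0 i) (dg i).
  move: i; apply: ord3_ind; rewrite /dg /=.
  - have -> : (fun t => cyl_vec (z, t) 0 0) = s \*: cos by apply/funext => y; rewrite mxE.
    by apply: is_derive_congr (is_deriveZ _ (is_derive_cos t)); rewrite /GRing.scale /=; ring.
  - have -> : (fun t => cyl_vec (z, t) 0 1) = s \*: sin by apply/funext => y; rewrite mxE.
    by apply: is_derive_congr (is_deriveZ _ (is_derive_sin t)); rewrite /GRing.scale /=; ring.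
  - have -> : (fun t => cyl_vec (z, t) 0 2) = cst z by apply/funext => y; rewrite mxE.
    exact: is_derive_cst.
have := Ck1_chain (@open_punctured R) cf (cyl_vec_neq0 (z, t)) dgi.
apply: is_derive_congr.
have DE i : 'D_(e i) (ext f) (cyl_vec (z, t)) = D i by rewrite /D /grad mxE val_cyl.
rewrite sum3E !DE /dg /= -!/(D _).
move: (D 0) (D 1) (D 2) => D0 D1 D2; ring.
Qed.

(** Differentiate X.x = 0 along the sphere: the normal part of the derivative
of X is - X. *)
Lemma tangent_grad (X : S2 -> V) x i : (forall i, CkS2 1 (fun x => X x 0 i)) -> tangent X ->
  X x 0 i + val x 0 0 * grad (fun x => X x 0 0) x 0 i + val x 0 1 * grad (fun x => X x 0 1) x 0 i
   + val x 0 2 * grad (fun x => X x 0 2) x 0 i = 0.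
Proof.
move=> cX tX.
pose c j := fun x : S2 => val x 0 j; pose Y j := fun x : S2 => X x 0 j.
have cc j : CkS2 1 (c j) by exact: CkS2_coord.
have cm j : CkS2 1 (fun x => c j x * Y j x) by apply: CkS2_mul; [exact: cc|exact: cX].
have E : (fun x => (c 0 x * Y 0 x + c 1 x * Y 1 x) + c 2 x * Y 2 x) = (fun _ => 0).
  by apply/funext => y; rewrite -(tX y) dotC dot3E.
have := grad_cst 0 x; rewrite -E.
rewrite grad_add; [|exact: CkS2_add|exact: cm].
rewrite grad_add; [|exact: cm..].
rewrite !grad_mul; try exact: cc; try exact: cX.
rewrite !grad_coord => /rowP /(_ i).
have := congr1 (fun u => u * val x 0 i) (tX x).
rewrite mul0r dot3E => T E'; have := congr2 (fun a b => a + b) E' T.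
have -> : (0 : V) 0 i = 0 by rewrite mxE.
rewrite addr0 => <-.
rewrite /c /Y {E' T E}.
move: (grad (fun x => X x 0 0) x) (grad (fun x => X x 0 1) x) (grad (fun x => X x 0 2) x) => g0 g1 g2.
by move: i; apply: ord3_ind; rewrite !mxE /=; ring.
Qed.

(** The trace of the derivative of X in the orthonormal frame along the radius,
the meridian and the parallel. The two hypotheses come from [tangent_grad], and
express the radial entries. *)
Lemma frame_trace (s z c g X0 X1 a00 a01 a10 a11 a20 a21 a22 : R) :
  s != 0 -> c ^+ 2 + g ^+ 2 = 1 ->
  X0 + s * c * a00 + s * g * a10 + z * a20 = 0 ->
  X1 + s * c * a01 + s * g * a11 + z * a21 = 0 ->
  a00 + a11 + a22 - (- (z / s * c) * a20 - z / s * g * a21 + a22) =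
  s^-1 * (- g * (s * (- g * a00 + c * a01)) - X0 * c + (c * (s * (- g * a10 + c * a11)) - X1 * g)).
Proof.
move=> s0 cg T0 T1; apply/eqP; rewrite -subr_eq0; apply/eqP.
transitivity (s^-1 * (c * (X0 + s * c * a00 + s * g * a10 + z * a20) +
   g * (X1 + s * c * a01 + s * g * a11 + z * a21)) +
   (1 - (c ^+ 2 + g ^+ 2)) * (a00 + a11)); first by field.
by rewrite cg T0 T1; ring.
Qed.

(** As the area density is 1 in the coordinates (z, t), the divergence is
d/dz of the component X_3, plus d/dt of the other coordinate component of X. *)
Lemma is_derive_div_parallel (X : S2 -> V) (z t : R) : tangent X ->
  (forall i, CkS2 1 (fun x => X x 0 i)) -> -1 < z < 1 ->
  let s := Num.sqrt (1 - z ^+ 2) in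
  let D := grad (fun x => X x 0 2) (cyl (z, t)) in
  is_derive t 1 (fun t => (- sin t * X (cyl (z, t)) 0 0 + cos t * X (cyl (z, t)) 0 1) / s)
   (div X (cyl (z, t)) - (- (z / s * cos t) * D 0 0 - z / s * sin t * D 0 1 + D 0 2)).
Proof.
move=> tX cX z1 s D.
have zle : -1 <= z <= 1 by case/andP: z1 => ? ?; rewrite !ltW.
have s0 : s != 0 by rewrite gt_eqF // sqrt_1B_gt0.
have d0 := is_derive_parallel t (cX 0) zle; rewrite -/s in d0.
have d1 := is_derive_parallel t (cX 1) zle; rewrite -/s in d1.
have := is_deriveZ s^-1 (is_deriveD (is_deriveM (is_deriveN (is_derive_sin t)) d0)
  (is_deriveM (is_derive_cos t) d1)).
have -> : s^-1 \*: (- sin * (fun t => X (cyl (z, t)) 0 0) + cos * (fun t => X (cyl (z, t)) 0 1)) =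
  (fun t => (- sin t * X (cyl (z, t)) 0 0 + cos t * X (cyl (z, t)) 0 1) / s).
  by apply/funext => u; rewrite [RHS]mulrC.
apply: is_derive_congr; rewrite div3E.
have T0 := tangent_grad (cyl (z, t)) 0 cX tX.
have T1 := tangent_grad (cyl (z, t)) 1 cX tX.
have V0 : val (cyl (z, t)) 0 0 = s * cos t by rewrite val_cyl // mxE.
have V1 : val (cyl (z, t)) 0 1 = s * sin t by rewrite val_cyl // mxE.
have V2 : val (cyl (z, t)) 0 2 = z by rewrite val_cyl // mxE.
rewrite V0 V1 V2 in T0 T1.
apply: esym; apply: (etrans (frame_trace _ s0 (cos2Dsin2 t) T0 T1)).
by rewrite /GRing.scale /=; congr (_ * _); rewrite !fctE; ring.
Qed.

Lemma grad_field_bound (X : S2 -> V) : (forall i, CkS2 1 (fun x => X x 0 i)) ->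
  exists2 M, 0 < M & forall i j x, `|grad (fun x => X x 0 i) x 0 j| <= M.
Proof.
move=> cX.
have H i j : exists M, forall x, `|grad (fun x => X x 0 i) x 0 j| <= M.
  by have [M _ HM] := CkS2_bounded (CkS2_grad j (cX i)); exists M.
have [m Hm] := choice (fun ij : 'I_3 * 'I_3 => H ij.1 ij.2).
exists (1 + \sum_ij `|m ij|); first by rewrite ltr_pwDl // sumr_ge0.
move=> i j x; apply: (le_trans (Hm (i, j) x)); apply: (le_trans (ler_norm _)).
rewrite (bigD1 (i, j)) //= addrCA lerDl addr_ge0 //; exact: sumr_ge0.
Qed.

(** At the poles tangent vectors are horizontal, so the boundary terms of the
divergence theorem vanish. *)
Lemma tangent_pole (X : S2 -> V) (z t : R) : tangent X -> z ^+ 2 = 1 -> X (cyl (z, t)) 0 2 = 0.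
Proof.
move=> tX z1.
have zle : -1 <= z <= 1.
  by rewrite -ler_norml -sqrtr_sqr z1 sqrtr1.
have := tX (cyl (z, t)); rewrite dot3E val_cyl // !mxE /= z1 subrr sqrtr0 !mul0r !mulr0 !add0r.
move/eqP; rewrite mulf_eq0 => /orP[/eqP //|/eqP z0].
by move/eqP: z1; rewrite z0 expr0n eq_sym oner_eq0.
Qed.

(** Integrate [is_derive_div_parallel] over a parallel: the derivative along it
has zero integral by periodicity, and the rest is the derivative in z of the
integral of X_3, which vanishes at both poles. Dominated differentiation under
the integral is applied for |z| < w < 1, as the meridians are singular at the
poles. *)
Theorem divergence_theorem (X : S2 -> V) : tangent X ->
  (forall i, CkS2 1 (fun x => X x 0 i)) -> \int[dV]_x div X x = 0.
Proof.
move=> tX cX.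
have cdiv := CkS2_div cX.
rewrite area_integralE //.
pose A z := \int[leb]_(t in `[0, 2 * pi]) X (cyl (z, t)) 0 2.
have pi20 : 0 < 2 * pi :> R by rewrite mulr_gt0 ?pi_gt0.
have cX0 i : CkS2 0 (fun x => X x 0 i) by exact/CkS/cX.
transitivity (A 1 - A (-1)); last first.
  have A1 z : z ^+ 2 = 1 -> A z = 0.
    move=> z1; rewrite /A /Rintegral integral0_eq // => t _.
    by rewrite tangent_pole.
  by rewrite !A1 ?subrr ?sqrrN ?expr1n.
apply: Rintegral_FTC2.
- by rewrite (lt_trans (ltrN10 _)).
- exact: continuous_parallel_integral.
- exact: continuous_parallel_integral (cX0 2).
move=> z z1.
have cD i : CkS2 0 (fun x => grad (fun x => X x 0 2) x 0 i) by exact: CkS2_grad.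
pose mer (y t : R) : R := let s := Num.sqrt (1 - y ^+ 2) in
  let D i := grad (fun x => X x 0 2) (cyl (y, t)) 0 i in
  - (y / s * cos t) * D 0 - y / s * sin t * D 1 + D 2.
have dmer (y t : R) : -1 < y < 1 -> is_derive y 1 (fun y => X (cyl (y, t)) 0 2) (mer y t).
  exact: is_derive_meridian.
pose w := (1 + `|z|) / 2.
have zw : `|z| < w /\ w < 1.
  have : `|z| < 1 by rewrite ltr_norml.
  by rewrite /w; move: `|z| => a ?; split; lra.
have w0 : 0 < w by rewrite (le_lt_trans (normr_ge0 z)) // zw.1.
have Iw (y : R) : y \in `](- w), w[%classic -> -1 < y < 1 /\ `|y| < w.
  rewrite inE /= in_itv /= => /andP[y1 y2]; split; last by rewrite ltr_norml y1.
  by rewrite (lt_trans _ y1) ?(lt_trans y2) ?ltrN2 ?zw.2.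
have Iz : `](- w), w[%classic z by rewrite /= in_itv /= -ltr_norml zw.1.
have [M M0 HM] := grad_field_bound cX.
pose s1 := Num.sqrt (1 - w ^+ 2).
have s10 : 0 < s1 by apply: sqrt_1B_gt0; rewrite zw.2 (lt_trans _ w0) ?ltrN10.
pose C := (s1^-1 + s1^-1 + 1) * M.
have C0 : 0 <= C.
  by apply: mulr_ge0; [rewrite !addr_ge0 ?invr_ge0 ?(ltW s10)|exact: ltW].
have merC (y t : R) : y \in `](- w), w[%classic -> `|mer y t| <= C.
  move=> /Iw[y1 yw]; rewrite /mer /C.
  set s := Num.sqrt _.
  have ss : s1 <= s.
    rewrite ler_wsqrtr // lerD2l lerN2 -(@real_normK _ y) ?num_real //.
    by rewrite ler_pXn2r ?nnegrE ?normr_ge0 ?ltW.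
  have s0 : 0 < s by exact: lt_le_trans ss.
  have ys : `|y / s| <= s1^-1.
    rewrite normrM [X in _ * X]gtr0_norm ?invr_gt0 // ler_pdivrMr //.
    rewrite (@le_trans _ _ 1) //; first by rewrite (le_trans (ltW yw)) // ltW ?zw.2.
    by rewrite mulrC ler_pdivlMr // mul1r.
  have c1 : `|cos t| <= 1 by rewrite ler_norml cos_geN1 cos_le1.
  have sn1 : `|sin t| <= 1 by rewrite ler_norml sin_geN1 sin_le1.
  have key (u : R) i : `|u| <= 1 ->
      `|y / s * u * grad (fun x => X x 0 2) (cyl (y, t)) 0 i| <= s1^-1 * M.
    move=> u1; rewrite normrM; apply: ler_pM => //.
    by rewrite normrM -[leRHS]mulr1; apply: ler_pM.
  rewrite !mulrDl mul1r.
  apply: (le_trans (ler_normD _ _)); apply: lerD; last exact: HM.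
  apply: (le_trans (ler_normB _ _)); apply: lerD; last exact: key.
  by rewrite mulNr normrN; exact: key.
have intX (y : R) : `](- w), w[%classic y ->
    leb.-integrable `[0, 2 * pi] (EFin \o (fun t => X (cyl (y, t)) 0 2)).
  by move=> _; apply: continuous_integrable_seg; apply: (continuous_cyl_t (f := fun x => X x 0 2)); exact/CkS2_continuous/cX0.
have derX (y t : R) : `](- w), w[%classic y -> `[0, 2 * pi]%classic t ->
    derivable ((fun y t => X (cyl (y, t)) 0 2) ^~ t) y 1.
  by move=> /mem_set /Iw[y1 _] _; have [] := dmer y t y1.
have intC : leb.-integrable `[0, 2 * pi] (EFin \o (fun _ : R => C)).
  by apply: continuous_integrable_seg => t; exact: cvg_cst.
have ubC (y t : R) : `](- w), w[%classic y -> `[0, 2 * pi]%classic t ->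
    `|partial1of2 (fun y t => X (cyl (y, t)) 0 2) y t| <= C.
  move=> yw _; rewrite partial1of2E.
  by have [_ ->] := dmer y t (Iw y (mem_set yw)).1; apply: merC; exact: mem_set.
have mI : measurable (`[0, 2 * pi]%classic : set (measurableTypeR R)) by exact: measurable_itv.
have D1 := derivable_under_integral mI Iz intX derX (fun _ => C0) intC ubC.
have D2 := differentiation_under_integral mI Iz intX derX (fun _ => C0) intC ubC.
split; first exact: D1.
rewrite -derive1E [LHS]D2.
transitivity (\int[leb]_(t in `[0, 2 * pi]) mer z t).
  by apply: eq_Rintegral => t _; rewrite partial1of2E; have [_ ->] := dmer z t z1.
have cmer : continuous (mer z).
  move=> t.
  have cD' i : grad (fun x => X x 0 2) (cyl (z, u)) 0 i @[u --> t] --> grad (fun x => X x 0 2) (cyl (z, t)) 0 i.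
    by apply: (continuous_cyl_t (f := fun x => grad (fun x => X x 0 2) x 0 i)); exact/CkS2_continuous/cD.
  apply: cvgD; last exact: cD'.
  apply: cvgB.
    apply: cvgM; last exact: cD'.
    by apply: cvgN; apply: cvgM; [exact: cvg_cst|exact: continuous_cos].
  apply: cvgM; last exact: cD'.
  by apply: cvgM; [exact: cvg_cst|exact: continuous_sin].
have cdv : continuous (fun t => div X (cyl (z, t))).
  by apply: continuous_cyl_t; exact: CkS2_continuous.
pose B (t : R) := (- sin t * X (cyl (z, t)) 0 0 + cos t * X (cyl (z, t)) 0 1) / Num.sqrt (1 - z ^+ 2).
have dB (t : R) : is_derive t 1 B (div X (cyl (z, t)) - mer z t) by exact: is_derive_div_parallel.
have cB : continuous B.
  by move=> t; apply: differentiable_continuous; apply/derivable1_diffP; have [] := dB t.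
have : \int[leb]_(t in `[0, 2 * pi]) (div X (cyl (z, t)) - mer z t) = B (2 * pi) - B 0.
  apply: Rintegral_FTC2 => // t; apply: cvgB; [exact: cdv|exact: cmer].
have -> : B (2 * pi) = B 0.
  have per : cyl (z, 2 * pi) = cyl (z, 0) :> S2.
    rewrite /cyl; congr radial; apply/rowP; apply: ord3_ind; rewrite !mxE //=.
    - by rewrite mulr_natl cos2pi cos0.
    - by rewrite mulr_natl sin2pi sin0.
  by rewrite /B per mulr_natl cos2pi cos0 sin2pi sin0.
rewrite subrr RintegralB //; try exact: continuous_integrable_seg.
by move/eqP; rewrite subr_eq0 => /eqP ->.
Qed.
End sphere_measure.

(** * Zonal functions and zonal fields *)

Section weierstrass.
Variable R : realType.

(** The expectation of g after n steps of the walk that moves up with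
probability 'X. The recursion on n makes its moments a matter of induction. *)
Fixpoint bernstein (n : nat) (g : nat -> R) : {poly R} :=
  if n is m.+1 then 'X * bernstein m (fun k => g k.+1) + (1 - 'X) * bernstein m g
  else (g 0%N)%:P.

Lemma bernstein_le n (g h : nat -> R) x : 0 <= x <= 1 ->
  (forall k, (k <= n)%N -> g k <= h k) -> (bernstein n g).[x] <= (bernstein n h).[x].
Proof.
move=> /andP[x0 x1]; elim: n g h => [|n ih] g h gh /=; first by rewrite !hornerE gh.
rewrite !hornerE; apply: lerD.
  by apply: ler_wpM2l => //; apply: ih => k kn; exact: gh.
apply: ler_wpM2l; first by rewrite subr_ge0.
by apply: ih => k kn; apply: gh; exact: leqW.
Qed.

Lemma bernstein_lin n (c d : R) (g h : nat -> R) x :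
  (bernstein n (fun k => c * g k + d * h k)).[x] =
  c * (bernstein n g).[x] + d * (bernstein n h).[x].
Proof.
elim: n g h => [|n ih] g h /=; first by rewrite !hornerE.
by rewrite !hornerE !ih; ring.
Qed.

Lemma bernstein_cst n c x : (bernstein n (fun=> c)).[x] = c.
Proof. by elim: n => [|n ih] /=; rewrite !hornerE ?ih //; ring. Qed.

(** The centre c is arbitrary because one step of the walk shifts it. *)
Lemma bernstein_variance n c x :
  (bernstein n (fun k => (k%:R - c) ^+ 2)).[x] = n%:R * x * (1 - x) + (n%:R * x - c) ^+ 2.
Proof.
elim: n c => [|n ih] c /=; first by rewrite !hornerE /=; ring.
have -> : (fun k : nat => (k.+1%:R - c) ^+ 2) = (fun k => (k%:R - (c - 1)) ^+ 2).
  by apply/funext => k; rewrite -addn1 natrD; ring.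
rewrite !hornerE !ih -[n.+1%:R]natr1; ring.
Qed.

(** A modulus of continuity in terms of a function q that separates points. When
q is a squared distance, its average against an approximate identity is a
variance or a second moment, and no separation of near and far points is needed. *)
Lemma compact_modulus (T : topologicalType) (A : set T) (f : T -> R) (q : T * T -> R) (eps : R) :
  compact A -> continuous f -> continuous q -> (forall z, 0 <= q z) ->
  (forall x y, A x -> A y -> q (x, y) = 0 -> x = y) -> 0 < eps ->
  exists2 C, 0 <= C & forall x y, A x -> A y -> `|f x - f y| <= eps + C * q (x, y).
Proof.
move=> cA cf cq q0 qeq e0.
pose g (z : T * T) := `|f z.1 - f z.2|.
have cg : continuous g.
  move=> z; apply: cvg_norm; apply: cvgB.
    by apply: (@continuous_comp _ _ _ fst f); [exact: cvg_fst|exact: cf].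
  by apply: (@continuous_comp _ _ _ snd f); [exact: cvg_snd|exact: cf].
pose D := (A `*` A) `&` (g @^-1` [set t | eps <= t]).
have cD : compact D.
  apply: compact_closedI; first exact: compact_setX.
  by apply: closed_comp => [z _|]; [exact: cg|exact: closed_ge].
have [D0|/eqP/set0P D0] := pselect (D = set0).
  exists 0 => // x y Ax Ay; rewrite mul0r addr0 leNgt; apply/negP => /ltW xy.
  by have : D (x, y) by []; rewrite D0.
have [z1 _ zmax] := compact_EVT_max D0 cD (continuous_subspaceT cg).
have [z2 z2D zmin] := compact_EVT_min D0 cD (continuous_subspaceT cq).
have qm : 0 < q z2.
  rewrite lt_neqAle q0 andbT; apply/eqP => /esym; move: z2D; rewrite inE.
  case: z2 {zmin} => x y [[/= Ax Ay]] + /(qeq _ _ Ax Ay) xy.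
  by rewrite /g /= xy subrr normr0 leNgt e0.
have C0 : 0 <= g z1 / q z2 by rewrite divr_ge0 ?normr_ge0.
exists (g z1 / q z2) => // x y Ax Ay.
have [xy|xy] := ltP `|f x - f y| eps.
  by apply: (le_trans (ltW xy)); rewrite lerDl mulr_ge0.
have xyD : (x, y) \in D by rewrite inE.
apply: (le_trans (zmax _ xyD)).
apply: (@le_trans _ _ (g z1 / q z2 * q (x, y))); last by rewrite lerDr ltW.
by rewrite mulrAC ler_pdivlMr // ler_wpM2l ?normr_ge0 // zmin.
Qed.

Lemma weierstrass01 (f : R -> R) (eps : R) : continuous f -> 0 < eps ->
  exists b : {poly R}, forall x, 0 <= x <= 1 -> `|b.[x] - f x| <= eps.
Proof.
move=> cf e0; have e20 : 0 < eps / 2 by rewrite divr_gt0.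
have csq : continuous (fun z : R * R => (z.1 - z.2) ^+ 2).
  by move=> z; apply: cvgM; apply: cvgB; (exact: cvg_fst || exact: cvg_snd).
have [C C0 HC] : exists2 C, 0 <= C & forall u v, 0 <= u <= 1 -> 0 <= v <= 1 ->
    `|f u - f v| <= eps / 2 + C * (u - v) ^+ 2.
  have [||C C0 HC] := compact_modulus (@segment_compact R 0 1) cf csq _ _ e20.
  - by move=> z; exact: sqr_ge0.
  - by move=> u v _ _ /eqP; rewrite sqrf_eq0 subr_eq0 => /eqP.
  by exists C => // u v u01 v01; apply: HC; rewrite /= in_itv.
pose n := (Num.truncn (C / (eps / 2))).+1.
have nC : C / n%:R <= eps / 2.
  have : C / (eps / 2) < n%:R by exact: truncnS_gt.
  by rewrite ltr_pdivrMr // mulrC => /ltW; rewrite ler_pdivrMr ?ltr0n.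
pose g (k : nat) := f (k%:R / n%:R).
exists (bernstein n g) => x x01.
pose q (k : nat) := (k%:R - n%:R * x) ^+ 2.
have n0 : n%:R != 0 :> R by rewrite pnatr_eq0.
have gq k : (k <= n)%N -> `|g k - f x| <= eps / 2 + C / n%:R ^+ 2 * q k.
  move=> kn; have k01 : 0 <= (k%:R / n%:R : R) <= 1.
    by rewrite divr_ge0 //= ler_pdivrMr ?ltr0n // mul1r ler_nat.
  apply: (le_trans (HC _ _ k01 x01)); rewrite lerD2l /q le_eqVlt; apply/orP; left; apply/eqP.
  by field.
have E c d : (bernstein n (fun k => c * (fun=> 1) k + d * q k)).[x] = c + d * (n%:R * x * (1 - x)).
  by rewrite bernstein_lin bernstein_cst bernstein_variance subrr expr0n addr0 mulr1.
have up : (bernstein n g).[x] <= (f x + eps / 2) + C / n%:R ^+ 2 * (n%:R * x * (1 - x)).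
  rewrite -E; apply: bernstein_le => // k kn.
  have := gq k kn; rewrite ler_distl => /andP[_] /= H; rewrite mulr1; lra.
have lo : (f x - eps / 2) + (- (C / n%:R ^+ 2)) * (n%:R * x * (1 - x)) <= (bernstein n g).[x].
  rewrite -E; apply: bernstein_le => // k kn.
  have := gq k kn; rewrite ler_distl => /andP[H _]; rewrite mulr1; lra.
have var : C / n%:R ^+ 2 * (n%:R * x * (1 - x)) <= eps / 2.
  apply: le_trans nC.
  have -> : C / n%:R ^+ 2 * (n%:R * x * (1 - x)) = C / n%:R * (x * (1 - x)) by field.
  rewrite -[leRHS]mulr1 ler_wpM2l ?divr_ge0 //.
  by move/andP: x01 => [x0 x1]; rewrite mulr_ile1 ?subr_ge0 // lerBlDr lerDl.
rewrite ler_distl; apply/andP; split; lra.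
Qed.

Lemma weierstrass (f : R -> R) (eps : R) : continuous f -> 0 < eps ->
  exists b : {poly R}, forall x, -1 <= x <= 1 -> `|b.[x] - f x| <= eps.
Proof.
move=> cf e0.
have cg : continuous (fun x : R => f (2 * x - 1)).
  move=> x; apply: (@continuous_comp _ _ _ (fun x : R => 2 * x - 1) f); last exact: cf.
  by apply: cvgB; [apply: cvgM; [exact: cvg_cst|exact: cvg_id]|exact: cvg_cst].
have [b Hb] := weierstrass01 cg e0.
exists (b \Po (2^-1 *: ('X + 1))) => x x1.
have := Hb (2^-1 * (x + 1)).
have -> : 2 * (2^-1 * (x + 1)) - 1 = x by field.
rewrite horner_comp !hornerE; apply.
by case/andP: x1 => ? ?; apply/andP; split; lra.
Qed.
End weierstrass.

Section zonal_poly.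
Variable R : realType.
Implicit Types b : {poly R}.

Lemma legendre_split_monomial n :
  exists a : {poly R}, exists c : R, 'X^n = c%:P + ((1 - 'X^2) * a)^`().
Proof.
suff : (exists a : {poly R}, exists c : R, 'X^n = c%:P + ((1 - 'X^2) * a)^`()) /\
       (exists a : {poly R}, exists c : R, ('X^(n.+1) : {poly R}) = c%:P + ((1 - 'X^2) * a)^`()) by case.
elim: n => [|n [ih1 ih2]].
  split.
    by exists 0, 1; rewrite mulr0 deriv0 addr0 expr0.
  exists (- (2^-1)%:P), 0.
  rewrite derivM derivN derivC oppr0 mulr0 addr0 derivB derivXn derivC sub0r expr1.
  rewrite add0r mulrNN mulr2n mulrDl -mulrDr.
  rewrite -polyCD [X in X%:P](_ : _ = 1 :> R); last by field.
  by rewrite mulr1.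
split=> //; have [a [c E]] := ih1.
pose q : R := n.+3%:R^-1.
have q0 : n.+3%:R * q = 1 by rewrite /q divff // pnatr_eq0.
exists ((n.+1%:R * q) *: a - q *: 'X^(n.+1)), (n.+1%:R * q * c).
rewrite mulrBr -!scalerAr derivB !derivZ.
have -> : ((1 - 'X^2) * a)^`() = 'X^n - c%:P by rewrite E addrAC subrr add0r.
rewrite mulrBl mul1r -exprD derivB !derivXn add2n /=.
have q0' : (n.+3%:R : {poly R}) * q%:P = 1 by rewrite -[_%:R](rmorph_nat polyC) -polyCM q0.
rewrite -!mul_polyC -(mulr_natl 'X^n) -(mulr_natl 'X^_) !polyCM !(rmorph_nat polyC).
move: q0'; set P := 'X^n; set Q := 'X^_.
move: (n.+1%:R : {poly R}) (n.+3%:R : {poly R}) (q%:P) (c%:P) P Q => N1 N3 q' c' P Q q0'.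
transitivity (N3 * q' * Q); first by rewrite q0' mul1r.
by ring.
Qed.

(** On polynomials, the range of the divergence of zonal fields has codimension
one, the constants being a complement. *)
Lemma legendre_split b : exists a : {poly R}, exists c : R, b = c%:P + ((1 - 'X^2) * a)^`().
Proof.
rewrite -[b]coefK poly_def.
elim/big_ind: _ => [|x y [a [c ->]] [a' [c' ->]]|i _].
- by exists 0, 0; rewrite mulr0 deriv0 addr0.
- by exists (a + a'), (c + c'); rewrite mulrDr derivD polyCD addrACA.
have [a [c ->]] := legendre_split_monomial i.
exists (b`_i *: a), (b`_i * c).
by rewrite scalerDr -scalerAr derivZ polyCM mul_polyC.
Qed.
End zonal_poly.

Section segment.
Variable R : realType.
Local Notation leb := (@lebesgue_measure R).

Lemma measurable_seg (a b : R) : measurable (`[a, b]%classic : set (measurableTypeR R)).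
Proof. exact: measurable_itv. Qed.

Lemma Rintegral_seg_cst (a b c : R) : a <= b -> \int[leb]_(x in `[a, b]) c = c * (b - a).
Proof.
move=> ab; rewrite Rintegral_cst; last exact: measurable_seg.
congr (_ * _).
have E : leb `[a, b]%classic = (b - a)%:E.
  rewrite lebesgue_measure_itv /= lte_fin; case: ltP => //= ba.
  by rewrite (le_anti (introT andP (conj ab ba))) subrr.
by rewrite [X in fine X]E.
Qed.

Lemma le_Rintegral_seg (f g : R -> R) a b : continuous f -> continuous g ->
  (forall x, a <= x <= b -> f x <= g x) ->
  \int[leb]_(x in `[a, b]) f x <= \int[leb]_(x in `[a, b]) g x.
Proof.
move=> cf cg fg; apply: le_Rintegral; first exact: measurable_seg.
- exact: continuous_integrable_seg.
- exact: continuous_integrable_seg.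
- by move=> x; rewrite /= in_itv /= => xab; exact: fg.
Qed.

Lemma Rintegral_seg_bound (f : R -> R) a b M : a <= b -> continuous f ->
  (forall x, a <= x <= b -> `|f x| <= M) ->
  `|\int[leb]_(x in `[a, b]) f x| <= M * (b - a).
Proof.
move=> ab cf fM; rewrite -Rintegral_seg_cst //.
apply: (le_trans (le_normr_Rintegral (measurable_seg a b) (continuous_integrable_seg _ _ cf))).
apply: le_Rintegral_seg => //; last by move=> x; exact: cvg_cst.
by move=> x; apply: cvg_norm; exact: cf.
Qed.
End segment.

Section zonal_integration.
Variable R : realType.
Local Notation V := 'rV[R]_3.
Local Notation S2 := (S2 R).
Local Notation leb := (@lebesgue_measure R).
Local Notation dV := (@area R).
Variable p : V.
Hypothesis pp : dot p p = 1.
Implicit Types (x : S2).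
Local Notation s x := (sdot p x).

Lemma dot_perp x : dot (p - s x *: val x) (p - s x *: val x) = 1 - s x ^+ 2.
Proof.
rewrite !(dotBl, dotBr, dotZl, dotZr) pp dot_val (dotC p) -/(sdot p x); ring.
Qed.

Lemma sdot_le1 x : -1 <= s x <= 1.
Proof.
rewrite -ler_norml -[leRHS]sqrtr1 -sqrtr_sqr ler_wsqrtr //.
by rewrite -subr_ge0 -dot_perp dot_ge0.
Qed.

Lemma perp_le x i : `|(p - s x *: val x) 0 i| <= 1.
Proof.
have : (p - s x *: val x) 0 i ^+ 2 <= 1.
  apply: (@le_trans _ _ (1 - s x ^+ 2)); last by rewrite lerBlDr lerDl sqr_ge0.
  rewrite -dot_perp /dot (bigD1 i) //= -expr2 lerDl.
  by apply: sumr_ge0 => k _; rewrite -expr2 sqr_ge0.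
by rewrite -[X in _ <= X -> _](expr1n _ 2) -real_normK ?num_real // ler_pXn2r ?nnegrE.
Qed.

Lemma smooth_field_zonal (a : {poly R}) : smooth_field (zonal (horner a) p).
Proof.
split=> [|i k]; first exact: zonal_tangent.
apply: (CkS2_zonal (h := fun n => horner (a^`(n)))) => n x _.
exact: continuous_horner.
Qed.

Lemma smooth_zonal (a : {poly R}) k : CkS2 k (fun x => a.[s x]).
Proof.
apply: (CkS2_comp (h := fun n => horner (a^`(n)))); first exact: CkS2_sdot.
by move=> n x _; exact: continuous_horner.
Qed.

Lemma div_zonal_poly (a : {poly R}) x :
  div (zonal (horner a) p) x = (((1 - 'X^2) * a)^`()).[s x].
Proof.
rewrite (div_zonal pp (smooth_zonal a 1) (is_derive_poly a (s x))).
by rewrite derivM derivB derivXn derivC !hornerE /=; ring.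
Qed.

Lemma Rintegral_zonal_div (a : {poly R}) : \int[dV]_x (((1 - 'X^2) * a)^`()).[s x] = 0.
Proof.
rewrite -(divergence_theorem (@zonal_tangent _ (horner a) p)); last first.
  by move=> i; exact: (smooth_field_zonal a).2.
by apply: eq_Rintegral => x _; rewrite div_zonal_poly.
Qed.

Lemma area_cst (c : R) : \int[dV]_x c = c * (4 * pi).
Proof. by rewrite Rintegral_cst // -/(total_area R) total_areaE. Qed.

Lemma itv_poly_div (a : {poly R}) c :
  \int[leb]_(u in `[-1, 1]) (c%:P + ((1 - 'X^2) * a)^`()).[u] = 2 * c.
Proof.
transitivity ((c *: 'X + (1 - 'X^2) * a).[1] - (c *: 'X + (1 - 'X^2) * a).[-1]); last first.
  by rewrite !hornerE; ring.
apply: Rintegral_FTC2.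
- by rewrite (lt_trans (ltrN10 _)).
- exact: continuous_horner.
- exact: continuous_horner.
- move=> u _; apply: is_derive_congr (is_derive_poly _ _).
  by rewrite derivD derivZ derivX alg_polyC.
Qed.

Lemma comp_sdot_measurable (f : R -> R) : continuous f -> measurable_fun setT (fun x => f (s x)).
Proof.
move=> cf; apply: continuous_measurable_S2 => x.
apply: (@continuous_comp _ _ _ (sdot p) f); last exact: cf.
exact: CkS2_continuous (CkS2_sdot 0 p) x.
Qed.

Lemma CkS2_comp0 (f : R -> R) : continuous f -> CkS2 0 (fun x => f (s x)).
Proof.
move=> cf; apply: (CkS2_comp (h := fun=> f)) => //; first exact: CkS2_sdot.
by move=> n x _; exact: cf.
Qed.

Lemma Rintegral_bound (f : S2 -> R) M : measurable_fun setT f -> (forall x, `|f x| <= M) ->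
  `|\int[dV]_x f x| <= M * (4 * pi).
Proof.
move=> mf fM; have intf := bounded_integrable mf fM.
apply: (le_trans (le_normr_Rintegral measurableT intf)).
rewrite -area_cst; apply: le_Rintegral => //.
- by have := integrable_norm intf.
- by apply: CkS2_integrable; exact: CkS2_cst.
Qed.

(** Archimedes' theorem on the areas of zones, for any axis p. The cylindrical
chart has a fixed axis; instead of rotating it, the polynomial case is deduced
from the divergence theorem by [legendre_split], and the rest by approximation. *)
Lemma zonal_int (f : R -> R) : continuous f ->
  \int[dV]_x f (s x) = 2 * pi * \int[leb]_(u in `[-1, 1]) f u.
Proof.
move=> cf; apply/eqP; rewrite -subr_eq0 -normr_le0; apply/ler_addgt0Pl => eps e0.
rewrite addr0.
pose d := eps / (8 * pi).
have pi0 : 0 < pi :> R by exact: pi_gt0.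
have d0 : 0 < d by rewrite divr_gt0 ?mulr_gt0.
have [b Hb] := weierstrass cf d0.
have [a [c bE]] := legendre_split b.
have cb := @continuous_horner _ b.
have Eb : \int[dV]_x b.[s x] = 2 * pi * \int[leb]_(u in `[-1, 1]) b.[u].
  rewrite [in RHS]bE itv_poly_div.
  transitivity (\int[dV]_x (c + (((1 - 'X^2) * a)^`()).[s x])).
    by apply: eq_Rintegral => x _; rewrite {1}bE !hornerE.
  rewrite RintegralD //; last 2 first.
  - by apply: CkS2_integrable; exact: CkS2_cst.
  - by apply: CkS2_integrable; exact: smooth_zonal.
  by rewrite area_cst Rintegral_zonal_div addr0; ring.
have E1 : `|\int[dV]_x (b.[s x] - f (s x))| <= d * (4 * pi).
  apply: Rintegral_bound => [|x]; last by apply: Hb; exact: sdot_le1.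
  by apply: measurable_funB; exact: comp_sdot_measurable.
have E2 : `|\int[leb]_(u in `[-1, 1]) (b.[u] - f u)| <= d * 2.
  have cbf : continuous (fun u => b.[u] - f u) by move=> u; apply: cvgB; [exact: cb|exact: cf].
  have -> : d * 2 = d * (1 - (-1)) by ring.
  exact: Rintegral_seg_bound.
move: E1 E2; rewrite !RintegralB //; try exact: continuous_integrable_seg;
  try (by apply: CkS2_integrable; exact: CkS2_comp0).
rewrite Eb; set I := Rintegral _ _ _; set J := Rintegral _ _ _; set K := Rintegral _ _ _.
move=> E1 E2.
have -> : J - 2 * pi * K = - (2 * pi * I - J) + 2 * pi * (I - K) by ring.
apply: (le_trans (ler_normD _ _)); rewrite normrN normrM (gtr0_norm (mulr_gt0 _ pi0)) //.
have -> : eps = d * (4 * pi) + 2 * pi * (d * 2).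
  transitivity (d * (8 * pi)); first by rewrite /d divfK // gt_eqF ?mulr_gt0.
  by ring.
by apply: lerD => //; rewrite ler_pM2l ?mulr_gt0.
Qed.

Lemma Lfun2_integrable_S2 (f : S2 -> R) : f \in Lfun dV 2%:E -> dV.-integrable setT (EFin \o f).
Proof. by move=> /(Lfun_subset12 (area_fin_num R)) /Lfun1_integrable. Qed.

Lemma bounded_Lfun2 (f : S2 -> R) M : measurable_fun setT f -> (forall x, `|f x| <= M) ->
  f \in Lfun dV 2%:E.
Proof.
move=> mf fM.
have M0 : 0 <= M by exact: le_trans (fM (north R)).
rewrite inE; apply/andP; split; first by rewrite inE.
rewrite inE /= /finite_norm unlock /Lnorm; apply: poweR_lty.
have mf2 : measurable_fun setT (fun x => `|f x| `^ 2).
  by apply: (measurableT_comp (measurable_powR _)) => //; exact: measurableT_comp.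
have bf2 x : `| `|f x| `^ 2 | <= M ^+ 2.
  by rewrite ger0_norm ?powR_ge0 // powR_mulrn // ler_pXn2r ?nnegrE.
have /integrableP[_] := bounded_integrable mf2 bf2.
apply: le_lt_trans; rewrite le_eqVlt; apply/orP; left; apply/eqP.
by apply: eq_integral => x _; rewrite /comp abse_EFin abse_EFin poweR_EFin (ger0_norm (powR_ge0 _ _)).
Qed.

Lemma integrable_mul_bounded (f g : S2 -> R) M : dV.-integrable setT (EFin \o f) ->
  measurable_fun setT g -> (forall x, `|g x| <= M) ->
  dV.-integrable setT (EFin \o (fun x => f x * g x)).
Proof.
move=> intf mg gM.
have := integrableMl measurableT intf mg; apply.
by exists M; split; [exact: num_real|move=> N MN x _; exact: le_trans (gM x) (ltW MN)].
Qed.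

Lemma Rintegral_mul_bound (f g : S2 -> R) M : dV.-integrable setT (EFin \o f) ->
  measurable_fun setT g -> (forall x, `|g x| <= M) ->
  `|\int[dV]_x (f x * g x)| <= M * \int[dV]_x `|f x|.
Proof.
move=> intf mg gM; have intfg := integrable_mul_bounded intf mg gM.
apply: (le_trans (le_normr_Rintegral measurableT intfg)).
have intnf : dV.-integrable setT (EFin \o (fun x => `|f x|)) by exact: integrable_norm.
rewrite -RintegralZl //; apply: le_Rintegral => //.
- by have := integrable_norm intfg.
- by have := integrableZl measurableT M intnf.
- by move=> x _; rewrite normrM mulrC ler_wpM2r.
Qed.

(** The divergence theorem for the product of the function with a test field. *)
Lemma weak_gradient_zonal (f a : R -> R) : continuous a ->
  (forall u : R, -1 <= u <= 1 -> is_derive u 1 f (a u)) ->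
  weak_gradient (fun x => f (s x)) (zonal a p).
Proof.
move=> ca df.
have Cf : CkS2 1 (fun x => f (s x)).
  apply: (CkS2_comp (h := fun n => if n is 0%N then f else a)); first exact: CkS2_sdot.
    by move=> [|//] x _; apply: df; exact: sdot_le1.
  move=> [|n] x _; last exact: ca.
  apply: differentiable_continuous; apply/derivable1_diffP.
  by have [] := df _ (sdot_le1 x).
have Cf0 : CkS2 0 (fun x => f (s x)) by exact: (CkS (Cf : Ck 1 _ _)).
have Cz i : CkS2 0 (fun x => zonal a p x 0 i).
  by apply: (CkS2_zonal (h := fun=> a)) => // n x _; exact: ca.
have L0 (g : S2 -> R) : CkS2 0 g -> g \in Lfun dV 2%:E.
  move=> cg; have [M _ gM] := CkS2_bounded cg.
  exact: bounded_Lfun2 (CkS2_measurable cg) gM.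
split.
- exact: L0.
- by move=> i; exact: L0.
- exact: zonal_tangent.
move=> X [tX sX].
have CX i : CkS2 1 (fun x => X x 0 i) by exact: sX.
have CfX i : CkS2 1 (fun x => (f (s x) *: X x) 0 i).
  have -> : (fun x => (f (s x) *: X x) 0 i) = (fun x => f (s x) * X x 0 i).
    by apply/funext => x; rewrite mxE.
  exact: CkS2_mul.
have tfX : tangent (fun x => f (s x) *: X x) by move=> x; rewrite dotZl tX mulr0.
have := divergence_theorem tfX CfX.
have gradE x : grad (fun x => f (s x)) x = zonal a p x.
  by rewrite (grad_comp (CkS2_sdot 1 p) (df _ (sdot_le1 x))) grad_sdot.
have -> : div (fun x => f (s x) *: X x) = (fun x => f (s x) * div X x + dot (zonal a p x) (X x)).
  by apply/funext => x; rewrite div_mul // gradE.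
rewrite RintegralD //.
- by move/eqP; rewrite addr_eq0 => /eqP.
- apply: CkS2_integrable; exact: (CkS2_mul Cf0 (CkS2_div CX)).
- apply: CkS2_integrable.
  apply: (Ck_sum (F := fun i => ext (fun x => zonal a p x 0 i * X x 0 i))); first exact: open_punctured.
  by move=> i; have := CkS2_mul (Cz i) (sX i 0%N); rewrite /CkS2.
Qed.

Lemma perp_eq0 x i : s x ^+ 2 = 1 -> (p - s x *: val x) 0 i = 0.
Proof.
move=> s1; have /eqP := dot_perp x; rewrite s1 subrr dot_eq0 => /eqP ->.
by rewrite mxE.
Qed.

(** The product (1 - u^2) a(u) vanishes at both ends, so the mean value theorem
from the nearer end bounds it by d (1 - |u|); the bound on a is therefore
uniform up to the poles. *)
Lemma zonal_coeff_close (g a : R -> R) d : continuous g -> continuous a ->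
  (forall u : R, -1 < u < 1 -> is_derive u 1 (fun u => (1 - u ^+ 2) * a u) (g u)) ->
  (forall u, -1 <= u <= 1 -> `|g u| <= d) ->
  forall u, -1 < u < 1 -> `|a u| <= d.
Proof.
move=> cg ca dF gd u /andP[u1 u2].
have d0 : 0 <= d by apply: le_trans (gd 0 _); rewrite ?normr_ge0 // ler01 lerN10.
pose F u := (1 - u ^+ 2) * a u.
have cF : continuous F.
  move=> v; apply: cvgM; last exact: ca.
  by apply: cvgB; [exact: cvg_cst|exact: exprn_continuous].
have F1 : F 1 = 0 by rewrite /F expr1n subrr mul0r.
have FN1 : F (-1) = 0 by rewrite /F sqrrN expr1n subrr mul0r.
have L : `|F u| <= d * (1 + u).
  have [c cI E] := @MVT_segment _ F g (-1) u (ltW u1)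
    (fun v vI => dF v (ltac:(move: vI; rewrite in_itv /= => /andP[v1 v2]; by rewrite v1 (lt_trans v2))))
    (continuous_subspaceT cF).
  rewrite FN1 subr0 opprK addrC in E; rewrite E normrM (@ger0_norm _ (1 + u)); last by rewrite -lerBlDl sub0r ltW.
  apply: ler_wpM2r; first by rewrite -lerBlDl sub0r ltW.
  by apply: gd; move: cI; rewrite in_itv /= => /andP[-> v2]; rewrite (le_trans v2) // ltW.
have U : `|F u| <= d * (1 - u).
  have [c cI E] := @MVT_segment _ F g u 1 (ltW u2)
    (fun v vI => dF v (ltac:(move: vI; rewrite in_itv /= => /andP[v1 v2]; by rewrite v2 (lt_trans u1))))
    (continuous_subspaceT cF).
  rewrite F1 sub0r in E; rewrite -normrN E normrM (@ger0_norm _ (1 - u)); last by rewrite subr_ge0 ltW.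
  apply: ler_wpM2r; first by rewrite subr_ge0 ltW.
  by apply: gd; move: cI; rewrite in_itv /= => /andP[v1 ->]; rewrite (le_trans _ v1) // ltW.
have u3 : 0 < 1 - u by rewrite subr_gt0.
have u4 : 0 < 1 + u by rewrite -ltrBlDl sub0r.
have FE : `|F u| = (1 - u) * (1 + u) * `|a u|.
  by rewrite /F normrM gtr0_norm; [congr (_ * _); ring|rewrite (_ : 1 - u ^+ 2 = (1 - u) * (1 + u)) ?mulr_gt0 //; ring].
rewrite FE in L U.
have [uge|ult] := lerP 0 u.
  have : (1 - u) * ((1 + u) * `|a u|) <= (1 - u) * d by rewrite mulrA (le_trans U) // mulrC.
  rewrite ler_pM2l // => /(le_trans _); apply.
  by rewrite ler_peMl // lerDl.
have : (1 + u) * ((1 - u) * `|a u|) <= (1 + u) * d.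
  by rewrite mulrA [X in X * _]mulrC (le_trans L) // mulrC.
rewrite ler_pM2l // => /(le_trans _); apply.
by rewrite ler_peMl //; lra.
Qed.

(** The definition of a weak gradient allows only smooth test fields. The
function f is approximated by a polynomial, its mean is removed, and
[zonal_coeff_close] makes the corresponding polynomial field close to the given
one. *)
Lemma zonal_weak (f a : R -> R) (phi : S2 -> R) (z : S2 -> V) :
  continuous f -> continuous a ->
  (forall u : R, -1 < u < 1 -> is_derive u 1 (fun u => (1 - u ^+ 2) * a u) (f u)) ->
  weak_gradient phi z ->
  \int[dV]_x (f (s x) * phi x) = - \int[dV]_x dot (zonal a p x) (z x).
Proof.
move=> cf ca dF [Lphi Lz tz wz].
have Iphi := Lfun2_integrable_S2 Lphi.
have Iz i := Lfun2_integrable_S2 (Lz i).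
have ca2 : continuous (fun u : R => (1 - u ^+ 2) * a u).
  move=> v; apply: cvgM; last exact: ca.
  by apply: cvgB; [exact: cvg_cst|exact: exprn_continuous].
have mz1 (h : R -> R) i : continuous h -> measurable_fun setT (fun x => zonal h p x 0 i).
  move=> ch; apply: CkS2_measurable.
  by apply: (CkS2_zonal (h := fun=> h)) => // n x _; exact: ch.
have bz (h : R -> R) i : continuous h -> exists M, forall x, `|zonal h p x 0 i| <= M.
  move=> ch; have Cz : CkS2 0 (fun x => zonal h p x 0 i).
    by apply: (CkS2_zonal (h := fun=> h)) => // n x _; exact: ch.
  by have [M _ HM] := CkS2_bounded Cz; exists M.
have dotI (h : R -> R) : continuous h ->
    \int[dV]_x dot (zonal h p x) (z x) = \sum_(i < 3) \int[dV]_x (z x 0 i * zonal h p x 0 i) /\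
    forall i, dV.-integrable setT (EFin \o (fun x => z x 0 i * zonal h p x 0 i)).
  move=> ch; have Ii i : dV.-integrable setT (EFin \o (fun x => z x 0 i * zonal h p x 0 i)).
    by have [M HM] := bz h i ch; apply: integrable_mul_bounded HM => //; exact: mz1.
  split=> //; rewrite sum3E.
  transitivity (\int[dV]_x ((z x 0 0 * zonal h p x 0 0 + z x 0 1 * zonal h p x 0 1) + z x 0 2 * zonal h p x 0 2)).
    by apply: eq_Rintegral => x _; rewrite dotC dot3E.
  rewrite RintegralD //; last by have := integrableD measurableT (Ii 0) (Ii 1).
  by rewrite RintegralD.
apply/eqP; rewrite -subr_eq0 opprK -normr_le0; apply/ler_addgt0Pl => eps e0; rewrite addr0.
pose N := \int[dV]_x `|phi x| + \sum_(i < 3) \int[dV]_x `|z x 0 i|.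
have N0 : 0 <= N by rewrite addr_ge0 ?sumr_ge0 // => *; apply: Rintegral_ge0 => *.
have N1 : 0 < N + 1 by rewrite ltr_wpDl.
pose d := eps / (2 * (N + 1)).
have d0 : 0 < d by rewrite divr_gt0 ?mulr_gt0.
have [b Hb] := weierstrass cf d0.
have [A [c bE]] := legendre_split b.
have cb := @continuous_horner _ b.
have cA := @continuous_horner _ A.
have If0 : \int[leb]_(u in `[-1, 1]) f u = 0.
  transitivity ((1 - 1 ^+ 2) * a 1 - (1 - (-1) ^+ 2) * a (-1)).
    by apply: (Rintegral_FTC2 (F := fun u => (1 - u ^+ 2) * a u)) => //; rewrite (lt_trans (ltrN10 _)).
  by rewrite sqrrN expr1n subrr !mul0r subrr.
have cbf : continuous (fun u => b.[u] - f u) by move=> u; apply: cvgB; [exact: cb|exact: cf].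
have cd : `|c| <= d.
  have : `|\int[leb]_(u in `[-1, 1]) (b.[u] - f u)| <= d * (1 - (-1)).
    by apply: Rintegral_seg_bound => //; rewrite ltW // (lt_trans (ltrN10 _)).
  rewrite RintegralB //; try exact: continuous_integrable_seg.
  rewrite If0 subr0 [in X in X -> _]bE itv_poly_div normrM ger0_norm //.
  by rewrite opprK -[1 + 1]/(2%:R) [_ * 2]mulrC ler_pM2l.
have aA u : -1 < u < 1 -> `|A.[u] - a u| <= 2 * d.
  move=> u1; have := @zonal_coeff_close (fun u => b.[u] - c - f u) (fun u => A.[u] - a u) (2 * d).
  move=> H; apply: H u1 => {u}.
  - move=> v; apply: cvgB; last exact: cf.
    by apply: cvgB; [exact: cb|exact: cvg_cst].
  - by move=> v; apply: cvgB; [exact: cA|exact: ca].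
  - move=> v v1.
    have -> : (fun u => (1 - u ^+ 2) * (A.[u] - a u)) =
       horner ((1 - 'X^2) * A) - (fun u => (1 - u ^+ 2) * a u).
      by apply/funext => w; rewrite !fctE !hornerE mulrBr.
    apply: is_derive_congr (is_deriveB (is_derive_poly _ v) (dF v v1)).
    by rewrite [in RHS]bE !hornerE; ring.
  - move=> v v1; have -> : b.[v] - c - f v = (b.[v] - f v) - c by ring.
    rewrite (le_trans (ler_normB _ _)) // mulr_natl mulr2n lerD //; exact: Hb.
have wA := wz _ (smooth_field_zonal A).
have [DA IA] := dotI _ cA; have [Da Ia] := dotI _ ca.
have divA : \int[dV]_x (phi x * div (zonal (horner A) p) x) = \int[dV]_x (phi x * (b.[s x] - c)).
  apply: eq_Rintegral => x _; rewrite div_zonal_poly; congr (_ * _).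
  have := congr1 (fun q => q.[s x]) bE; rewrite hornerD hornerC => ->; ring.
rewrite divA in wA.
have wA' : \int[dV]_x (phi x * (b.[s x] - c)) + \sum_(i < 3) \int[dV]_x (z x 0 i * (zonal (horner A) p x 0 i)) = 0.
  rewrite wA -DA; apply/eqP; rewrite addrC subr_eq0; apply/eqP.
  by apply: eq_Rintegral => x _; rewrite dotC.
have bnd (g : R -> R) : continuous g -> exists M, forall x, `|g (s x)| <= M.
  by move=> cg; have [M _ HM] := CkS2_bounded (CkS2_comp0 cg); exists M.
have Iphig (g : R -> R) : continuous g -> dV.-integrable setT (EFin \o (fun x => phi x * g (s x))).
  move=> cg; have [M HM] := bnd g cg.
  by apply: integrable_mul_bounded HM => //; exact: comp_sdot_measurable.
have cbc : continuous (fun u => b.[u] - c) by move=> u; apply: cvgB; [exact: cb|exact: cvg_cst].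
have -> : \int[dV]_x (f (s x) * phi x) = \int[dV]_x (phi x * f (s x)).
  by apply: eq_Rintegral => x _; rewrite mulrC.
rewrite Da -[X in `|X|]subr0 -[X in _ - X]wA' opprD addrACA -sumrB.
rewrite -RintegralB //; [|exact: Iphig|exact: (Iphig _ cbc)].
have -> : eps = 2 * d * (N + 1) by rewrite /d; field; rewrite ?gt_eqF.
apply: (@le_trans _ _ (2 * d * N)); last by move: (N) => N'; lra.
rewrite /N mulrDr mulr_sumr; apply: (le_trans (ler_normD _ _)); apply: lerD.
  under eq_Rintegral do rewrite -mulrBr.
  apply: Rintegral_mul_bound => //.
    apply: measurable_funB; first exact: comp_sdot_measurable.
    exact: (comp_sdot_measurable (f := fun u => b.[u] - c)).
  move=> x; have -> : f (s x) - (b.[s x] - c) = c - (b.[s x] - f (s x)) by ring.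
  rewrite (le_trans (ler_normB _ _)) // mulr_natl mulr2n lerD //; apply: Hb; exact: sdot_le1.
apply: (le_trans (ler_norm_sum _ _ _)); apply: ler_sum => i _.
rewrite -RintegralB //.
under eq_Rintegral do rewrite -mulrBr.
apply: Rintegral_mul_bound => //; first by apply: measurable_funB; exact: mz1.
move=> x; rewrite /zonal !mxE -mulrBl normrM.
have := sdot_le1 x; rewrite le_eqVlt => /andP[/orP[/eqP s1|s1] s2].
  have := @perp_eq0 x i; rewrite -s1 sqrrN expr1n => /(_ erefl); rewrite !mxE => ->.
  by rewrite normr0 mulr0 mulr_ge0 // ltW.
move: s2; rewrite le_eqVlt => /orP[/eqP s2|s2].
  have := @perp_eq0 x i; rewrite s2 expr1n => /(_ erefl); rewrite !mxE => ->.
  by rewrite normr0 mulr0 mulr_ge0 // ltW.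
rewrite -[leRHS]mulr1; apply: ler_pM => //.
  by rewrite distrC; apply: aA; rewrite s1.
by have := perp_le x i; rewrite !mxE.
Qed.
End zonal_integration.

(** * The Green function away from its pole *)

Section detect.
Variable R : realType.
Local Notation V := 'rV[R]_3.
Local Notation S2 := (S2 R).
Local Notation dV := (@area R).

Lemma dist_fun (C : set V) : closed C -> C !=set0 ->
  exists2 d : V -> R, continuous d & forall x : V, 0 <= d x /\ (d x = 0 <-> C x).
Proof.
move=> cC [c0 Cc0].
pose D (x : V) : set R := [set `|x - w| | w in C].
have D0 x : has_inf (D x).
  split; first by exists `|x - c0|, c0.
  by exists 0 => _ [w _ <-]; exact: normr_ge0.
have lb x : lbound (D x) 0 by move=> _ [w _ <-]; exact: normr_ge0.
pose d x := inf (D x).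
have d_ge0 x : 0 <= d x by apply: lb_le_inf; [exact: (D0 x).1|exact: lb].
have d_le x w : C w -> d x <= `|x - w| by move=> Cw; apply: ge_inf; [exact: (D0 x).2|exists w].
have lip x y : d x <= `|x - y| + d y.
  rewrite -lerBlDl; apply: lb_le_inf; first exact: (D0 y).1.
  move=> _ [w Cw <-]; rewrite lerBlDl.
  apply: (le_trans (d_le x w Cw)); apply: le_trans (ler_normD _ _).
  by rewrite addrA subrK.
exists d.
  move=> x; have FF := @nbhs_filter V x; apply/cvgrPdist_le => e e0; near=> y.
  have xy : `|x - y| <= e by near: y; exact: cvgr_dist_le.
  rewrite ler_distl; apply/andP; split.
    by rewrite lerBlDr (le_trans (lip y x)) // addrC lerD2l distrC.
  by rewrite (le_trans (lip x y)) // addrC lerD2l.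
move=> x; split=> //; split=> [dx0|Cx]; last first.
  by apply/le_anti; rewrite d_ge0 andbT (le_trans (d_le x x Cx)) // subrr normr0.
apply: contrapT => nCx.
have /nbhs_ballP[e /= e0 eC] : nbhs x (~` C).
  by apply: open_nbhs_nbhs; split; [exact: closed_openC|].
have : e <= d x.
  apply: lb_le_inf; first exact: (D0 x).1.
  move=> _ [w Cw <-]; rewrite leNgt; apply/negP => wx.
  by apply: (eC w) => //; rewrite -ball_normE.
by rewrite dx0 leNgt e0.
Unshelve. all: by end_near. Qed.

Implicit Types (x : S2) (U : set S2).

Lemma open_cutoff U : open U -> U <> setT ->
  exists2 d : S2 -> R, continuous d & forall x, 0 <= d x /\ (d x = 0 <-> ~ U x).
Proof.
move=> [W oW WU] UT.
have W0 : ~` W !=set0.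
  apply: contrapT => WT; apply: UT; rewrite -WU; apply/seteqP; split=> // x _.
  by apply: contrapT => nW; apply: WT; exists (val x).
have [d cd dE] := dist_fun (open_closedC oW) W0.
exists (d \o val).
  by move=> x; apply: continuous_comp; [exact: val_continuous|exact: cd].
move=> x; split; first exact: (dE _).1.
by rewrite -WU; exact: (dE _).2.
Qed.

(** The indicator function of an open set is a limit of continuous functions. *)
Lemma area_open_integral0 (F : S2 -> R) U : dV.-integrable setT (EFin \o F) ->
  (forall chi : S2 -> R, continuous chi -> \int[dV]_x (F x * chi x) = 0) ->
  open U -> (\int[dV]_(x in U) (F x)%:E = 0)%E.
Proof.
move=> iF F0 oU.
have mF : measurable_fun setT F by have /measurable_int/measurable_EFinP := iF.
have mU : measurable U by apply: sub_sigma_algebra.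
have [UT|UT] := pselect (U = setT).
  have c1 : continuous ((fun=> 1) : S2 -> R) by move=> x; exact: cst_continuous.
  have E : \int[dV]_x F x = 0 by rewrite -(F0 _ c1); apply: eq_Rintegral => x _; rewrite mulr1.
  have {}E := congr1 EFin E; rewrite -[RHS]E UT /Rintegral fineK //; exact: integrable_fin_num.
have [d cd dE] := open_cutoff oU UT.
pose chi (n : nat) x : R := Num.min 1 (n%:R * d x).
have cchi n : continuous (chi n).
  move=> x; apply: (@continuous_min _ _ (fun=> 1 : R) (fun x => n%:R * d x)).
    exact: cst_continuous.
  have FF := @nbhs_filter S2 x.
  by apply: cvgM; [exact: cvg_cst|exact: cd].
have chi01 n x : 0 <= chi n x <= 1.
  by rewrite /chi le_min ler01 mulr_ge0 ?(dE x).1 // ge_min lexx.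
have E0 n : (\int[dV]_x (F x * chi n x)%:E = 0)%E.
  have := congr1 EFin (F0 _ (cchi n)); rewrite /Rintegral fineK //.
  apply: integrable_fin_num => //.
  apply: (integrable_mul_bounded (M := 1)) => //; first exact: continuous_measurable_S2.
  by move=> x; have /andP[c0 c1] := chi01 n x; rewrite ger0_norm.
pose f_ (n : nat) x : \bar R := (F x * chi n x)%:E.
pose f x : \bar R := (F x * \1_U x)%:E.
have mchi n : measurable_fun setT (chi n) by exact: continuous_measurable_S2.
have [] := @dominated_convergence _ _ _ dV setT measurableT f_ f (fun x => `|F x|%:E).
- by move=> n; apply/measurable_EFinP; exact: measurable_funM.
- by apply/measurable_EFinP; apply: measurable_funM => //; exact: measurable_indic.
- apply: aeW => x _; apply: cvg_EFin; first exact: nearW.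
  rewrite /comp; apply: cvgM; first exact: cvg_cst.
  have [d0 dU] := dE x; have [Ux|nUx] := pselect (U x); last first.
    rewrite indicE memNset //; apply: cvg_near_cst; apply: nearW => n.
    by rewrite /chi (dU.2 nUx) mulr0; apply/min_idPr.
  have dx : 0 < d x by rewrite lt_neqAle d0 andbT eq_sym; apply/eqP => /dU.
  rewrite indicE mem_set //; apply: cvg_near_cst.
  exists (Num.truncn (d x)^-1).+1 => // n /= nd; apply/min_idPl.
  rewrite -ler_pdivrMr // mul1r ltW // (lt_le_trans (truncnS_gt _)) // ler_nat //.
- by have := integrable_norm iF.
- apply: aeW => x n _; rewrite /f_ abse_EFin lee_fin normrM.
  have /andP[c0 c1] := chi01 n x; rewrite (ger0_norm c0) -[leRHS]mulr1 ler_wpM2l //.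
move=> _ _ cI.
have I0 : (\int[dV]_x f x = 0)%E.
  apply: (cvg_unique _ cI) => //.
  by apply: cvg_near_cst; apply: nearW => n; exact: E0.
rewrite -I0 [LHS]integral_mkcond; apply: eq_integral => x _.
by rewrite /f patchE indicE; case: ifP => _; rewrite ?mulr1 ?mulr0.
Qed.

(** The fundamental lemma of the calculus of variations. The open sets form a
pi-system that generates the Borel sets. *)
Lemma ae_eq0_of_continuous (F : S2 -> R) : dV.-integrable setT (EFin \o F) ->
  (forall chi : S2 -> R, continuous chi -> \int[dV]_x (F x * chi x) = 0) ->
  {ae dV, forall x, F x = 0}.
Proof.
move=> iF F0.
have mF : measurable_fun setT F by have /measurable_int/measurable_EFinP := iF.
have iFA A : measurable A -> dV.-integrable A (EFin \o F).
  by move=> mA; apply: integrableS iF.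
have FA A : measurable A -> (\int[dV]_(x in A) (F x)%:E = 0)%E.
  move=> mA.
  apply: (@dynkin_induction _ S2 (@open S2) (fun A => \int[dV]_(x in A) (F x)%:E = 0)%E) => //.
  - by move=> B C oB oC; exact: openI.
  - by apply: area_open_integral0 => //; exact: openT.
  - by move=> B oB; exact: area_open_integral0.
  - move=> B mB B0.
    have E : (\int[dV]_x (F x)%:E = 0)%E by apply: area_open_integral0 => //; exact: openT.
    move: E; rewrite -(setUv B) integral_setU_EFin //; last 3 first.
    - exact: measurableC.
    - by rewrite setUv.
    - by apply/disj_setPS; rewrite setICr.
    by rewrite B0 add0e.
  - move=> B mB tB B0; rewrite integral_bigcup //; last first.
      by apply: iFA; exact: bigcupT_measurable.
    by apply: eseries0 => n _ _; exact: B0.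
have := @integral_ae_eq _ _ _ dV setT measurableT (cst 0%E) (EFin \o F) iF (measurable_cst _).
move=> H; have /H {}H : forall E : set S2, E `<=` setT -> measurable E ->
    (\int[dV]_(x in E) (EFin \o F) x = \int[dV]_(x in E) cst 0 x)%E.
  by move=> E _ mE; rewrite integral0; exact: FA.
by apply: filterS H => x /(_ I) [].
Qed.
End detect.

Section green.
Variable R : realType.
Local Notation V := 'rV[R]_3.
Local Notation S2 := (S2 R).
Local Notation leb := (@lebesgue_measure R).
Local Notation dV := (@area R).
Implicit Types (x : S2) (eta u : R).

Lemma pi4_gt0 : 0 < 4 * pi :> R.
Proof. by rewrite mulr_gt0 ?pi_gt0. Qed.

(** The n-th derivative of - ln (1 + eta - u) / (4 pi), which in u = x.y is the
logarithmic Green function with pole outside the sphere. *)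
Definition reglog eta (n : nat) u : R :=
  if n is k.+1 then (k`!)%:R / (4 * pi) * ((1 + eta - u)^-1) ^+ k.+1
  else - (4 * pi)^-1 * ln (1 + eta - u).

(** With u = x.y, an approximate identity on the sphere as eta tends to 0. *)
Definition poisson eta u : R := (2 * eta + eta ^+ 2) / (4 * pi) * ((1 + eta - u)^-1) ^+ 2.

Lemma is_derive_reglog eta u n : u < 1 + eta ->
  is_derive u 1 (reglog eta n) (reglog eta n.+1 u).
Proof.
move=> u1; have D0 : 0 < 1 + eta - u by rewrite subr_gt0.
have dD : is_derive u 1 (fun u : R => 1 + eta - u) (- 1).
  have := is_deriveB (is_derive_cst (1 + eta) u 1) (is_derive_id u 1).
  by rewrite sub0r.
case: n => [|n] /=.
  have := is_deriveZ (- (4 * pi)^-1) (is_derive1_comp (f := @ln R) (g := fun u => 1 + eta - u) (is_derive1_ln D0) dD).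
  apply: is_derive_congr; rewrite fact0 /GRing.scale /= expr1; ring.
have dV1 := is_deriveV (f := fun u => 1 + eta - u) (lt0r_neq0 D0) dD.
have := is_deriveZ ((n`!)%:R / (4 * pi)) (is_deriveX n.+1 dV1).
have -> : reglog eta n.+1 = (n`!%:R / (4 * pi)) \*: (fun u : R => (1 + eta - u)^-1) ^+ n.+1.
  by apply/funext => v; rewrite /reglog /= fctE.
apply: is_derive_congr.
rewrite /GRing.scale /= factS natrM -exprVn (exprS _ n.+1) (exprS _ n).
by move: (n`!%:R) (n.+1%:R) ((4 * pi)^-1) (1 + eta - u)^-1 => A B C D; ring.
Qed.

Lemma continuous_reglog eta u n : u < 1 + eta -> {for u, continuous (reglog eta n)}.
Proof.
move=> u1; apply: differentiable_continuous; apply/derivable1_diffP.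
by have [] := is_derive_reglog n u1.
Qed.

Lemma poisson_ge0 eta u : 0 <= eta -> 0 <= poisson eta u.
Proof.
move=> e0; rewrite /poisson mulr_ge0 ?sqr_ge0 // divr_ge0 ?(ltW pi4_gt0) //.
by rewrite addr_ge0 ?sqr_ge0 ?mulr_ge0.
Qed.

Lemma poisson_le eta u : 0 < eta -> u <= 1 ->
  poisson eta u <= (2 * eta + eta ^+ 2) / (4 * pi) * (eta^-1) ^+ 2.
Proof.
move=> e0 u1; apply: ler_wpM2l.
  by rewrite divr_ge0 ?(ltW pi4_gt0) // addr_ge0 ?sqr_ge0 ?mulr_ge0 // ltW.
have D : eta <= 1 + eta - u by lra.
rewrite ler_pXn2r ?nnegrE ?invr_ge0 ?(ltW e0) ?(le_trans (ltW e0)) //.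
by rewrite lef_pV2 ?posrE // (lt_le_trans e0).
Qed.

(** With the quadratic modulus [sphere_modulus] this replaces an estimate of the
mass far from the pole. *)
Lemma poisson_moment eta u : 0 < eta -> u <= 1 ->
  poisson eta u * (1 - u) ^+ 2 <= (2 * eta + eta ^+ 2) / (4 * pi).
Proof.
move=> e0 u1; have D0 : 0 < 1 + eta - u by lra.
rewrite /poisson -mulrA -[leRHS]mulr1; apply: ler_wpM2l.
  by rewrite divr_ge0 ?(ltW pi4_gt0) // addr_ge0 ?sqr_ge0 ?mulr_ge0 // ltW.
rewrite -exprMn expr_le1 ?mulr_ge0 ?invr_ge0 ?(ltW D0) ?subr_ge0 // mulrC ler_pdivrMr // mul1r; lra.
Qed.

Section pole.
Variables (y : S2) (eta : R).
Hypothesis eta0 : 0 < eta.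
Local Notation s x := (sdot (val y) x).

Lemma sdot_lt x : s x < 1 + eta.
Proof. by have /andP[_ s1] := sdot_le1 (dot_val y) x; rewrite (le_lt_trans s1) // ltrDl. Qed.

Lemma smooth_reglog n : smooth (fun x => reglog eta n (s x)).
Proof.
move=> k.
have := @CkS2_comp _ k (fun i => reglog eta (n + i)) _ (CkS2_sdot k (val y)).
rewrite addn0; apply.
- by move=> i x _; rewrite addnS; apply: is_derive_reglog; exact: sdot_lt.
- by move=> i x _; apply: continuous_reglog; exact: sdot_lt.
Qed.

Lemma grad_reglog x : grad (fun x => reglog eta 0 (s x)) x = zonal (reglog eta 1) (val y) x.
Proof.
by rewrite (grad_comp (CkS2_sdot 1 _) (is_derive_reglog 0 (sdot_lt x))) grad_sdot.
Qed.

Lemma laplace_reglog x :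
  - laplace_beltrami (fun x => reglog eta 0 (s x)) x = poisson eta (s x) - (4 * pi)^-1.
Proof.
rewrite /laplace_beltrami.
have -> : grad (fun x => reglog eta 0 (s x)) = zonal (reglog eta 1) (val y).
  by apply/funext => z; exact: grad_reglog.
rewrite (div_zonal (dot_val y) (smooth_reglog 1 1) (is_derive_reglog 1 (sdot_lt x))).
rewrite /poisson /= !fact0 expr1 [1`!](_ : _ = 1)%N //.
have D0 : 1 + eta - s x != 0 by rewrite gt_eqF // subr_gt0 sdot_lt.
have pi0 : pi != 0 :> R by rewrite gt_eqF ?pi_gt0.
move: (pi : R) pi0 => P P0; field; rewrite P0; exact: D0.
Qed.

Lemma CkS2_poisson k : CkS2 k (fun x => poisson eta (s x)).
Proof.
have -> : (fun x => poisson eta (s x)) = fun x => (2 * eta + eta ^+ 2) * reglog eta 2 (s x).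
  apply/funext => x; rewrite /poisson /= (_ : 1`! = 1)%N //; ring.
by apply: CkS2_mul; [exact: CkS2_cst|exact: smooth_reglog].
Qed.

(** By [laplace_reglog] and the divergence theorem, without computing an
integral. *)
Lemma poisson_int : \int[dV]_x poisson eta (s x) = 1.
Proof.
have C i : CkS2 1 (fun x => zonal (reglog eta 1) (val y) x 0 i).
  apply: (CkS2_zonal (h := fun i => reglog eta i.+1)) => n x _.
    by apply: is_derive_reglog; exact: sdot_lt.
  by apply: continuous_reglog; exact: sdot_lt.
have := divergence_theorem (@zonal_tangent _ (reglog eta 1) (val y)) C.
have E x : div (zonal (reglog eta 1) (val y)) x = (4 * pi)^-1 - poisson eta (s x).
  have <- : grad (fun x => reglog eta 0 (s x)) = zonal (reglog eta 1) (val y).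
    by apply/funext => z; exact: grad_reglog.
  by rewrite -[LHS]opprK -/(laplace_beltrami _ _) laplace_reglog opprB.
under eq_Rintegral do rewrite E.
rewrite RintegralB //; last 2 first.
- by apply: CkS2_integrable; exact: CkS2_cst.
- by apply: CkS2_integrable; exact: CkS2_poisson.
rewrite area_cst mulVf ?gt_eqF ?pi4_gt0 // => /eqP.
by rewrite subr_eq0 => /eqP <-.
Qed.

(** The mean over the sphere of x |-> [reglog eta 0 (x.y)], which does not
depend on y; the truncation at 1 makes the integrand continuous on R. *)
Definition reglog_mean : R :=
  (4 * pi)^-1 * (2 * pi * \int[leb]_(u in `[-1, 1]) reglog eta 0 (Num.min u 1)).

Lemma reglog_meanE : (4 * pi)^-1 * \int[dV]_x reglog eta 0 (s x) = reglog_mean.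
Proof.
rewrite /reglog_mean -(zonal_int (dot_val y)).
  congr (_ * _); apply: eq_Rintegral => x _.
  by have /andP[_ /min_idPl ->] := sdot_le1 (dot_val y) x.
move=> u; apply: (@continuous_comp _ _ _ (fun u : R => Num.min u 1) (reglog eta 0)).
  by apply: (@continuous_min _ _ (fun u : R => u) (fun=> 1 : R)); [exact: cvg_id|exact: cst_continuous].
by apply: continuous_reglog; rewrite gt_min ltrDl eta0 orbT.
Qed.

Lemma green_poisson (G : S2 -> S2 -> R) p : green_function G ->
  \int[dV]_x (G x p * poisson eta (s x)) = reglog eta 0 (s p) - reglog_mean.
Proof.
move=> /(_ p)[iG /(_ _ (smooth_reglog 0)) gG G0].
rewrite -reglog_meanE -[in RHS]total_areaE -gG.
under [in RHS]eq_Rintegral do rewrite laplace_reglog mulrBr.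
have [M _ HM] := CkS2_bounded (CkS2_poisson 0).
rewrite RintegralB //; last 2 first.
- by apply: integrable_mul_bounded HM => //; apply: CkS2_measurable; exact: CkS2_poisson.
- by apply: (integrable_mul_bounded (M := `|(4 * pi)^-1|)).
by rewrite RintegralZr // G0 mul0r subr0.
Qed.
End pole.
End green.

Section smoothing.
Variable R : realType.
Local Notation V := 'rV[R]_3.
Local Notation S2 := (S2 R).
Local Notation leb := (@lebesgue_measure R).
Local Notation dV := (@area R).
Implicit Types (x : S2) (eta u : R).

Lemma radial_continuous (v : V) : v != 0 -> {for v, continuous (@radial R)}.
Proof.
move=> v0 A [B [[W oW WB] Bv] BA]; have FF := @nbhs_filter V v.
have cv : {for v, continuous (fun w : V => rinv w *: w)}.
  by apply: cvgZ; [exact: rinv_cont|exact: cvg_id].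
have nW : \forall w \near v, W (rinv w *: w).
  apply: cv; apply: open_nbhs_nbhs; split=> //.
  have -> : rinv v *: v = val (radial v) by rewrite val_radial.
  by move: Bv; rewrite -WB.
have n0 : \forall w \near v, punctured w.
  by apply: open_nbhs_nbhs; split; [exact: open_punctured|].
apply: filterS2 nW n0 => w Ww w0; apply: BA; rewrite -WB /preimage /=.
have -> : set_val (radial w) = rinv w *: w by exact: val_radial.
exact: Ww.
Qed.

Lemma compact_S2 : compact [set: S2].
Proof.
have <- : @radial R @` @sphere R = setT.
  apply/seteqP; split=> // x _; exists (val x); first exact: dot_val.
  exact: radial_val.
apply: continuous_compact; last exact: compact_sphere.
apply: continuous_in_subspaceT => v; rewrite inE => sv; apply: radial_continuous.
by rewrite -dot_eq0 (sv : dot v v = 1) oner_eq0.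
Qed.

Lemma continuous_CkS2 (f : S2 -> R) : continuous f -> CkS2 0 f.
Proof.
move=> cf; apply/Ck0P => v v0.
by apply: continuous_comp; [exact: radial_continuous|exact: cf].
Qed.

Lemma sdotC x y : sdot (val x) y = sdot (val y) x.
Proof. by rewrite /sdot dotC. Qed.

Lemma sdot_continuous2 : continuous (fun q : S2 * S2 => sdot (val q.1) q.2).
Proof.
move=> q; rewrite /sdot /dot; apply: (@cvg_big _ _ +%R 0); first exact: add_continuous.
move=> i _; apply: cvgM.
  apply: (@continuous_comp (S2 * S2)%type S2 R snd (fun x : S2 => val x 0 i)); first exact: cvg_snd.
  exact: CkS2_continuous (CkS2_coord R 0 i) _.
apply: (@continuous_comp (S2 * S2)%type S2 R fst (fun x : S2 => val x 0 i)); first exact: cvg_fst.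
exact: CkS2_continuous (CkS2_coord R 0 i) _.
Qed.

Lemma sdot_eq1 x y : sdot (val x) y = 1 -> x = y.
Proof.
move=> xy; apply: val_inj.
have := dot_perp (dot_val x) y; rewrite xy expr1n subrr scale1r => /eqP.
by rewrite dot_eq0 subr_eq0 => /eqP.
Qed.

(** The quantity 1 - x.y is half the square of the distance from x to y. *)
Lemma sphere_modulus (psi : S2 -> R) (eps : R) : continuous psi -> 0 < eps ->
  exists2 C, 0 <= C &
    forall x y, `|psi x - psi y| <= eps + C * (1 - sdot (val y) x) ^+ 2.
Proof.
move=> cf e0.
have csq : continuous (fun z : S2 * S2 => (1 - sdot (val z.1) z.2) ^+ 2).
  move=> z.
  by apply: cvgM; (apply: cvgB; [exact: cvg_cst|exact: sdot_continuous2]).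
have [||C C0 HC] := compact_modulus compact_S2 cf csq _ _ e0.
- by move=> z; exact: sqr_ge0.
- by move=> x y _ _ /eqP; rewrite sqrf_eq0 subr_eq0 => /eqP/esym/sdot_eq1.
by exists C => // x y; rewrite -sdotC; exact: HC.
Qed.

Lemma poisson_approx (psi : S2 -> R) (eps : R) : continuous psi -> 0 < eps ->
  exists2 C, 0 <= C & forall eta y, 0 < eta ->
    `|\int[dV]_x (poisson eta (sdot (val y) x) * psi x) - psi y| <= eps + C * (2 * eta + eta ^+ 2).
Proof.
move=> cpsi e0; have [C C0 HC] := sphere_modulus cpsi e0.
exists C => // eta y eta0.
have CP k := CkS2_poisson y eta0 k.
have Cpsi := continuous_CkS2 cpsi.
have [s1 s2] : (forall x, sdot (val y) x <= 1) /\ forall x, 0 <= poisson eta (sdot (val y) x).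
  by split=> x; [have /andP[] := sdot_le1 (dot_val y) x|apply: poisson_ge0; exact: ltW].
have I1 : dV.-integrable setT (EFin \o (fun x => poisson eta (sdot (val y) x) * psi x)).
  by apply: CkS2_integrable; apply: CkS2_mul.
have I2 : dV.-integrable setT (EFin \o (fun x => poisson eta (sdot (val y) x) * psi y)).
  by apply: CkS2_integrable; apply: CkS2_mul => //; exact: CkS2_cst.
have I3 : dV.-integrable setT (EFin \o (fun x => poisson eta (sdot (val y) x) * eps)).
  by apply: CkS2_integrable; apply: CkS2_mul => //; exact: CkS2_cst.
have -> : psi y = \int[dV]_x (poisson eta (sdot (val y) x) * psi y).
  by rewrite RintegralZr ?poisson_int ?mul1r //; apply: CkS2_integrable; exact: CP.
rewrite -RintegralB //.
apply: (le_trans (le_normr_Rintegral measurableT _)).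
  by have := integrableB measurableT I1 I2.
apply: (@le_trans _ _ (\int[dV]_x (poisson eta (sdot (val y) x) * eps + C * ((2 * eta + eta ^+ 2) / (4 * pi))))).
  apply: le_Rintegral => //.
  - by have := integrable_norm (integrableB measurableT I1 I2).
  - have Ic : dV.-integrable setT (EFin \o (fun=> C * ((2 * eta + eta ^+ 2) / (4 * pi)))).
      by apply: CkS2_integrable; exact: CkS2_cst.
    by have := integrableD measurableT I3 Ic.
  - move=> x _; rewrite -mulrBr normrM (ger0_norm (s2 x)).
    apply: (@le_trans _ _ (poisson eta (sdot (val y) x) * (eps + C * (1 - sdot (val y) x) ^+ 2))).
      by apply: ler_wpM2l.
    rewrite mulrDr lerD2l mulrCA ler_wpM2l //; exact: poisson_moment.
rewrite RintegralD //; last by apply: CkS2_integrable; exact: CkS2_cst.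
rewrite RintegralZr ?poisson_int //; last by apply: CkS2_integrable; exact: CP.
rewrite mul1r area_cst lerD2l -mulrA divfK // gt_eqF // pi4_gt0 //.
Qed.
End smoothing.

Section fubini.
Variable R : realType.
Local Notation S2 := (S2 R).
Local Notation dV := (@area R).
Implicit Types (x : S2).

Lemma fin_num_area : fin_num_fun (@area R).
Proof.
move=> A mA; rewrite ge0_fin_numE // (le_lt_trans _ (area_finite R).1) //.
by apply: le_measure; rewrite ?inE.
Qed.

HB.instance Definition _ := Measure_isFinite.Build _ _ R (@area R) fin_num_area.

Lemma measurable_sdot2 : measurable_fun setT (fun q : S2 * S2 => sdot (val q.1) q.2).
Proof.
have E : (fun q : S2 * S2 => sdot (val q.1) q.2) =
  fun q => val q.2 0 0 * val q.1 0 0 + val q.2 0 1 * val q.1 0 1 + val q.2 0 2 * val q.1 0 2.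
  by apply/funext => q; rewrite /sdot dot3E.
have mc i : measurable_fun setT (fun x => val x 0 i).
  exact: CkS2_measurable (CkS2_coord R 0 i).
have m1 i : measurable_fun setT (fun q : S2 * S2 => val q.1 0 i).
  exact: (measurableT_comp (mc i) measurable_fst).
have m2 i : measurable_fun setT (fun q : S2 * S2 => val q.2 0 i).
  exact: (measurableT_comp (mc i) measurable_snd).
by rewrite E; apply: measurable_funD; [apply: measurable_funD|]; exact: measurable_funM.
Qed.

Section kernel.
Variables (g psi : S2 -> R) (k : R -> R) (M N : R).
Hypotheses (ig : dV.-integrable setT (EFin \o g)) (mpsi : measurable_fun setT psi).
Hypotheses (psiM : forall x, `|psi x| <= M) (mk : measurable_fun setT k).
Hypothesis kN : forall x y : S2, `|k (sdot (val x) y)| <= N.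

Let M0 : 0 <= M. Proof. exact: le_trans (psiM (north R)). Qed.
Let N0 : 0 <= N. Proof. exact: le_trans (kN (north R) (north R)). Qed.
Let mg : measurable_fun setT g. Proof. by have /measurable_int/measurable_EFinP := ig. Qed.

Let mks x : measurable_fun setT (fun y => k (sdot (val x) y)).
Proof. by apply: measurableT_comp => //; exact: CkS2_measurable (CkS2_sdot 0 _). Qed.

Let mkp x : measurable_fun setT (fun y => k (sdot (val x) y) * psi y).
Proof. exact: measurable_funM. Qed.

Let ikp x : dV.-integrable setT (EFin \o (fun y => k (sdot (val x) y) * psi y)).
Proof.
by apply: (bounded_integrable (M := N * M) (mkp x)) => y; rewrite normrM ler_pM.
Qed.

Let igk (y : S2) : dV.-integrable setT (EFin \o (fun x => g x * k (sdot (val y) x))).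
Proof. exact: (integrable_mul_bounded ig (mks y) (kN y)). Qed.

Lemma sdot_kernel_integrable : (dV \x dV)%E.-integrable setT
  (EFin \o (fun q : S2 * S2 => g q.1 * (k (sdot (val q.1) q.2) * psi q.2))).
Proof.
set f := fun q : S2 * S2 => _.
have mf : measurable_fun setT f.
  apply: measurable_funM; first exact: (measurableT_comp mg measurable_fst).
  apply: measurable_funM; last exact: (measurableT_comp mpsi measurable_snd).
  exact: (measurableT_comp mk measurable_sdot2).
have mna : measurable_fun setT (fun x => `|g x|) by exact: measurableT_comp.
apply/integrable12ltyP; first exact/measurable_EFinP.
apply: (@le_lt_trans _ _ (\int[dV]_x (`|g x| * (N * M * (4 * pi)))%:E)%E); last first.
  have ing : dV.-integrable setT (EFin \o (fun x => `|g x| * (N * M * (4 * pi)))).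
    apply: (integrable_mul_bounded (M := `|N * M * (4 * pi)|)) => //.
    exact: (integrable_norm ig).
  have /integrableP[_] := ing; apply: le_lt_trans.
  apply: ge0_le_integral => //.
  - by move=> x _; rewrite lee_fin !mulr_ge0 // ltW // pi_gt0.
  - by apply/measurable_EFinP; exact: measurable_funM.
  - by apply: measurableT_comp => //; have /measurable_int := ing.
  - by move=> x _; exact: lee_abs.
apply: ge0_le_integral => //.
- by move=> x _; exact: integral_ge0.
- apply: (@measurable_fun_fubini_tonelli_F _ _ S2 S2 R dV (abse \o (EFin \o f))) => //.
    by apply: measurableT_comp => //; exact/measurable_EFinP.
  by move=> q; exact: abse_ge0.
- by apply/measurable_EFinP; exact: measurable_funM.
move=> x _.
apply: (@le_trans _ _ (\int[dV]_y (`|g x| * (N * M))%:E)%E).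
  apply: ge0_le_integral => //.
  - apply: measurableT_comp => //; apply/measurable_EFinP.
    exact: (measurable_funM (measurable_cst (g x)) (mkp x)).
  - by move=> y _; rewrite /= lee_fin !normrM ler_wpM2l // ler_pM.
have AE : dV setT = (4 * pi)%:E by rewrite -(area_finite R).2 (fineK (area_fin_num R)).
rewrite integral_cst // [leRHS](_ : _ = (`|g x| * (N * M))%:E * (4 * pi)%:E)%E; last first.
  by rewrite -EFinM !mulrA.
by rewrite le_eqVlt; apply/orP; left; apply/eqP; congr (_ * _)%E; exact: AE.
Qed.

(** Fubini for an integral operator with bounded kernel k(x.y), which is
symmetric. *)
Lemma sdot_kernel_swap :
  \int[dV]_y (psi y * \int[dV]_x (g x * k (sdot (val y) x))) =
  \int[dV]_x (g x * \int[dV]_y (k (sdot (val x) y) * psi y)).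
Proof.
have := @Fubini _ _ S2 S2 R dV dV _ sdot_kernel_integrable.
set f := fun q : S2 * S2 => _.
have -> : (\int[dV]_x \int[dV]_y (EFin \o f) (x, y))%E =
   (\int[dV]_x (g x * \int[dV]_y (k (sdot (val x) y) * psi y))%:E)%E.
  apply: eq_integral => x _; rewrite EFinM /Rintegral fineK; last exact: (integrable_fin_num measurableT (ikp x)).
  by rewrite -(integralZl measurableT (ikp x)).
have -> : (\int[dV]_y \int[dV]_x (EFin \o f) (x, y))%E =
   (\int[dV]_y (psi y * \int[dV]_x (g x * k (sdot (val y) x)))%:E)%E.
  apply: eq_integral => y _; rewrite EFinM /Rintegral fineK; last exact: (integrable_fin_num measurableT (igk y)).
  rewrite -(integralZl measurableT (igk y)); apply: eq_integral => x _.
  by rewrite /= -EFinM /f /= sdotC; congr (_%:E); ring.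
by rewrite /Rintegral => ->.
Qed.
End kernel.

Lemma measurable_sdot_kernel (psi : S2 -> R) (k : R -> R) M N :
  measurable_fun setT psi -> (forall x, `|psi x| <= M) -> measurable_fun setT k ->
  (forall x y : S2, `|k (sdot (val x) y)| <= N) ->
  measurable_fun setT (fun x => \int[dV]_y (k (sdot (val x) y) * psi y)).
Proof.
move=> mpsi psiM mk kN.
have i1 : dV.-integrable setT (EFin \o ((fun=> 1) : S2 -> R)).
  by apply: CkS2_integrable; exact: CkS2_cst.
have H := measurable_fubini_F (sdot_kernel_integrable i1 mpsi psiM mk kN).
have /= := measurableT_comp (@fine_measurable R setT measurableT) H.
apply: eq_measurable_fun => x _ /=; rewrite /fubini_F /Rintegral; congr fine.
by apply: eq_integral => y _ /=; rewrite mul1r.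
Qed.
End fubini.

Section green_near.
Variable R : realType.
Local Notation S2 := (S2 R).
Local Notation dV := (@area R).
Variables (G : S2 -> S2 -> R) (p : S2).
Hypothesis hG : green_function G.
Implicit Types (x : S2).
Local Notation s x := (sdot (val p) x).

(** - ln (1 - u) / (4 pi), truncated where u > 1/2 to be continuous. *)
Definition green_profile (u : R) : R := - (4 * pi)^-1 * ln (Num.max (1 - u) 2^-1).

Lemma continuous_green_profile : continuous green_profile.
Proof.
move=> u; apply: cvgM; first exact: cvg_cst.
apply: (@continuous_comp _ _ _ (fun u : R => Num.max (1 - u) 2^-1) (@ln R)).
  apply: (@continuous_max _ _ (fun u : R => 1 - u) (fun=> 2^-1 : R)).
    by apply: cvgB; [exact: cvg_cst|exact: cvg_id].
  exact: cst_continuous.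
by apply: continuous_ln; rewrite lt_max invr_gt0 ltr0n orbT.
Qed.

Lemma reglog_close (eta u : R) : 0 < eta -> u <= 2^-1 ->
  `|reglog eta 0 u - green_profile u| <= eta.
Proof.
move=> e0 u2; have u1 : 0 < 1 - u by lra.
have pi1 : 0 <= ((4 * pi)^-1 : R) <= 2^-1.
  rewrite invr_ge0 ltW ?pi4_gt0 //= lef_pV2 ?posrE ?pi4_gt0 //.
  by have := pi_ge2 R; lra.
rewrite /reglog /green_profile (max_idPl _); last by lra.
rewrite -mulrBr mulNr normrN normrM ger0_norm; last by case/andP: pi1.
have E : ln (1 + eta - u) = ln (1 - u) + ln (1 + eta / (1 - u)).
  rewrite -lnM ?posrE //; last by rewrite addr_gt0 // divr_gt0.
  by congr ln; field; rewrite gt_eqF.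
have q0 : 0 < eta / (1 - u) by rewrite divr_gt0.
have l0 : 0 <= ln (1 + eta / (1 - u)) by rewrite ln_ge0 // lerDl ltW.
have l1 : ln (1 + eta / (1 - u)) <= eta / (1 - u) by apply: le_ln1Dx; lra.
have l2 : eta / (1 - u) <= 2 * eta by rewrite ler_pdivrMr // mulrAC ler_peMl ?(ltW e0) //; lra.
rewrite E addrAC subrr add0r ger0_norm //.
case/andP: pi1 => pa pb.
apply: (@le_trans _ _ (2^-1 * (2 * eta))); last by lra.
by apply: ler_pM => //; exact: le_trans l2.
Qed.

(** Both sides are limits of the integral of G against the convolution of psi
with the kernel [poisson eta]. By Fubini and [green_poisson] this is the integral
of psi against [reglog eta 0], which converges uniformly on the support of psi;
the additive constants disappear because psi has mean zero. *)
Lemma green_pairing (psi : S2 -> R) : continuous psi ->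
  (forall x, 2^-1 < s x -> psi x = 0) -> \int[dV]_x psi x = 0 ->
  \int[dV]_x (G x p * psi x) = \int[dV]_x (green_profile (s x) * psi x).
Proof.
move=> cpsi psi0 ipsi; have [iG _ _] := hG p.
have Cpsi := continuous_CkS2 cpsi.
have mpsi := CkS2_measurable Cpsi.
have [M M0 psiM] := CkS2_bounded Cpsi.
have Cgp := CkS2_comp0 (val p) continuous_green_profile.
have [N N0 NE] : exists2 N, 0 <= N & \int[dV]_x `|G x p| = N.
  by exists (\int[dV]_x `|G x p|) => //; exact: Rintegral_ge0.
apply/eqP; rewrite -subr_eq0 -normr_le0; apply/ler_addgt0Pl => eps e0; rewrite addr0.
have e1 : 0 < eps / (2 * (N + 1)) by rewrite divr_gt0 ?mulr_gt0 ?ltr_wpDl.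
have [C C0 HC] := poisson_approx cpsi e1.
have [eta [eta0 eta1 etaQ]] : exists eta : R,
    [/\ 0 < eta, eta <= 1 & eta * (3 * C * N + M * (4 * pi) + 1) <= eps / 2].
  have : 0 < 3 * C * N + M * (4 * pi) + 1.
    by rewrite ltr_wpDl // addr_ge0 ?mulr_ge0 ?(ltW M0) // ltW // pi_gt0.
  move: (_ + 1) => Q Q0.
  exists (Num.min 1 (eps / (2 * Q))); split.
  - by rewrite lt_min ltr01 divr_gt0 ?mulr_gt0.
  - by rewrite ge_min lexx.
  have : Num.min 1 (eps / (2 * Q)) <= eps / (2 * Q) by rewrite ge_min lexx orbT.
  move=> /(ler_wpM2r (ltW Q0)) /le_trans; apply.
  by rewrite le_eqVlt; apply/orP; left; apply/eqP; field; rewrite gt_eqF.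
have eta3 : 2 * eta + eta ^+ 2 <= 3 * eta.
  have : eta * eta <= eta by rewrite ler_piMl // ltW.
  by rewrite expr2; lra.
have Csm : CkS2 0 (fun x => reglog eta 0 (s x)) := smooth_reglog p eta0 0 0.
have Irp : dV.-integrable setT (EFin \o (fun x => reglog eta 0 (s x) * psi x)).
  exact: CkS2_integrable (CkS2_mul Csm Cpsi).
have [P [mP Pc J]] : exists P : S2 -> R, [/\ measurable_fun setT P,
    forall x, `|P x - psi x| <= eps / (2 * (N + 1)) + C * (3 * eta) &
    \int[dV]_x (G x p * P x) = \int[dV]_x (reglog eta 0 (s x) * psi x)].
  pose k u := poisson eta (Num.min u 1).
  have kE (y : S2) x : k (sdot (val y) x) = poisson eta (sdot (val y) x).
    by have /andP[_ /min_idPl E] := sdot_le1 (dot_val y) x; rewrite /k E.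
  have ck : continuous k.
    move=> u; apply: cvgM; first exact: cvg_cst.
    have u1 : 0 < 1 + eta - Num.min u 1 by rewrite subr_gt0 gt_min ltrDl eta0 orbT.
    have cV : {for u, continuous (fun u : R => (1 + eta - Num.min u 1)^-1)}.
      apply: cvgV; first by rewrite gt_eqF.
      apply: cvgB; first exact: cvg_cst.
      by apply: (@continuous_min _ _ (fun u : R => u) (fun=> 1 : R)); [exact: cvg_id|exact: cst_continuous].
    by rewrite /continuous_at; apply: cvgM; exact: cV.
  have mk : measurable_fun setT k by exact: continuous_measurable_fun.
  have kB (x y : S2) : `|k (sdot (val x) y)| <= (2 * eta + eta ^+ 2) / (4 * pi) * (eta^-1) ^+ 2.
    have /andP[_ s1] := sdot_le1 (dot_val x) y.
    by rewrite kE ger0_norm ?poisson_ge0 ?(ltW eta0) //; exact: poisson_le.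
  exists (fun x => \int[dV]_y (k (sdot (val x) y) * psi y)); split.
  - exact: measurable_sdot_kernel mpsi psiM mk kB.
  - move=> x; under eq_Rintegral do rewrite kE.
    apply: (le_trans (HC eta x eta0)); rewrite lerD2l; exact: ler_wpM2l.
  rewrite -(sdot_kernel_swap iG mpsi psiM mk kB).
  have I2 : dV.-integrable setT (EFin \o (fun x => reglog_mean eta * psi x)).
    exact: CkS2_integrable (CkS2_mul (CkS2_cst 0 (reglog_mean eta)) Cpsi).
  transitivity (\int[dV]_x (reglog eta 0 (s x) * psi x - reglog_mean eta * psi x)).
    apply: eq_Rintegral => y _; rewrite -mulrBl mulrC; congr (_ * _).
    under eq_Rintegral do rewrite kE.
    by rewrite (green_poisson y eta0 p hG) sdotC.
  rewrite (RintegralB measurableT Irp I2) RintegralZl ?(CkS2_integrable Cpsi) //.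
  by rewrite ipsi mulr0 subr0.
have PM x : `|P x| <= eps / (2 * (N + 1)) + C * (3 * eta) + M.
  have -> : P x = (P x - psi x) + psi x by rewrite subrK.
  exact: le_trans (ler_normD _ _) (lerD (Pc x) (psiM x)).
have I1 : dV.-integrable setT (EFin \o (fun x => G x p * P x)).
  exact: (integrable_mul_bounded iG mP PM).
have I2 : dV.-integrable setT (EFin \o (fun x => G x p * psi x)).
  exact: (integrable_mul_bounded iG mpsi psiM).
have E1 : `|\int[dV]_x (G x p * psi x) - \int[dV]_x (G x p * P x)| <=
    (eps / (2 * (N + 1)) + C * (3 * eta)) * N.
  rewrite -[X in _ <= _ * X]NE -(RintegralB measurableT I2 I1); under eq_Rintegral do rewrite -mulrBr.
  apply: Rintegral_mul_bound; [exact: iG|exact: measurable_funB|].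
  by move=> x; rewrite distrC.
have E2 : `|\int[dV]_x (reglog eta 0 (s x) * psi x) -
            \int[dV]_x (green_profile (s x) * psi x)| <= (eta * M) * (4 * pi).
  have Cgpsi := CkS2_mul Cgp Cpsi.
  rewrite -(RintegralB measurableT Irp (CkS2_integrable Cgpsi)).
  apply: Rintegral_bound; first exact: CkS2_measurable (CkS2_sub (CkS2_mul Csm Cpsi) Cgpsi).
  move=> x; rewrite -mulrBl normrM; have [sx|sx] := lerP (s x) 2^-1.
    apply: ler_pM; [exact: normr_ge0|exact: normr_ge0|exact: reglog_close|exact: psiM].
  rewrite (psi0 _ sx) normr0 mulr0; apply: mulr_ge0; exact: ltW.
rewrite J in E1.
apply: (le_trans (ler_distD (\int[dV]_x (reglog eta 0 (s x) * psi x)) _ _)).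
apply: (le_trans (lerD E1 E2)).
have eps2 : eps = eps / 2 + eps / 2 by field.
rewrite [leRHS]eps2.
have q1 : eps / (2 * (N + 1)) * N <= eps / 2.
  have N1 : 0 < N + 1 by rewrite ltr_wpDl.
  have -> : eps / (2 * (N + 1)) * N = eps / 2 * (N / (N + 1)).
    by field; rewrite gt_eqF.
  rewrite -[leRHS]mulr1 ler_wpM2l ?divr_ge0 ?(ltW e0) //.
  by rewrite ler_pdivrMr // mul1r lerDl.
rewrite mulrDl -addrA; apply: lerD => //; apply: le_trans etaQ.
by rewrite -subr_ge0 (_ : _ - _ = eta) ?ltW //; ring.
Qed.

(** The test functions in [green_pairing] have mean zero and vanish where
s > 1/2. A general continuous chi is multiplied by b = max(0, 1/2 - s), and a
multiple of b is subtracted; this multiple is the source of the constant m. *)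
Lemma green_near :
  exists m, {ae dV, forall x, s x < 2^-1 -> G x p = green_profile (s x) + m}.
Proof.
have [iG _ _] := hG p.
have cs := CkS2_continuous (CkS2_sdot 0 (val p)).
pose b (u : R) := Num.max 0 (2^-1 - u).
have cb : continuous b.
  move=> u; apply: (@continuous_max _ _ (fun=> 0 : R) (fun u : R => 2^-1 - u)).
    exact: cst_continuous.
  by apply: cvgB; [exact: cvg_cst|exact: cvg_id].
have cbs : continuous (fun x => b (s x)).
  by move=> x; apply: (@continuous_comp _ _ _ (sdot (val p)) b); [exact: cs|exact: cb].
have Cb := CkS2_comp0 (val p) cb.
have Cg := CkS2_comp0 (val p) continuous_green_profile.
pose c := \int[dV]_x b (s x).
have c0 : 0 < c.
  rewrite /c zonal_int //; last exact: dot_val.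
  rewrite pmulr_rgt0 ?mulr_gt0 ?pi_gt0 //.
  apply: (@lt_le_trans _ _ (\int[lebesgue_measure]_(u in `[-1, 1]) (2^-1 - u))).
    suff -> : \int[lebesgue_measure]_(u in `[-1, 1]) (2^-1 - u) =
        (2^-1 * 1 - 2^-1 * 1 ^+ 2) - (2^-1 * (-1) - 2^-1 * (-1) ^+ 2) :> R.
      by rewrite sqrrN !expr1n; lra.
    apply: (@Rintegral_FTC2 R (fun u => 2^-1 * u - 2^-1 * u ^+ 2)).
    - by rewrite (lt_trans (ltrN10 _)).
    - by move=> u; apply: cvgB; [exact: cvg_cst|exact: cvg_id].
    - move=> u; apply: cvgB; apply: cvgM; try exact: cvg_cst; first exact: cvg_id.
      exact: exprn_continuous.
    - move=> u _; have := is_deriveB (is_deriveZ (2^-1 : R) (is_derive_id u (1 : R)))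
        (is_deriveZ (2^-1 : R) (is_deriveX 2 (is_derive_id u (1 : R)))).
      apply: is_derive_congr; rewrite /GRing.scale /= expr1; by field.
  apply: le_Rintegral_seg => //.
    by move=> u; apply: cvgB; [exact: cvg_cst|exact: cvg_id].
  by move=> u _; rewrite /b le_max lexx orbT.
pose H x := G x p - green_profile (s x).
have Ig : dV.-integrable setT (EFin \o (fun x => green_profile (s x))).
  exact: CkS2_integrable.
have iH : dV.-integrable setT (EFin \o H).
  by have := integrableB measurableT iG Ig.
pose m := (\int[dV]_x (H x * b (s x))) / c.
have bnd (f : S2 -> R) : continuous f -> exists2 M, 0 < M & forall x, `|f x| <= M.
  by move=> cf; apply: CkS2_bounded; exact: continuous_CkS2.
have ifb (f h : S2 -> R) : dV.-integrable setT (EFin \o h) -> continuous f ->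
    dV.-integrable setT (EFin \o (fun x => h x * f x)).
  move=> ih cf; have [M _ HM] := bnd f cf.
  by apply: integrable_mul_bounded HM => //; exact: continuous_measurable_S2.
have ic (f : S2 -> R) : continuous f -> dV.-integrable setT (EFin \o f).
  by move=> cf; apply: CkS2_integrable; exact: continuous_CkS2.
have pair (psi : S2 -> R) : continuous psi -> (forall x, 2^-1 < s x -> psi x = 0) ->
    \int[dV]_x psi x = 0 -> \int[dV]_x (H x * psi x) = 0.
  move=> cpsi psi0 ipsi; under eq_Rintegral do rewrite mulrBl.
  rewrite RintegralB //; [|exact: ifb|exact: ifb].
  by rewrite green_pairing // subrr.
pose F x := (H x - m) * b (s x).
have iHm : dV.-integrable setT (EFin \o (fun x => H x - m)).
  have im : dV.-integrable setT (EFin \o (fun _ : S2 => m)) by apply: CkS2_integrable; exact: CkS2_cst.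
  by have := integrableB measurableT iH im.
have iF : dV.-integrable setT (EFin \o F) by exact: ifb.
have : {ae dV, forall x, F x = 0}.
  apply: ae_eq0_of_continuous => // chi cchi.
  have ccb : continuous (fun x => chi x * b (s x)).
    by move=> x; have FF := @nbhs_filter S2 x; apply: cvgM; [exact: cchi|exact: cbs].
  pose d := (\int[dV]_x (chi x * b (s x))) / c.
  have cdb : continuous (fun x => d * b (s x)).
    by move=> x; have FF := @nbhs_filter S2 x; apply: cvgM; [exact: cvg_cst|exact: cbs].
  have Hpsi : \int[dV]_x (H x * (chi x * b (s x) - d * b (s x))) = 0.
    apply: pair.
    - by move=> x; have FF := @nbhs_filter S2 x; apply: cvgB; [exact: ccb|exact: cdb].
    - move=> x sx; rewrite /b (max_idPl _) ?mulr0 ?subrr //; lra.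
    - rewrite RintegralB //; [|exact: ic|exact: ic].
      rewrite RintegralZl //; last exact: ic.
      by rewrite /d divfK ?subrr // gt_eqF.
  have E1 : \int[dV]_x (H x * (chi x * b (s x))) = d * (m * c).
    move: Hpsi; under eq_Rintegral do rewrite mulrBr.
    rewrite RintegralB //; [|exact: ifb|exact: ifb].
    move=> /eqP; rewrite subr_eq0 => /eqP ->.
    under eq_Rintegral do rewrite mulrCA.
    rewrite RintegralZl //; last exact: ifb.
    by rewrite /m divfK // gt_eqF.
  transitivity (\int[dV]_x (H x * (chi x * b (s x)) - m * (chi x * b (s x)))).
    by apply: eq_Rintegral => x _; rewrite /F; ring.
  rewrite RintegralB //; [|exact: ifb|]; last first.
    by apply: ic => x; have FF := @nbhs_filter S2 x; apply: cvgM; [exact: cvg_cst|exact: ccb].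
  rewrite RintegralZl //; last exact: ic.
  by rewrite E1 /d; field; rewrite gt_eqF.
exists m; move: H0; apply: filterS => x Fx sx; move: Fx; rewrite /F /b (max_idPr _); last by lra.
move=> /eqP; rewrite mulf_eq0 => /orP[|]; last by rewrite subr_eq0 gt_eqF.
by rewrite /H subr_eq0 subr_eq addrC => /eqP.
Qed.
End green_near.

(** * The mean field fixed point *)

Section picard.
Variable R : realType.
Variables (T : (R -> R) -> R -> R) (r : R).
Local Notation good Z := (continuous Z /\ forall s : R, `|Z s| <= r).
Hypothesis Tgood : forall Z : R -> R, good Z -> good (T Z).
Hypothesis Tcontr : forall (Z W : R -> R) d, good Z -> good W ->
  (forall s, `|Z s - W s| <= d) -> forall s, `|T Z s - T W s| <= d / 2.

(** The contraction principle in a ball of the space of continuous functions. *)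
Lemma picard : 0 < r -> exists2 Z : R -> R, good Z & forall s, T Z s = Z s.
Proof.
move=> r0.
pose Zn n := iter n T (fun=> 0).
have gZ n : good (Zn n).
  elim: n => [|n ih]; last exact: Tgood.
  by split=> [x|s]; [exact: cst_continuous|rewrite normr0 ltW].
pose e n : R := r * (2^-1) ^+ n.
have step n s : `|Zn n.+1 s - Zn n s| <= e n.
  elim: n s => [|n ih] s; first by rewrite /e expr0 mulr1 /= subr0; exact: (gZ 1%N).2.
  by rewrite /e exprSr mulrA; exact: (Tcontr (gZ n.+1) (gZ n) ih).
have far n k s : `|Zn (n + k)%N s - Zn n s| <= 2 * e n - 2 * e (n + k)%N.
  elim: k => [|k ih]; first by rewrite addn0 subrr normr0 subrr.
  rewrite addnS; apply: (le_trans (ler_distD (Zn (n + k)%N s) _ _)).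
  apply: (le_trans (lerD (step _ _) ih)).
  by rewrite /e exprSr; lra.
have e0 n : 0 < e n by rewrite mulr_gt0 ?exprn_gt0.
have Zcau n m s : (n <= m)%N -> `|Zn m s - Zn n s| <= 2 * e n.
  move=> nm; rewrite -(subnKC nm); apply: (le_trans (far _ _ _)).
  by rewrite gerBl mulr_ge0 // ltW.
have esmall eps : 0 < eps -> exists n, 2 * e n < eps.
  move=> eps0; have : e n @[n --> \oo] --> 0.
    rewrite -[X in _ --> X](mulr0 r); apply: cvgM; first exact: cvg_cst.
    by apply: cvg_expr; rewrite ger0_norm ?invr_ge0 // invf_lt1 // ltr1n.
  move=> /cvgrPdist_lt /(_ (eps / 2)); rewrite divr_gt0 // => /(_ erefl) [n _ /(_ n (leqnn n))].
  by rewrite /= sub0r normrN gtr0_norm // => en; exists n; lra.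
have cvgZ s : cvg (Zn n s @[n --> \oo]).
  apply/cauchy_cvgP; apply: cauchy_exP => eps eps0; have [n en] := esmall _ eps0.
  exists (Zn n s); exists n => // m /= nm.
  by rewrite -ball_normE /= distrC (le_lt_trans (Zcau _ _ _ nm)).
pose Z s := lim (Zn n s @[n --> \oo]).
have Zclose n s : `|Z s - Zn n s| <= 2 * e n.
  apply/ler_addgt0Pr => eps eps0.
  have /cvgrPdist_le /(_ eps eps0) [m _ mP] : Zn n s @[n --> \oo] --> Z s by exact: cvgZ.
  apply: (le_trans (ler_distD (Zn (maxn m n) s) _ _)); rewrite addrC; apply: lerD.
    by apply: Zcau; exact: leq_maxr.
  by apply: mP; rewrite /= leq_maxl.
have gZ' : good Z.
  split=> [x|s]; last first.
    apply/ler_addgt0Pr => eps eps0; have [n en] := esmall _ eps0.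
    have -> : Z s = Zn n s + (Z s - Zn n s) by rewrite addrC subrK.
    apply: (le_trans (ler_normD _ _)); apply: lerD; first exact: (gZ n).2.
    exact: le_trans (Zclose _ _) (ltW en).
  apply/cvgrPdist_le => eps eps0.
  have [n en] := esmall (eps / 3) (divr_gt0 eps0 (ltr0n _ 3)).
  have /cvgrPdist_le /(_ (eps / 3) (divr_gt0 eps0 (ltr0n _ 3))) : Zn n y @[y --> x] --> Zn n x.
    exact: (gZ n).1.
  apply: filterS => y xy.
  apply: (le_trans (ler_distD (Zn n x) _ _)).
  have -> : eps = eps / 3 + (eps / 3 + eps / 3) by field.
  apply: lerD; first exact: le_trans (Zclose _ _) (ltW en).
  apply: (le_trans (ler_distD (Zn n y) _ _)); apply: lerD; first exact: xy.
  by rewrite distrC; exact: le_trans (Zclose _ _) (ltW en).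
exists Z => // s; apply/eqP; rewrite -subr_eq0 -normr_le0; apply/ler_addgt0Pr => eps eps0.
rewrite add0r; have [n en] := esmall _ eps0.
apply: (le_trans (ler_distD (Zn n.+1 s) _ _)).
have H1 : `|T Z s - Zn n.+1 s| <= e n.
  have -> : e n = 2 * e n / 2 by field.
  by apply: Tcontr => // t; exact: Zclose.
have H2 : `|Zn n.+1 s - Z s| <= e n.
  have -> : e n = 2 * e n.+1 by rewrite /e exprSr; field.
  by rewrite distrC.
by apply: (le_trans (lerD H1 H2)); lra.
Qed.
End picard.

Section primitive.
Variable R : realType.
Local Notation leb := (@lebesgue_measure R).
Implicit Types f g : R -> R.

(** The lower bound -3 makes -1 an interior point, so that this primitive is
differentiable at -1. *)
Definition prim g (x : R) : R := \int[leb]_(u in `[-3, x]) g u.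

Lemma is_derive_prim g (x : R) : continuous g -> -1 <= x -> is_derive x 1 (prim g) (g x).
Proof.
move=> cg x1.
have x3 : -3 < x by lra.
have xu : x < x + 1 by rewrite ltrDl.
have [] := continuous_FTC1_closed xu (continuous_integrable_seg (-3) (x + 1) cg) x3 (cg x).
by rewrite derive1E => d1 d2; split.
Qed.

Lemma continuous_prim g (x : R) : continuous g -> -1 <= x -> {for x, continuous (prim g)}.
Proof.
move=> cg x1; apply: differentiable_continuous; apply/derivable1_diffP.
by have [] := is_derive_prim cg x1.
Qed.

Lemma primD f g x : continuous f -> continuous g -> prim (fun u => f u + g u) x = prim f x + prim g x.
Proof.
by move=> cf cg; rewrite /prim RintegralD //; exact: continuous_integrable_seg.
Qed.

Lemma primZ c g x : continuous g -> prim (fun u => c * g u) x = c * prim g x.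
Proof.
by move=> cg; rewrite /prim RintegralZl //; exact: continuous_integrable_seg.
Qed.

Lemma prim_mvt g (a b : R) : continuous g -> -1 <= a -> a <= b ->
  exists2 c, a <= c <= b & prim g b - prim g a = g c * (b - a).
Proof.
move=> cg a1 ab.
have dP (v : R) : v \in `]a, b[ -> is_derive v 1 (prim g) (g v).
  by rewrite in_itv /= => /andP[av _]; apply: is_derive_prim => //; exact: le_trans (ltW av).
have cP : {within `[a, b], continuous (prim g)}.
  apply: continuous_in_subspaceT => v; rewrite inE /= in_itv /= => /andP[av _].
  by apply: continuous_prim => //; exact: le_trans av.
have [c cI E] := MVT_segment ab dP cP.
by exists c => //; move: cI; rewrite in_itv.
Qed.

Lemma prim_le f g (a b : R) : continuous f -> continuous g -> -1 <= a -> a <= b ->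
  (forall u, a <= u <= b -> f u <= g u) -> prim f b - prim f a <= prim g b - prim g a.
Proof.
move=> cf cg a1 ab fg; rewrite -subr_ge0.
have cN : continuous (fun u => g u + -1 * f u).
  by move=> u; apply: cvgD; [exact: cg|apply: cvgM; [exact: cvg_cst|exact: cf]].
have [c cab E] := prim_mvt cN a1 ab.
have cf1 : continuous (fun u => -1 * f u).
  by move=> u; apply: cvgM; [exact: cvg_cst|exact: cf].
move: E; rewrite !primD // !primZ // => E.
have : 0 <= (g c + -1 * f c) * (b - a).
  by rewrite mulr_ge0 ?subr_ge0 // mulN1r subr_ge0 fg.
by rewrite -E; lra.
Qed.

Lemma prim_bound g (a b M : R) : continuous g -> -1 <= a -> a <= b ->
  (forall u, a <= u <= b -> `|g u| <= M) -> `|prim g b - prim g a| <= M * (b - a).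
Proof.
move=> cg a1 ab gM; have [c cab ->] := prim_mvt cg a1 ab.
by rewrite normrM (@ger0_norm _ (b - a)) ?subr_ge0 // ler_wpM2r ?subr_ge0 // gM.
Qed.

Lemma prim_seg g (a b : R) : continuous g -> -1 <= a -> a < b ->
  \int[leb]_(u in `[a, b]) g u = prim g b - prim g a.
Proof.
move=> cg a1 ab; rewrite /Rintegral (@continuous_FTC2 _ g (prim g)) //.
- exact: continuous_subspaceT.
- split.
  + move=> x; rewrite in_itv /= => /andP[ax _].
    by have [] := is_derive_prim cg (le_trans a1 (ltW ax)).
  + by apply: cvg_at_right_filter; exact: continuous_prim.
  + by apply: cvg_at_left_filter; apply: continuous_prim => //; lra.
- move=> x; rewrite in_itv /= => /andP[ax _].
  by have [_ <-] := is_derive_prim cg (le_trans a1 (ltW ax)); rewrite derive1E.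
Qed.

(** Used at a zero x0 of F, with d the derivative there, so that the quotient is
continuous. *)
Definition slope (F : R -> R) (x0 d x : R) : R := if x == x0 then d else F x / (x - x0).

Lemma slope_continuous0 (F : R -> R) (x0 d : R) : F x0 = 0 -> is_derive x0 1 F d ->
  {for x0, continuous (slope F x0 d)}.
Proof.
move=> F0 /is_derive1_caratheodory[g [gE cg gx]].
have -> // : slope F x0 d = g.
apply/funext => x; rewrite /slope; case: eqVneq => [->//|xx0].
by have := gE x; rewrite F0 subr0 => ->; rewrite mulfK // subr_eq0.
Qed.

Lemma slope_continuous (F : R -> R) (x0 d x : R) : x != x0 -> {for x, continuous F} ->
  {for x, continuous (slope F x0 d)}.
Proof.
move=> xx0 cF.
have nE : \near x, (fun x => F x / (x - x0)) x = slope F x0 d x.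
  have : \forall y \near x, (~` [set x0]) y.
    apply: open_nbhs_nbhs; split; last exact/eqP.
    by apply: closed_openC; exact: accessible_closed_set1 (@hausdorff_accessible _ (@Rhausdorff R)) x0.
  by apply: filterS => y /eqP yx; rewrite /slope (negPf yx).
have E : slope F x0 d x = F x / (x - x0) by rewrite /slope (negPf xx0).
suff : slope F x0 d y @[y --> x] --> F x / (x - x0) by rewrite -E.
apply: (cvg_trans (near_eq_cvg nE)).
apply: cvgM; first exact: cF.
apply: cvgV; first by rewrite subr_eq0.
by apply: cvgB; [exact: cvg_id|exact: cvg_cst].
Qed.

Lemma slopeE (F : R -> R) (x0 d x : R) : F x0 = 0 -> slope F x0 d x * (x - x0) = F x.
Proof.
move=> F0; rewrite /slope; case: eqVneq => [->|xx0]; first by rewrite subrr mulr0.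
by rewrite divfK // subr_eq0.
Qed.

Definition clamp (a b x : R) : R := Num.max a (Num.min x b).

Lemma clamp_in a b x : a <= b -> a <= clamp a b x <= b.
Proof. by move=> ab; rewrite /clamp le_max lexx /= ge_max ab ge_min lexx orbT. Qed.

Lemma clamp_id a b x : a <= x <= b -> clamp a b x = x.
Proof. by move=> /andP[ax xb]; rewrite /clamp (min_idPl xb) (max_idPr ax). Qed.

Lemma clamp_continuous a b : continuous (clamp a b).
Proof.
move=> x; apply: (@continuous_max _ _ (fun=> a : R) (fun x : R => Num.min x b)).
  exact: cst_continuous.
by apply: (@continuous_min _ _ (fun x : R => x) (fun=> b : R)); [exact: cvg_id|exact: cst_continuous].
Qed.

Lemma clamp_comp (a b : R) (F : R -> R) : a <= b ->
  (forall x, a <= x <= b -> {for x, continuous F}) -> continuous (F \o clamp a b).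
Proof.
move=> ab cF x; apply: continuous_comp; first exact: clamp_continuous.
by apply: cF; exact: clamp_in.
Qed.

Definition mass g (x : R) : R := prim g x - prim g (-1).

Lemma mass0 g : mass g (-1) = 0. Proof. by rewrite /mass subrr. Qed.

Lemma is_derive_mass g (x : R) : continuous g -> -1 <= x -> is_derive x 1 (mass g) (g x).
Proof.
move=> cg x1; have := is_deriveB (is_derive_prim cg x1) (is_derive_cst (prim g (-1)) x 1).
by rewrite subr0.
Qed.

Lemma continuous_mass g (x : R) : continuous g -> -1 <= x -> {for x, continuous (mass g)}.
Proof.
move=> cg x1; apply: differentiable_continuous; apply/derivable1_diffP.
by have [] := is_derive_mass cg x1.
Qed.

Lemma massD f g x : continuous f -> continuous g -> mass (fun u => f u + g u) x = mass f x + mass g x.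
Proof. by move=> cf cg; rewrite /mass !primD //; ring. Qed.

Lemma massZ c g x : continuous g -> mass (fun u => c * g u) x = c * mass g x.
Proof. by move=> cg; rewrite /mass !primZ // mulrBr. Qed.

Lemma mass_bound g (x M : R) : continuous g -> -1 <= x ->
  (forall u, -1 <= u <= x -> `|g u| <= M) -> `|mass g x| <= M * (x + 1).
Proof.
move=> cg x1 gM; have -> : x + 1 = x - (-1) by rewrite opprK.
exact: prim_bound.
Qed.
End primitive.

Section exp_bounds.
Variable R : realType.
Implicit Types x y : R.

Lemma expR_near1 x : `|x| <= 8^-1 -> `|expR x - 1| <= 7^-1.
Proof.
rewrite ler_norml => /andP[x1 x2].
have l1 : 1 + x <= expR x by exact: expR_ge1Dx.
have l2 : 1 + - x <= expR (- x) by exact: expR_ge1Dx.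
have l3 : expR x * expR (- x) = 1 by rewrite -expRD subrr expR0.
have l4 : 0 < expR x by exact: expR_gt0.
rewrite ler_norml; apply/andP; split; first lra.
have : expR x * (7 / 8) <= expR x * expR (- x) by apply: ler_wpM2l; [exact: ltW|lra].
by rewrite l3; lra.
Qed.

Lemma expR_lip x y : `|x| <= 8^-1 -> `|y| <= 8^-1 -> `|expR x - expR y| <= 2 * `|x - y|.
Proof.
wlog yx : x y / y <= x => [H|] x1 y1.
  have [xy|/ltW xy] := leP y x; first exact: H.
  by rewrite distrC (distrC x); exact: H.
rewrite ger0_norm ?subr_ge0 ?ler_expR // ger0_norm ?subr_ge0 //.
have -> : expR x - expR y = expR x * (1 - expR (y - x)).
  by rewrite mulrBr mulr1 -expRD [x + _]addrC subrK.
have l1 : 1 + (y - x) <= expR (y - x) by exact: expR_ge1Dx.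
have /ler_normlP[_ l2] := expR_near1 x1.
have l4 : 0 < expR x by exact: expR_gt0.
apply: (@le_trans _ _ (expR x * (x - y))); first by rewrite ler_pM2l //; lra.
by rewrite ler_wpM2r ?subr_ge0 //; lra.
Qed.

Lemma div_bound (A B a b : R) : `|A| <= a -> 0 < b -> b <= B -> `|A / B| <= a / b.
Proof.
move=> Aa b0 bB; have B0 := lt_le_trans b0 bB.
rewrite normrM normfV (gtr0_norm B0); apply: ler_pM => //.
  by rewrite invr_ge0 ltW.
by rewrite lef_pV2.
Qed.

(** Splits the difference so that D and D' are only compared relative to D. *)
Lemma ratio_diff (N N' D D' : R) : D != 0 -> D' != 0 ->
  N / D - N' / D' = (N - N') / D - N' / D' * ((D - D') / D).
Proof. by move=> D0 D'0; field; rewrite D0 D'0. Qed.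
End exp_bounds.

Section fixed_point.
Variable R : realType.
Variables (kap : R -> R) (h lam : R).
Hypothesis ck : continuous kap.
Hypotheses (h0 : 0 < h) (h8 : h <= 8^-1).
Local Notation c := (mass kap 1).
Hypothesis c0 : 0 < c.
Hypothesis abs_mass : mass (fun u => `|kap u|) 1 <= 2 * c.
Hypothesis tail : forall u : R, -1 <= u <= - h -> `|kap u| <= h * c.
Hypotheses (lam0 : 0 <= lam) (lamh : lam * h <= 1296^-1).
Implicit Types f g Z W : R -> R.

Definition wt f (u : R) : R := kap u * f u.

(** The flux through height t divided by 1 - t^2. Its singularity at -1 is
removable; outside [-1, h] it is frozen. *)
Definition quot f : R -> R :=
  (fun t => slope (mass (wt f)) (-1) (wt f (-1)) t / (1 - t)) \o clamp (-1) h.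

Definition potential f (s : R) : R := prim (quot f) h - prim (quot f) (clamp (-1) h s).

Lemma continuous_wt f : continuous f -> continuous (wt f).
Proof. by move=> cf u; apply: cvgM; [exact: ck|exact: cf]. Qed.

Let h1 : -1 <= h. Proof. by have := h0; lra. Qed.

Lemma continuous_slope_mass g (x : R) : continuous g -> -1 <= x ->
  {for x, continuous (slope (mass g) (-1) (g (-1)))}.
Proof.
move=> cg x1; have [->|xN1] := eqVneq x (-1).
  by apply: slope_continuous0; [exact: mass0|exact: is_derive_mass].
by apply: slope_continuous => //; exact: continuous_mass.
Qed.

Lemma continuous_quot f : continuous f -> continuous (quot f).
Proof.
move=> cf; apply: clamp_comp => // x /andP[x1 xh].
apply: cvgM; first by apply: continuous_slope_mass => //; exact: continuous_wt.
apply: cvgV; first by have hh := h8; rewrite subr_eq0 eq_sym lt_eqF //; lra.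
by apply: cvgB; [exact: cvg_cst|exact: cvg_id].
Qed.

Lemma quotE f t : -1 < t <= h -> quot f t = mass (wt f) t / ((1 + t) * (1 - t)).
Proof.
move=> /andP[t1 th]; rewrite /quot /= clamp_id ?(ltW t1) // /slope gt_eqF // opprK.
by rewrite invfM mulrA (addrC t).
Qed.

Lemma continuous_potential f : continuous f -> continuous (potential f).
Proof.
move=> cf x; apply: cvgB; first exact: cvg_cst.
apply: (@clamp_comp _ _ _ (prim (quot f)) h1) => y /andP[y1 _].
by apply: continuous_prim => //; exact: continuous_quot.
Qed.

Lemma mass_wt_le f B t : continuous f -> (forall u, `|f u| <= B) -> -1 <= t <= 1 ->
  `|mass (wt f) t| <= 2 * c * B.
Proof.
move=> cf fB /andP[t1 t2].
have B0 : 0 <= B by exact: le_trans (fB 0).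
have ca : continuous (fun u => `|kap u|) by move=> u; apply: cvg_norm; exact: ck.
have cBa : continuous (fun u => B * `|kap u|).
  by move=> u; apply: cvgM; [exact: cvg_cst|exact: ca].
have cNB : continuous (fun u => - B * `|kap u|).
  by move=> u; apply: cvgM; [exact: cvg_cst|exact: ca].
have cw := continuous_wt cf.
have wB u : - B * `|kap u| <= wt f u <= B * `|kap u|.
  rewrite mulNr -ler_norml /wt normrM mulrC; exact: ler_wpM2r.
have E1 : mass (wt f) t <= B * mass (fun u => `|kap u|) t.
  rewrite -massZ //; apply: prim_le => // u _; by have /andP[] := wB u.
have E2 : - B * mass (fun u => `|kap u|) t <= mass (wt f) t.
  rewrite -massZ //; apply: prim_le => // u _; by have /andP[] := wB u.
have E3 : mass (fun u => `|kap u|) t <= mass (fun u => `|kap u|) 1.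
  have [d _ E] := prim_mvt ca t1 t2.
  have : 0 <= `|kap d| * (1 - t) by rewrite mulr_ge0 ?subr_ge0.
  by rewrite -E /mass; lra.
have E4 : B * mass (fun u => `|kap u|) t <= B * (2 * c).
  by apply: ler_wpM2l => //; exact: le_trans abs_mass.
rewrite ler_norml; apply/andP; split; lra.
Qed.

(** Below - h the flux is O(h c) by [tail]. On (- h, h) it is O(c), but this
interval has length 2h. *)
Lemma potential_bound f B s : continuous f -> (forall u, `|f u| <= B) ->
  `|potential f s| <= 18 * h * c * B.
Proof.
move=> cf fB; have B0 : 0 <= B by exact: le_trans (fB 0).
have cq := continuous_quot cf.
have hB : 0 <= h * c * B by apply: mulr_ge0 => //; apply: mulr_ge0; exact: ltW.
have q1 t : -1 <= t <= - h -> `|quot f t| <= h * c * B.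
  move=> /andP[t1 t2].
  have wB u : -1 <= u <= t -> `|wt f u| <= h * c * B.
    move=> /andP[u1 u2]; rewrite /wt normrM; apply: ler_pM => //.
    by apply: tail; rewrite u1 (le_trans u2).
  have th : -1 <= t <= h by rewrite t1 /= (le_trans t2) //; have := h0; lra.
  rewrite /quot /= clamp_id // normrM normfV.
  have t3 : 1 <= `|1 - t| by rewrite ger0_norm; have := h0; lra.
  rewrite ler_pdivrMr; last by rewrite (lt_le_trans _ t3).
  apply: (@le_trans _ _ (h * c * B)); last by rewrite ler_peMr.
  rewrite /slope; case: eqVneq => [_|tN1]; first by apply: wB; rewrite lexx t1.
  have t4 : 0 < t + 1 by rewrite -ltrBlDr sub0r lt_neqAle eq_sym tN1.
  rewrite opprK normrM normfV (gtr0_norm t4) ler_pdivrMr //.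
  by apply: mass_bound => //; exact: continuous_wt.
have q2 t : - h <= t <= h -> `|quot f t| <= 8 * c * B.
  move=> /andP[t1 t2]; have hh := h8; rewrite quotE; last by rewrite t2 andbT; lra.
  have -> : 8 * c * B = (2 * c * B) / 4^-1 by field.
  apply: div_bound.
  - by apply: mass_wt_le => //; apply/andP; split; lra.
  - by rewrite invr_gt0.
  - have -> : 4^-1 = 2^-1 * 2^-1 :> R by field.
    by apply: ler_pM; rewrite ?invr_ge0 //; lra.
have step a b : - h <= a -> a <= b -> b <= h -> `|prim (quot f) b - prim (quot f) a| <= 16 * (h * c * B).
  move=> a1 ab bh.
  have := @prim_bound _ (quot f) a b (8 * c * B) cq _ ab _.
  have a2 : -1 <= a by have := h8; lra.
  move=> /(_ a2) H; apply: (le_trans (H _)).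
    by move=> u /andP[ua ub]; apply: q2; rewrite (le_trans a1) //= (le_trans ub).
  have -> : 16 * (h * c * B) = 8 * c * B * (2 * h) by ring.
  by rewrite ler_wpM2l ?mulr_ge0 ?(ltW c0) //; lra.
rewrite /potential; have /andP[s1 s2] := clamp_in s h1.
move: (clamp (-1) h s) s1 s2 => t t1 t2.
have [ht|th] := lerP (- h) t.
  by apply: (le_trans (step _ _ ht t2 (lexx h))); lra.
apply: (le_trans (ler_distD (prim (quot f) (- h)) _ _)).
have S1 := step (- h) h (lexx _) (ltac:(by have := h0; lra)) (lexx _).
have S2 : `|prim (quot f) (- h) - prim (quot f) t| <= h * c * B * (- h - t).
  by apply: prim_bound => //; [exact: ltW|move=> u /andP[ut uh]; apply: q1; rewrite uh andbT (le_trans t1)].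
have S3 : h * c * B * (- h - t) <= h * c * B * 1 by rewrite ler_wpM2l //; have := h0; lra.
by apply: (le_trans (lerD S1 S2)); lra.
Qed.

Lemma wtB f g : wt (fun u => f u + -1 * g u) = fun u => wt f u + -1 * wt g u.
Proof. by apply/funext => u; rewrite /wt; ring. Qed.

Lemma mass_wtB f g t : continuous f -> continuous g ->
  mass (wt (fun u => f u + -1 * g u)) t = mass (wt f) t - mass (wt g) t.
Proof.
move=> cf cg; rewrite wtB massD; [|exact: continuous_wt|].
  by rewrite massZ ?mulN1r //; exact: continuous_wt.
by move=> u; apply: cvgM; [exact: cvg_cst|exact: continuous_wt].
Qed.

Lemma potentialB f g s : continuous f -> continuous g ->
  potential (fun u => f u + -1 * g u) s = potential f s - potential g s.
Proof.
move=> cf cg; have cqf := continuous_quot cf; have cqg := continuous_quot cg.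
have -> : potential (fun u => f u + -1 * g u) s =
    prim (fun t => quot f t + -1 * quot g t) h - prim (fun t => quot f t + -1 * quot g t) (clamp (-1) h s).
  rewrite /potential; suff -> : quot (fun u => f u + -1 * g u) = fun t => quot f t + -1 * quot g t by [].
  apply/funext => t; rewrite /quot /= /slope !mass_wtB // wtB.
  by case: eqVneq => _; ring.
have cN : continuous (fun t => -1 * quot g t).
  by move=> t; apply: cvgM; [exact: cvg_cst|exact: cqg].
have E x : prim (fun t => quot f t + -1 * quot g t) x = prim (quot f) x - prim (quot g) x.
  by rewrite (primD x cqf cN) (primZ (-1) x cqg) mulN1r.
rewrite !E /potential.
move: (prim (quot f) h) (prim (quot g) h) (prim (quot f) _) (prim (quot g) _) => A B C D.
by rewrite !opprD addrACA.
Qed.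

Definition gibbs Z (u : R) : R := expR (- Z u).

Definition picard_map Z (s : R) : R := - lam * (potential (gibbs Z) s / mass (wt (gibbs Z)) 1).

Let good Z := continuous Z /\ forall s : R, `|Z s| <= 8^-1.

Lemma continuous_gibbs Z : continuous Z -> continuous (gibbs Z).
Proof.
move=> cZ u; apply: (@continuous_comp _ _ _ (fun u => - Z u) (@expR R)).
  by apply: cvgN; exact: cZ.
exact: continuous_expR.
Qed.

Lemma gibbs_bounds Z : good Z ->
  [/\ continuous (gibbs Z), forall u, `|gibbs Z u| <= 2 & c / 2 <= mass (wt (gibbs Z)) 1].
Proof.
move=> [cZ Z8]; have cb := continuous_gibbs cZ.
have b7 u : `|gibbs Z u + -1 * 1| <= 7^-1 by rewrite mulr1; apply: expR_near1; rewrite normrN.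
split=> // [u|].
  have := b7 u; rewrite mulr1 ler_norml => /andP[u1 u2].
  by rewrite ger0_norm ?expR_ge0 //; lra.
have c1 : continuous ((fun=> 1) : R -> R) by move=> x; exact: cst_continuous.
have c2 : continuous (fun u => gibbs Z u + -1 * 1).
  by move=> u; apply: cvgD; [exact: cb|exact: cvg_cst].
have := mass_wt_le c2 b7 (t := 1); rewrite lexx andbT (le_trans (lerN10 _) ler01) => /(_ erefl).
rewrite (mass_wtB _ cb c1).
have -> : wt ((fun=> 1) : R -> R) = kap by apply/funext => u; rewrite /wt mulr1.
rewrite ler_norml => /andP[H _]; have := c0; lra.
Qed.

Lemma picard_map_good Z : good Z -> good (picard_map Z).
Proof.
move=> gZ; have [cb b2 m0] := gibbs_bounds gZ; split=> [x|s].
  apply: cvgM; first exact: cvg_cst.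
  by apply: cvgM; [exact: continuous_potential|exact: cvg_cst].
rewrite /picard_map normrM normrN (ger0_norm lam0).
have c20 : 0 < c / 2 by rewrite divr_gt0.
have H := div_bound (potential_bound s cb b2) c20 m0.
apply: (le_trans (ler_wpM2l lam0 H)).
have -> : lam * (18 * h * c * 2 / (c / 2)) = 72 * (lam * h) by field; rewrite gt_eqF.
have := lamh; lra.
Qed.

(** The constant 1296 in [lamh] comes from 648 (lam h) <= 1/2. *)
Lemma picard_map_contr Z W d : good Z -> good W -> (forall s, `|Z s - W s| <= d) ->
  forall s, `|picard_map Z s - picard_map W s| <= d / 2.
Proof.
move=> gZ gW ZW s; have [cb b2 m0] := gibbs_bounds gZ; have [cb' b2' m0'] := gibbs_bounds gW.
have d0 : 0 <= d by exact: le_trans (ZW 0).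
have H648 : 648 * (lam * h) <= 2^-1 by have := lamh; lra.
have cbd : continuous (fun u => gibbs Z u + -1 * gibbs W u).
  by move=> u; apply: cvgD; [exact: cb|apply: cvgM; [exact: cvg_cst|exact: cb']].
have bd u : `|gibbs Z u + -1 * gibbs W u| <= 2 * d.
  rewrite mulN1r; apply: (le_trans (expR_lip _ _)); rewrite ?normrN; [exact: gZ.2|exact: gW.2|].
  by rewrite ler_pM2l // -opprD normrN; exact: ZW.
have Pd := potential_bound s cbd bd; rewrite potentialB // in Pd.
have Md := mass_wt_le cbd bd (t := 1); rewrite lexx andbT (le_trans (lerN10 _) ler01) mass_wtB // in Md.
have {}Md := Md isT.
have P2 := potential_bound s cb' b2'.
have c20 : 0 < c / 2 by rewrite divr_gt0.
have D0 := lt_le_trans c20 m0; have D0' := lt_le_trans c20 m0'.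
rewrite /picard_map -mulrBr normrM normrN (ger0_norm lam0).
set N := potential _ s in Pd *; set N' := potential (gibbs W) s in Pd P2 *.
set D := mass (wt (gibbs Z)) 1 in m0 D0 Md *; set D' := mass (wt (gibbs W)) 1 in m0' D0' Md *.
have -> : N / D - N' / D' = (N - N') / D - N' / D' * ((D - D') / D).
  exact: ratio_diff (lt0r_neq0 D0) (lt0r_neq0 D0').
have H1 := div_bound Pd c20 m0.
have H2 := div_bound P2 c20 m0'.
have H3 := div_bound Md c20 m0.
have H4 : `|N' / D' * ((D - D') / D)| <= 18 * h * c * 2 / (c / 2) * (2 * c * (2 * d) / (c / 2)).
  by rewrite normrM; apply: ler_pM.
apply: (le_trans (ler_wpM2l lam0 (le_trans (ler_normB _ _) (lerD H1 H4)))).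
have -> : lam * (18 * h * c * (2 * d) / (c / 2) +
   18 * h * c * 2 / (c / 2) * (2 * c * (2 * d) / (c / 2))) = 648 * (lam * h) * d.
  by field; rewrite gt_eqF.
by rewrite mulrC; apply: ler_wpM2l.
Qed.

Lemma mean_field_fixpoint : exists Z, [/\ continuous Z,
  0 < mass (wt (gibbs Z)) 1 & forall s : R, -1 < s < h ->
    is_derive s 1 Z (lam * mass (wt (gibbs Z)) s / (mass (wt (gibbs Z)) 1 * ((1 + s) * (1 - s))))].
Proof.
have [Z gZ ZE] := picard picard_map_good picard_map_contr (ltac:(by rewrite invr_gt0)).
have [cb _ m0] := gibbs_bounds gZ.
have I0 : 0 < mass (wt (gibbs Z)) 1 by apply: lt_le_trans m0; rewrite divr_gt0.
exists Z; split=> //; first exact: gZ.1.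
move=> s /andP[s1 sh]; set I := mass _ 1 in I0 *.
pose F t := - lam / I * (prim (quot (gibbs Z)) h - prim (quot (gibbs Z)) t).
have nE : \near s, F s = Z s.
  have : \forall t \near s, t \in `]-1, h[ by apply: near_in_itvoo; rewrite in_itv /= s1.
  apply: filterS => t; rewrite in_itv /= => /andP[t1 t2].
  rewrite -ZE /picard_map /potential clamp_id ?(ltW t1) ?(ltW t2) // /F -/I; ring.
apply: (near_eq_is_derive nE).
have dq := is_derive_prim (continuous_quot cb) (ltW s1).
have := is_deriveZ (- lam / I) (is_deriveB (is_derive_cst (prim (quot (gibbs Z)) h) s 1) dq).
apply: is_derive_congr; rewrite quotE ?s1 ?(ltW sh) // /GRing.scale /= sub0r.
by rewrite (invfM I); ring.
Qed.

(** The coefficient a is a quotient with removable singularities at both -1 and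
1, as the density m - 1/2 has mean zero; hence two applications of [slope]. Below
h the derivative of V + Z + (lam / 2) ln (1 - s) is zero. *)
Lemma mean_field_profile : exists (Z V a : R -> R) (C0 : R),
  let I := mass (wt (gibbs Z)) 1 in
  [/\ continuous Z /\ 0 < I, continuous a,
      forall u : R, -1 <= u <= 1 -> is_derive u 1 V (a u),
      forall u : R, -1 < u < 1 -> is_derive u 1 (fun u => (1 - u ^+ 2) * a u)
         (- lam * (wt (gibbs Z) u / I - 2^-1)) &
      forall s, -1 <= s <= h -> V s = C0 - Z s - lam / 2 * ln (1 - s)].
Proof.
have [Z [cZ]] := mean_field_fixpoint.
set I := mass _ 1 => I0 dZ.
have cw : continuous (wt (gibbs Z)) by apply: continuous_wt; exact: continuous_gibbs.
pose bet u := - lam / I * wt (gibbs Z) u + lam / 2 * 1.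
have cb1 : continuous (fun u => - lam / I * wt (gibbs Z) u).
  by move=> u; apply: cvgM; [exact: cvg_cst|exact: cw].
have c1 : continuous ((fun=> 1) : R -> R) by move=> x; exact: cst_continuous.
have cb2 : continuous ((fun=> lam / 2 * 1) : R -> R) by move=> x; exact: cst_continuous.
have cbet : continuous bet by move=> u; apply: cvgD; [exact: cb1|exact: cb2].
have mass1 u : -1 <= u -> mass (fun=> 1 : R) u = u + 1.
  move=> u1; have [d _ E] := prim_mvt c1 (lexx (-1)) u1.
  by rewrite /mass E mul1r opprK.
have betE u : -1 <= u -> mass bet u = - lam / I * mass (wt (gibbs Z)) u + lam / 2 * (u + 1).
  by move=> u1; rewrite massD // massZ // massZ // mass1.
have N11 : -1 <= 1 :> R by rewrite (le_trans (lerN10 _)).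
have bet1 : mass bet 1 = 0 by rewrite betE // -/I; field; rewrite gt_eqF.
pose F1 := slope (mass bet) (-1) (bet (-1)).
have F1E u : F1 u * (u + 1) = mass bet u.
  by have := @slopeE _ (mass bet) (-1) (bet (-1)) u (mass0 bet); rewrite opprK.
have F11 : F1 1 = 0.
  by apply: (mulIf (lt0r_neq0 (ltac:(lra) : 0 < 1 + 1 :> R))); rewrite mul0r F1E.
have N1N : (1 : R) != -1 by rewrite gt_eqF // (lt_trans (ltrN10 _)).
have dF1 : is_derive (1 : R) 1 F1 (bet 1 / 2).
  have nE : \forall t \near (1 : R), mass bet t * (t + 1)^-1 = F1 t.
    have : \forall t \near (1 : R), t \in `]-1, 2[ by apply: near_in_itvoo; rewrite in_itv /=; apply/andP; split; lra.
    apply: filterS => t; rewrite in_itv /= => /andP[t1 _].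
    by rewrite -F1E mulfK // gt_eqF //; lra.
  apply: (near_eq_is_derive nE).
  have d1 : is_derive (1 : R) 1 (fun u : R => u + 1) 1.
    by have := is_deriveD (is_derive_id (1 : R) (1 : R)) (is_derive_cst (1 : R) (1 : R) (1 : R)); rewrite addr0.
  have d2 := is_deriveV (f := fun u : R => u + 1) (lt0r_neq0 (ltac:(lra) : 0 < 1 + 1 :> R)) d1.
  have := is_deriveM (is_derive_mass cbet N11) d2.
  by apply: is_derive_congr; rewrite bet1 scale0r add0r /GRing.scale /= mulrC.
pose a := (fun u => - slope F1 1 (bet 1 / 2) u) \o clamp (-1) 1.
have ca : continuous a.
  apply: clamp_comp => // u /andP[u1 u2]; apply: cvgN.
  have [->|u1'] := eqVneq u 1; first exact: slope_continuous0.
  by apply: slope_continuous => //; exact: continuous_slope_mass.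
have aE u : -1 <= u <= 1 -> (1 - u ^+ 2) * a u = mass bet u.
  move=> u1; rewrite /a /= clamp_id // -F1E -(@slopeE _ F1 1 (bet 1 / 2) u) //; ring.
have dV (u : R) : -1 <= u <= 1 -> is_derive u 1 (prim a) (a u).
  by move=> /andP[u1 _]; exact: is_derive_prim.
pose Phi s := prim a s + Z s + lam / 2 * ln (1 - s).
have ln_der (s : R) : s < 1 -> is_derive s 1 (fun s : R => ln (1 - s)) (- (1 - s)^-1).
  move=> s1; have s0 : 0 < 1 - s by rewrite subr_gt0.
  have d1 : is_derive s 1 (fun s : R => 1 - s) (-1).
    by have := is_deriveB (is_derive_cst (1 : R) s 1) (is_derive_id s (1 : R)); rewrite sub0r.
  have := is_derive1_comp (f := @ln R) (g := fun s => 1 - s) (is_derive1_ln s0) d1.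
  by apply: is_derive_congr; rewrite mulrN1.
have dPhi s : -1 < s < h -> is_derive s 1 Phi 0.
  move=> sh; have /andP[s1 s2] := sh; have s3 : s < 1 by have := h8; lra.
  have s4 : -1 <= s <= 1 by rewrite !ltW.
  have := is_deriveD (is_deriveD (dV s s4) (dZ s sh)) (is_deriveZ (lam / 2) (ln_der s s3)).
  apply: is_derive_congr.
  have e1 : 1 + s != 0 by rewrite gt_eqF //; lra.
  have e2 : 1 - s != 0 by rewrite gt_eqF //; lra.
  have -> : a s = mass bet s / ((1 + s) * (1 - s)).
    rewrite -aE //; field; by rewrite e1 e2.
  rewrite betE ?(ltW s1) // /GRing.scale /=; field.
  by rewrite e1 e2 gt_eqF.
have cPhi (s : R) : -1 <= s <= h -> {for s, continuous Phi}.
  move=> /andP[s1 s2]; have s3 : s < 1 by have := h8; lra.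
  apply: cvgD; first by apply: cvgD; [exact: continuous_prim|exact: cZ].
  apply: cvgM; first exact: cvg_cst.
  have cln : {for s, continuous (fun s : R => ln (1 - s))}.
    apply: differentiable_continuous; apply/derivable1_diffP.
    by have [] := ln_der s s3.
  exact: cln.
exists Z, (prim a), a, (Phi (-1)); split; [by []|exact: ca|exact: dV| |].
  move=> u /andP[u1 u2].
  have nE : \near u, mass bet u = (1 - u ^+ 2) * a u.
    have : \forall t \near u, t \in `]-1, 1[ by apply: near_in_itvoo; rewrite in_itv /= u1.
    by apply: filterS => t; rewrite in_itv /= => /andP[t1 t2]; rewrite aE // !ltW.
  apply: (near_eq_is_derive nE).
  apply: is_derive_congr (is_derive_mass cbet (ltW u1)).
  by rewrite /bet; ring.
move=> s /andP[s1 s2].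
have dI (v : R) : v \in `]-1, s[ -> is_derive v 1 Phi 0.
  by rewrite in_itv /= => /andP[v1 v2]; apply: dPhi; rewrite v1 (lt_le_trans v2).
have cI : {within `[-1, s], continuous Phi}.
  apply: continuous_in_subspaceT => v; rewrite inE /= in_itv /= => /andP[v1 v2].
  by apply: cPhi; rewrite v1 (le_trans v2).
have [v _ E] := MVT_segment s1 dI cI.
by move: E; rewrite mul0r /Phi => /eqP; rewrite subr_eq0 => /eqP E; rewrite -E; ring.
Qed.
End fixed_point.

(** * The curvature function *)

Section pospow.
Variable R : realType.
Implicit Types u : R.

(** As powers of the positive part, these are of class C^(n - 1). *)
Definition pospow (n : nat) u : R := (Num.max u 0) ^+ n.

Lemma pospow_ge0 n u : 0 <= pospow n u.
Proof. by apply: exprn_ge0; rewrite le_max lexx orbT. Qed.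

Lemma pospow_gt0 n u : 0 < u -> 0 < pospow n u.
Proof. by move=> u0; apply: exprn_gt0; rewrite lt_max u0. Qed.

Lemma pospow_eq0 n u : u <= 0 -> pospow n.+1 u = 0.
Proof. by move=> u0; rewrite /pospow (max_idPr u0) expr0n. Qed.

Lemma pospowS n u : pospow n.+2 u = u * pospow n.+1 u.
Proof.
rewrite /pospow exprS; case: (leP u 0) => [_|//].
by rewrite expr0n !mulr0.
Qed.

Lemma pospow_continuous n : continuous (pospow n).
Proof.
move=> u; apply: (@continuous_comp _ _ _ (fun u : R => Num.max u 0) (fun u : R => u ^+ n)).
  by apply: (@continuous_max _ _ (fun u : R => u) (fun=> 0 : R)); [exact: cvg_id|exact: cst_continuous].
exact: exprn_continuous.
Qed.

Lemma is_derive_pospow n u : is_derive u 1 (pospow n.+2) (n.+2%:R * pospow n.+1 u).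
Proof.
have dX : is_derive u 1 (fun u : R => u ^+ n.+2) (n.+2%:R * u ^+ n.+1).
  have -> : (fun u : R => u ^+ n.+2) = (id : R -> R) ^+ n.+2 by apply/funext => v; rewrite fctE.
  have := is_deriveX n.+2 (is_derive_id u (1 : R)).
  by apply: is_derive_congr; rewrite /GRing.scale /= mulr1.
have [u0|u0|->] := ltgtP u 0.
- have nE : \forall t \near u, (fun=> 0 : R) t = pospow n.+2 t.
    have : \forall t \near u, t \in `]u - 1, 0[ by apply: near_in_itvoo; rewrite in_itv /= u0 gtrBl ltr01.
    by apply: filterS => t; rewrite in_itv /= => /andP[_ t0]; rewrite pospow_eq0 // ltW.
  apply: (near_eq_is_derive nE); rewrite pospow_eq0 ?ltW // mulr0.
  exact: is_derive_cst.
- have nE : \forall t \near u, t ^+ n.+2 = pospow n.+2 t.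
    have : \forall t \near u, t \in `]0, u + 1[ by apply: near_in_itvoo; rewrite in_itv /= u0 ltrDl ltr01.
    by apply: filterS => t; rewrite in_itv /= => /andP[t0 _]; rewrite /pospow (max_idPl (ltW t0)).
  apply: (near_eq_is_derive nE); move: dX; apply: is_derive_congr.
  by rewrite /pospow (max_idPl (ltW u0)).
apply/is_derive1_caratheodory; exists (pospow n.+1); split.
- by move=> z; rewrite (pospow_eq0 _ (lexx 0)) !subr0 pospowS mulrC.
- exact: pospow_continuous.
- by rewrite pospow_eq0 // mulr0.
Qed.

Definition cutoff (a b u : R) : R := pospow 3 (u - a) * pospow 3 (b - u).

Lemma cutoff_continuous a b : continuous (cutoff a b).
Proof.
move=> u; apply: cvgM.
  apply: (@continuous_comp _ _ _ (fun u : R => u - a) (pospow 3)); last exact: pospow_continuous.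
  by apply: cvgB; [exact: cvg_id|exact: cvg_cst].
apply: (@continuous_comp _ _ _ (fun u : R => b - u) (pospow 3)); last exact: pospow_continuous.
by apply: cvgB; [exact: cvg_cst|exact: cvg_id].
Qed.

Lemma cutoff_ge0 a b u : 0 <= cutoff a b u.
Proof. by apply: mulr_ge0; exact: pospow_ge0. Qed.

Lemma cutoff_eq0 a b u : ~~ (a < u < b) -> cutoff a b u = 0.
Proof.
rewrite negb_and -!leNgt => /orP[ua|bu]; rewrite /cutoff.
  by rewrite pospow_eq0 ?mul0r // subr_le0.
by rewrite [X in _ * X]pospow_eq0 ?mulr0 // subr_le0.
Qed.

Lemma mass_cutoff_gt0 a b : -1 <= a -> a < b -> b <= 1 -> 0 < mass (cutoff a b) 1.
Proof.
move=> a1 ab b1; have cb := @cutoff_continuous a b.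
pose l := (b - a) / 3; have l0 : 0 < l by rewrite divr_gt0 // subr_gt0.
have x1 : -1 <= a + l by lra.
have x2 : a + l <= b - l by rewrite /l; lra.
have x3 : b - l <= 1 by lra.
have x4 : -1 <= b - l by lra.
have [c1 _ E1] := prim_mvt cb (lexx (-1)) x1.
have [c2 /andP[c21 c22] E2] := prim_mvt cb x1 x2.
have [c3 _ E3] := prim_mvt cb x4 x3.
have P1 : 0 <= cutoff a b c1 * (a + l - -1) by rewrite mulr_ge0 ?cutoff_ge0 // subr_ge0.
have P3 : 0 <= cutoff a b c3 * (1 - (b - l)) by rewrite mulr_ge0 ?cutoff_ge0 // subr_ge0.
have P2 : 0 < cutoff a b c2 * (b - l - (a + l)).
  apply: mulr_gt0; last by rewrite /l; lra.
  by apply: mulr_gt0; apply: pospow_gt0; lra.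
rewrite /mass; rewrite -E1 in P1; rewrite -E2 in P2; rewrite -E3 in P3; lra.
Qed.
End pospow.

Section profile.
Variable R : realType.
Variables h eta : R.
Hypotheses (h0 : 0 < h) (h8 : h <= 8^-1) (eta0 : 0 < eta).
Implicit Types u : R.

(** Positive exactly for u < 0. The cutoff carries the mass; the term of size eta
makes kappa positive down to -1, and gives it a simple zero at 0. *)
Definition kappa u : R := cutoff (- h) 0 u + eta * (- u * pospow 3 (h - u)).

Lemma kappa_tail_continuous : continuous (fun u => - u * pospow 3 (h - u)).
Proof.
move=> u; apply: cvgM; first by apply: cvgN; exact: cvg_id.
apply: (@continuous_comp _ _ _ (fun u : R => h - u) (pospow 3)); last exact: pospow_continuous.
by apply: cvgB; [exact: cvg_cst|exact: cvg_id].
Qed.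

Lemma kappa_continuous : continuous kappa.
Proof.
move=> u; apply: cvgD; first exact: cutoff_continuous.
by apply: cvgM; [exact: cvg_cst|exact: kappa_tail_continuous].
Qed.

Lemma kappa_gt0 u : u < 0 -> 0 < kappa u.
Proof.
move=> u0; apply: ltr_wpDl; first exact: cutoff_ge0.
apply: mulr_gt0 => //; apply: mulr_gt0; first by rewrite oppr_gt0.
by apply: pospow_gt0; rewrite subr_gt0 (lt_trans u0).
Qed.

Lemma kappa_le0 u : 0 <= u -> kappa u <= 0.
Proof.
move=> u0; rewrite /kappa cutoff_eq0 ?add0r; last by rewrite [u < 0]ltNge u0 andbF.
by rewrite pmulr_rle0 // mulNr oppr_le0 mulr_ge0 // pospow_ge0.
Qed.

Lemma kappa_lt0 u : 0 < u < h -> kappa u < 0.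
Proof.
move=> /andP[u0 uh]; rewrite /kappa cutoff_eq0 ?add0r; last by rewrite [u < 0]ltNge (ltW u0) andbF.
by rewrite pmulr_rlt0 // mulNr oppr_lt0 mulr_gt0 // pospow_gt0 // subr_gt0.
Qed.

Lemma kappa0 : kappa 0 = 0.
Proof. by rewrite /kappa cutoff_eq0 ?ltxx ?andbF // oppr0 mul0r mulr0 addr0. Qed.

Lemma kappa_eq0 u : h <= u -> kappa u = 0.
Proof.
move=> hu; have u0 : 0 <= u by exact: le_trans (ltW h0) hu.
rewrite /kappa cutoff_eq0 ?add0r; last by rewrite [u < 0]ltNge u0 andbF.
by rewrite pospow_eq0 ?mulr0 // subr_le0.
Qed.

Lemma kappa_tail_le u : -1 <= u <= 1 -> `|- u * pospow 3 (h - u)| <= 2.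
Proof.
move=> u1; have u2 : `|u| <= 1 by rewrite ler_norml.
case/andP: u1 => u1 _; rewrite normrM normrN (ger0_norm (pospow_ge0 _ _)).
have p2 : pospow 3 (h - u) <= 2.
  apply: (@le_trans _ _ ((9 / 8) ^+ 3)); last by rewrite !exprS expr0; lra.
  have p98 : 0 <= 9 / 8 :> R by rewrite divr_ge0.
  rewrite ler_pXn2r ?nnegrE ?le_max ?lexx ?orbT //.
  by rewrite ge_max; apply/andP; split; have hh := h8; lra.
by rewrite -[leRHS]mul1r; apply: ler_pM => //; exact: pospow_ge0.
Qed.

Hypothesis eta_small : 32 * eta <= mass (cutoff (- h) 0) 1 * h.
Local Notation b := (mass (cutoff (- h) 0) 1).
Local Notation c := (mass kappa 1).

Let b0 : 0 < b. Proof. by have hh := h8; apply: mass_cutoff_gt0; have := h0; lra. Qed.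

Let bh : b * h <= b * 8^-1. Proof. by rewrite ler_pM2l. Qed.

Let mass_cst2 : mass ((fun=> 2) : R -> R) 1 = 4.
Proof.
have c2 : continuous ((fun=> 2) : R -> R) by move=> x; exact: cst_continuous.
have N11 : -1 <= 1 :> R by rewrite (le_trans (lerN10 _)).
by rewrite /mass; have [d _ ->] := prim_mvt c2 (lexx (-1)) N11; lra.
Qed.

Lemma mass_kappa_ge : b / 2 <= c.
Proof.
have ct := kappa_tail_continuous.
have N11 : -1 <= 1 :> R by rewrite (le_trans (lerN10 _)).
rewrite massD; [|exact: cutoff_continuous|by move=> u; apply: cvgM; [exact: cvg_cst|exact: ct]].
rewrite massZ //.
have := mass_bound ct N11 (fun u => @kappa_tail_le u).
rewrite ler_norml => /andP[H _].
have : eta * (- (2 * (1 + 1))) <= eta * mass (fun u => - u * pospow 3 (h - u)) 1 by rewrite ler_pM2l.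
have := eta_small; have := bh; have := b0; lra.
Qed.

Lemma mass_kappa_gt0 : 0 < c.
Proof. by apply: lt_le_trans mass_kappa_ge; rewrite divr_gt0. Qed.

Lemma mass_abs_kappa : mass (fun u => `|kappa u|) 1 <= 2 * c.
Proof.
have ct := kappa_tail_continuous; have cb := @cutoff_continuous R (- h) 0.
have N11 : -1 <= 1 :> R by rewrite (le_trans (lerN10 _)).
have c2 : continuous (fun u : R => eta * 2) by move=> x; exact: cst_continuous.
have ck : continuous (fun u => `|kappa u|) by move=> u; apply: cvg_norm; exact: kappa_continuous.
have cs : continuous (fun u => cutoff (- h) 0 u + eta * 2).
  by move=> u; apply: cvgD; [exact: cb|exact: c2].
have H : mass (fun u => `|kappa u|) 1 <= mass (fun u => cutoff (- h) 0 u + eta * 2) 1.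
  apply: prim_le => // u u1; rewrite /kappa; apply: (le_trans (ler_normD _ _)).
  rewrite (ger0_norm (cutoff_ge0 _ _ _)) lerD2l normrM (gtr0_norm eta0) ler_pM2l //.
  exact: kappa_tail_le.
apply: (le_trans H); rewrite massD // massZ ?mass_cst2; last by move=> x; exact: cst_continuous.
have ct2 : continuous (fun u => eta * (- u * pospow 3 (h - u))).
  by move=> u; apply: cvgM; [exact: cvg_cst|exact: ct].
have E : c = b + eta * mass (fun u => - u * pospow 3 (h - u)) 1 by rewrite massD // massZ.
have := mass_bound ct N11 (fun u => @kappa_tail_le u).
rewrite ler_norml => /andP[H1 _].
have : eta * (- (2 * (1 + 1))) <= eta * mass (fun u => - u * pospow 3 (h - u)) 1 by rewrite ler_pM2l.
rewrite E; have := eta_small; have := bh; have := b0; lra.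
Qed.

Lemma kappa_small u : -1 <= u <= - h -> `|kappa u| <= h * c.
Proof.
move=> /andP[u1 uh]; have hh := h0.
rewrite {1}/kappa cutoff_eq0 ?add0r; last by rewrite [- h < u]ltNge uh.
rewrite normrM (gtr0_norm eta0).
have u2 : -1 <= u <= 1 by apply/andP; split; lra.
have H1 : eta * `|- u * pospow 3 (h - u)| <= eta * 2 by rewrite ler_pM2l //; exact: kappa_tail_le.
have H2 : h * (b / 2) <= h * c by rewrite ler_pM2l // mass_kappa_ge.
have := mulr_gt0 b0 h0; have := eta_small; lra.
Qed.
End profile.

Section curvature.
Variable R : realType.
Local Notation V := 'rV[R]_3.
Local Notation S2 := (S2 R).
Local Notation dV := (@area R).
Variables (h eta : R) (p : S2) (fg : S2 -> R).
Hypotheses (h0 : 0 < h) (h8 : h <= 8^-1) (eta0 : 0 < eta).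
Hypothesis fg2 : CkS2 2 fg.
Implicit Types (x : S2).
Local Notation s x := (sdot (val p) x).
Local Notation kap := (kappa h eta).

(** The factor (1 - s)^2 turns the power (1 - s)^(- lam / 2) of the solution
into the power (1 - s)^(- alpha), which the Green function cancels. *)
Definition curv x : R := (1 - s x) ^+ 2 * kap (s x) * expR (- fg x).

Lemma CkS2_pospow3 (f : S2 -> R) : CkS2 2 f -> CkS2 2 (fun x => pospow 3 (f x)).
Proof.
move=> cf.
apply: (CkS2_comp (h := fun n => match n with 0%N => pospow 3 | 1%N => fun u => 3 * pospow 2 u
   | _ => fun u => 3 * (2 * pospow 1 u) end)) => //.
  move=> [|[|//]] x _; first exact: is_derive_pospow.
  exact: (is_deriveZ (3 : R) (is_derive_pospow 0 (f x))).
move=> [|[|n]] x _; first exact: pospow_continuous.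
  by apply: cvgM; [exact: cvg_cst|exact: pospow_continuous].
apply: cvgM; first exact: cvg_cst.
by apply: cvgM; [exact: cvg_cst|exact: pospow_continuous].
Qed.

Lemma CkS2_curv_profile : CkS2 2 (fun x => (1 - s x) ^+ 2 * kap (s x)).
Proof.
have cs := CkS2_sdot 2 (val p).
have cc c : CkS2 2 (fun _ : S2 => c) := CkS2_cst 2 c.
have sub c : CkS2 2 (fun x => c - s x) := CkS2_sub (cc c) cs.
have csub c : CkS2 2 (fun x => s x - c) := CkS2_sub cs (cc c).
have -> : (fun x => (1 - s x) ^+ 2 * kap (s x)) = fun x => (1 - s x) * (1 - s x) *
    (pospow 3 (s x - - h) * pospow 3 (0 - s x) + eta * ((0 - s x) * pospow 3 (h - s x))).
  by apply/funext => x; rewrite /kappa /cutoff expr2 !sub0r.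
have c1 := CkS2_mul (sub 1) (sub 1).
have c2 := CkS2_mul (CkS2_pospow3 (csub (- h))) (CkS2_pospow3 (sub 0)).
have c3 := CkS2_mul (cc eta) (CkS2_mul (sub 0) (CkS2_pospow3 (sub h))).
exact: (CkS2_mul c1 (CkS2_add c2 c3)).
Qed.

Lemma CkS2_expN : CkS2 2 (fun x => expR (- fg x)).
Proof.
have -> : (fun x => expR (- fg x)) = fun x => expR (0 - fg x).
  by apply/funext => x; rewrite sub0r.
apply: (CkS2_comp (h := fun=> @expR R) (CkS2_sub (CkS2_cst 2 0) fg2)).
by move=> n x _; exact: continuous_expR.
Qed.

Lemma CkS2_curv : CkS2 2 curv.
Proof. exact: (CkS2_mul CkS2_curv_profile CkS2_expN). Qed.

Lemma curv_gt0 x : (0 < curv x) = (s x < 0).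
Proof.
rewrite /curv pmulr_lgt0 ?expR_gt0 //; apply/idP/idP => [|s0].
  apply: contraTT; rewrite -!leNgt => s0; apply: mulr_ge0_le0; first exact: sqr_ge0.
  exact: kappa_le0.
apply: mulr_gt0; last exact: kappa_gt0.
by rewrite exprn_gt0 // subr_gt0 (lt_trans s0).
Qed.

Definition antipode : S2 := radial (- val p).

Lemma val_antipode : val antipode = - val p.
Proof.
have pN0 : - val p != 0 by rewrite oppr_eq0 val_neq0.
by rewrite /antipode val_radial // dotNl dotC dotNl opprK dot_val sqrtr1 invr1 scale1r.
Qed.

Lemma sdot_antipode : s antipode = -1.
Proof. by rewrite /sdot val_antipode dotNl dot_val. Qed.

Lemma sdot_self : s p = 1.
Proof. exact: dot_val. Qed.

(** Otherwise a cutoff function of the height would have integral zero. *)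
Lemma sdot_surj_itv (a b : R) : -1 <= a -> a < b -> b <= 1 -> exists x, a < s x < b.
Proof.
move=> a1 ab b1; apply: contrapT => nx.
have H := zonal_int (dot_val p) (@cutoff_continuous R a b).
have E : \int[dV]_x cutoff a b (s x) = 0.
  transitivity (\int[dV]_x (0 : R)).
    apply: eq_Rintegral => x _; apply: cutoff_eq0; apply/negP => sx; apply: nx; by exists x.
  by rewrite area_cst mul0r.
have := mass_cutoff_gt0 a1 ab b1.
have B : -1 < 1 :> R by rewrite (lt_trans (ltrN10 _)).
have := prim_seg (@cutoff_continuous R a b) (lexx (-1)) B.
rewrite -/(mass _ 1) => <- m0.
have : 0 < 2 * pi * \int[lebesgue_measure]_(u in `[-1, 1]) cutoff a b u.
  by rewrite mulr_gt0 // mulr_gt0 // pi_gt0.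
by rewrite -H E ltxx.
Qed.

Lemma sign_changing_curv : sign_changing curv.
Proof.
have [y /andP[y0 yh]] : exists y, 0 < s y < h.
  by apply: sdot_surj_itv => //; have hh := h8; lra.
exists antipode, y; rewrite pmulr_rlt0; last by rewrite curv_gt0 sdot_antipode ltrN10.
rewrite /curv pmulr_llt0 ?expR_gt0 // pmulr_rlt0; first by apply: kappa_lt0; rewrite ?y0.
by rewrite exprn_gt0 // subr_gt0 (lt_le_trans yh) //; have hh := h8; lra.
Qed.

Lemma sdot_continuous : continuous (sdot (val p)).
Proof. exact: CkS2_continuous (CkS2_sdot 0 _). Qed.

Lemma positive_curvE : Defs.positive_set curv = [set x | s x < 0].
Proof. by apply/seteqP; split=> x /=; rewrite /Defs.positive_set /= curv_gt0. Qed.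

Lemma open_positive : open [set x | s x < 0].
Proof.
have -> : [set x | s x < 0] = sdot (val p) @^-1` [set t : R | t < 0] by [].
apply: open_comp; last exact: open_lt.
by move=> x _; exact: sdot_continuous.
Qed.

Lemma closure_positive x : closure [set x | s x < 0] x -> s x <= 0.
Proof.
have cl : closed [set x | s x <= 0].
  have -> : [set x | s x <= 0] = sdot (val p) @^-1` [set t : R | t <= 0] by [].
  apply: closed_comp; last exact: closed_le.
  by move=> y _; exact: sdot_continuous.
have sub : [set x | s x < 0] `<=` [set x | s x <= 0] by move=> y /= /ltW.
by move=> /(closure_subset sub); rewrite -(closure_id _).1.
Qed.

Lemma boundary_positive x : boundary (Defs.positive_set curv) x -> s x = 0.
Proof.
rewrite positive_curvE /boundary => -[cx nx].
have := closure_positive cx; rewrite le_eqVlt => /orP[/eqP//|sx].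
by exfalso; apply: nx; exact: open_nbhs_nbhs (conj open_positive sx).
Qed.

(** The cutoff in kappa is flat at 0, so only the term of size eta contributes. *)
Lemma grad_curv_neq0 x : s x = 0 -> grad curv x != 0.
Proof.
move=> s0.
pose F u := (1 - u) ^+ 2 * kap u.
have dF : is_derive (0 : R) 1 F (- (eta * h ^+ 3)).
  apply/is_derive1_caratheodory.
  exists (fun u => (1 - u) ^+ 2 * - (pospow 3 (u + h) * pospow 2 (0 - u) + eta * pospow 3 (h - u))); split.
  - move=> u; have -> : F 0 = 0.
      by rewrite /F kappa0 mulr0.
    by rewrite !subr0 /F /kappa /cutoff [pospow 3 (0 - u)]pospowS opprK sub0r; ring.
  - have c3 n (g : R -> R) : continuous g -> continuous (fun u => pospow n (g u)).
      move=> cg u; apply: (@continuous_comp _ _ _ g (pospow n)); [exact: cg|exact: pospow_continuous].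
    have cN : continuous (fun u : R => - (pospow 3 (u + h) * pospow 2 (0 - u) + eta * pospow 3 (h - u))).
      move=> u; apply: cvgN; apply: cvgD; apply: cvgM.
      + by apply: (c3 3%N (fun u => u + h)) => v; apply: cvgD; [exact: cvg_id|exact: cvg_cst].
      + by apply: (c3 2%N (fun u => 0 - u)) => v; apply: cvgB; [exact: cvg_cst|exact: cvg_id].
      + exact: cvg_cst.
      + by apply: (c3 3%N (fun u => h - u)) => v; apply: cvgB; [exact: cvg_cst|exact: cvg_id].
    apply: cvgM; last exact: cN.
    have c1 : continuous (fun u : R => 1 - u) by move=> u; apply: cvgB; [exact: cvg_cst|exact: cvg_id].
    by apply: cvgM; exact: c1.
  - rewrite subr0 expr1n mul1r subrr subr0 add0r [pospow 2 0]pospow_eq0 // mulr0 add0r.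
    by rewrite /pospow (max_idPl (ltW h0)).
have cE : CkS2 1 (fun x => expR (- fg x)) := CkS (CkS2_expN : Ck 2 _ _).
have cF : CkS2 1 (fun x => F (s x)) := CkS (CkS2_curv_profile : Ck 2 _ _).
have -> : curv = fun x => F (s x) * expR (- fg x) by [].
have dFs : is_derive (s x) 1 F (- (eta * h ^+ 3)) by rewrite s0.
rewrite grad_mul // (grad_comp (CkS2_sdot 1 _) dFs).
have -> : F (s x) = 0 by rewrite s0 /F kappa0 mulr0.
rewrite scale0r add0r grad_sdot s0 scale0r subr0 !scaler_eq0 negb_or negb_or val_neq0 andbT.
by rewrite gt_eqF ?expR_gt0 //= oppr_eq0 gt_eqF // mulr_gt0 // exprn_gt0.
Qed.

(** The straight homotopy to - p stays in the half-space v.p < 0, hence away from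
the origin, and is projected back to the sphere. *)
Lemma contractible_positive : contractible R [set x | s x < 0].
Proof.
pose v (q : S2 * R) : V := (1 - q.2) *: val q.1 - q.2 *: val p.
have vs q : dot (v q) (val p) = (1 - q.2) * s q.1 - q.2.
  by rewrite /v dotBl !dotZl dot_val mulr1.
have v0 x t : s x < 0 -> 0 <= t <= 1 -> dot (v (x, t)) (val p) < 0.
  move=> sx /andP[t0 t1]; rewrite vs /=.
  move: t1; rewrite le_eqVlt => /orP[/eqP->|t1]; first by rewrite subrr mul0r sub0r ltrN10.
  rewrite ltrBlDr add0r (lt_le_trans _ t0) // pmulr_rlt0 // subr_gt0 //.
have vn0 x t : s x < 0 -> 0 <= t <= 1 -> v (x, t) != 0.
  move=> sx t01; apply/eqP => E; have := v0 x t sx t01.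
  by rewrite E /dot big1 ?ltxx // => i _; rewrite mxE mul0r.
exists antipode; first by rewrite /= sdot_antipode ltrN10.
exists (fun q => radial (v q)); split.
- apply: continuous_in_subspaceT => -[x t]; rewrite inE => -[/= sx].
  rewrite in_itv /= => t01.
  apply: continuous_comp; last by apply: radial_continuous; exact: vn0.
  apply: continuous_row => i q; rewrite /continuous_at.
  have -> : (fun q : S2 * R => v q 0 i) = fun q => (1 - q.2) * val q.1 0 i - q.2 * val p 0 i.
    by apply/funext => q'; rewrite !mxE.
  have -> : v q 0 i = (1 - q.2) * val q.1 0 i - q.2 * val p 0 i by rewrite !mxE.
  apply: cvgB; apply: cvgM.
  + by apply: cvgB; [exact: cvg_cst|exact: cvg_snd].
  + apply: (@continuous_comp (S2 * R)%type S2 R fst (fun x : S2 => val x 0 i)); first exact: cvg_fst.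
    exact: CkS2_continuous (CkS2_coord R 0 i) _.
  + exact: cvg_snd.
  + exact: cvg_cst.
- move=> x t /= sx t01; rewrite /sdot val_radial ?vn0 // dotZl pmulr_rlt0 ?v0 //.
  by rewrite invr_gt0 sqrtr_gt0 dot_gt0 ?vn0.
- by move=> x _; rewrite /v /= subr0 scale1r scale0r subr0 radial_val.
- by move=> x _; rewrite /v /= subrr scale0r scale1r sub0r.
Qed.

Lemma admissible_curv : admissible p curv.
Proof.
split.
- exact: CkS2_curv.
- exact: sign_changing_curv.
- by move=> x /boundary_positive; exact: grad_curv_neq0.
- by rewrite positive_curvE => /closure_positive; rewrite sdot_self leNgt ltr01.
- by rewrite positive_curvE; exact: contractible_positive.
Qed.
End curvature.

(** * The zonal solution *)

Section solution.
Variable R : realType.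
Local Notation V := 'rV[R]_3.
Local Notation S2 := (S2 R).
Local Notation dV := (@area R).
Variables (G : S2 -> S2 -> R) (fg : S2 -> R) (p : S2) (h eta al : R).
Hypotheses (hG : green_function G) (fg2 : CkS2 2 fg).
Hypotheses (h0 : 0 < h) (h8 : h <= 8^-1) (eta0 : 0 < eta).
Hypothesis eta_small : 32 * eta <= mass (cutoff (- h) 0) 1 * h.
Hypothesis al0 : 0 < 2 + al.
Local Notation lam := (2 * (2 + al)).
Hypothesis lamh : lam * h <= 1296^-1.
Implicit Types (x : S2).
Local Notation s x := (sdot (val p) x).
Local Notation kap := (kappa h eta).
Local Notation K := (curv h eta p fg).
Local Notation Kt := (Ktilde G fg K (fun _ : 'I_1 => p) (fun _ => al)).

Lemma measurable_Ktilde : measurable_fun setT Kt.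
Proof.
have [iG _ _] := hG p.
have mG : measurable_fun setT (fun x => G x p) by have /measurable_int/measurable_EFinP := iG.
have mK : measurable_fun setT K.
  by apply: CkS2_measurable; exact: (CkS (CkS (CkS2_curv h eta p fg2 : Ck 2 _ _))).
have mf : measurable_fun setT fg.
  by apply: CkS2_measurable; exact: (CkS (CkS (fg2 : Ck 2 _ _))).
have -> : Kt = fun x => K x * expR (fg x - 4 * pi * al * G x p).
  by apply/funext => x; rewrite /Ktilde big_ord1 mulrA.
apply: measurable_funM => //; apply: measurableT_comp => //.
by apply: measurable_funB => //; exact: measurable_funM.
Qed.

(** The identity Ktilde e^v = c kappa e^(-Z) holds almost everywhere: below h by
[green_near] and the formula for V, above h because kappa is zero there. *)
Lemma mean_field_solution :
  exists v, solution G fg K (fun _ : 'I_1 => p) (fun _ => al) (4 * pi * (2 + al)) v.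
Proof.
have ck := @kappa_continuous _ h eta.
have c0 := mass_kappa_gt0 h0 h8 eta0 eta_small.
have lam0 : 0 <= lam by rewrite mulr_ge0 // ltW.
have [Z [U [a [C0 [[cZ I0] ca dU dB UE]]]]] := mean_field_profile ck h0 h8 c0
  (mass_abs_kappa h0 h8 eta0 eta_small) (kappa_small h0 h8 eta0 eta_small) lam0 lamh.
set W := wt kap (gibbs Z) in I0 dB *.
set I1 := mass W 1 in I0 dB *.
have cW : continuous W by apply: continuous_wt => //; exact: continuous_gibbs.
have [m Gm] := green_near p hG.
pose v x := U (s x).
have wv : weak_gradient v (zonal a (val p)) := weak_gradient_zonal (dot_val p) ca dU.
have mv : measurable_fun setT v.
  by have [/Lfun2_integrable_S2/measurable_int/measurable_EFinP] := wv.
pose c := expR (C0 - 4 * pi * al * m).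
have c_gt0 : 0 < c by exact: expR_gt0.
pose Kev x := Kt x * expR (v x).
have mKev : measurable_fun setT Kev.
  by apply: measurable_funM; [exact: measurable_Ktilde|exact: measurableT_comp].
have CW : CkS2 0 (fun x => W (s x)) := CkS2_comp0 (val p) cW.
have KevE : {ae dV, forall x, Kev x = c * W (s x)}.
  apply: filterS Gm => x Gx; have /andP[s1 s2] := sdot_le1 (dot_val p) x.
  rewrite /Kev /Ktilde big_ord1 /curv /W /wt /gibbs.
  have [sh|sh] := ltP (s x) h; last by rewrite kappa_eq0 // !(mulr0, mul0r).
  have s3 : 0 < 1 - s x by have hh := h8; lra.
  have pi0 : 4 * pi != 0 :> R by rewrite gt_eqF ?pi4_gt0.
  have -> : G x p = - (4 * pi)^-1 * ln (1 - s x) + m.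
    rewrite Gx; last by have hh := h8; lra.
    by rewrite /green_profile (max_idPl _) //; have hh := h8; lra.
  rewrite /v UE ?s1 ?(ltW sh) //.
  have -> : (1 - s x) ^+ 2 = expR (2 * ln (1 - s x)).
    by rewrite mulr_natl mulr2n expRD lnK ?posrE // expr2.
  have -> : expR (2 * ln (1 - s x)) * kap (s x) * expR (- fg x) *
    expR (fg x - 4 * pi * (al * (- (4 * pi)^-1 * ln (1 - s x) + m))) *
    expR (C0 - Z (s x) - lam / 2 * ln (1 - s x)) =
    kap (s x) * expR (2 * ln (1 - s x) + - fg x +
      (fg x - 4 * pi * (al * (- (4 * pi)^-1 * ln (1 - s x) + m))) +
      (C0 - Z (s x) - lam / 2 * ln (1 - s x))).
    by rewrite !expRD; ring.
  rewrite [RHS]mulrCA /c -[in RHS]expRD; congr (_ * expR _).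
  move: (4 * pi : R) pi0 (ln _) => q q0 l; field; exact: q0.
have iW : dV.-integrable setT (EFin \o (fun x => c * W (s x))).
  by apply: CkS2_integrable; exact: (CkS2_mul (CkS2_cst 0 c) CW).
have eqKev : ae_eq dV setT (EFin \o Kev) (EFin \o (fun x => c * W (s x))).
  by apply: filterS KevE => x E _ /=; rewrite E.
have iKev : dV.-integrable setT (EFin \o Kev).
  have mE : measurable_fun setT (EFin \o Kev) by exact/measurable_EFinP.
  apply/integrableP; split=> //.
  have /integrableP[mE' fin] := iW.
  rewrite (ae_eq_integral (abse \o (EFin \o (fun x => c * W (s x))))) //.
  - exact: measurableT_comp.
  - exact: measurableT_comp.
  - by apply: filterS eqKev => x E _ /=; rewrite -[Kev x]/(fine ((EFin \o Kev) x)) E.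
have IE : \int[dV]_x Kev x = c * (2 * pi * I1).
  transitivity (\int[dV]_x (c * W (s x))).
    rewrite /Rintegral (ae_eq_integral (EFin \o (fun x => c * W (s x)))) //.
    - exact/measurable_EFinP.
    - by have /measurable_int := iW.
  rewrite RintegralZl //; last exact: CkS2_integrable.
  rewrite (zonal_int (dot_val p) cW) prim_seg // (lt_trans (ltrN10 _)) //.
have I_gt0 : 0 < \int[dV]_x Kev x.
  by rewrite IE !mulr_gt0 // pi_gt0.
exists v; split=> //.
exists (zonal a (val p)) => // phi z wphi; have [Lphi _ _ _] := wphi.
pose bet u := - lam * (W u / I1 - 2^-1).
have cbet : continuous bet.
  move=> u; apply: cvgM; first exact: cvg_cst.
  apply: cvgB; last exact: cvg_cst.
  by apply: cvgM; [exact: cW|exact: cvg_cst].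
have := zonal_weak (dot_val p) cbet ca dB wphi => /esym/eqP; rewrite eqr_oppLR => /eqP ->.
have iphi := Lfun2_integrable_S2 Lphi.
have mphi : measurable_fun setT phi by have /measurable_int/measurable_EFinP := iphi.
have Cb : CkS2 0 (fun x => bet (s x)) := CkS2_comp0 (val p) cbet.
have [M _ bM] := CkS2_bounded Cb.
have ib : dV.-integrable setT (EFin \o (fun x => bet (s x) * phi x)).
  have -> : (fun x => bet (s x) * phi x) = fun x => phi x * bet (s x) by apply/funext => x; rewrite mulrC.
  exact: (integrable_mul_bounded iphi (CkS2_measurable Cb) bM).
set rho := 4 * pi * (2 + al).
have pi0 : 0 < pi :> R by exact: pi_gt0.
have rho0 : rho != 0 by rewrite gt_eqF // !mulr_gt0.
have mI : measurable_fun setT (fun x => (Kev x / (\int[dV]_x Kev x) - (total_area R)^-1) * phi x).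
  apply: measurable_funM => //; apply: measurable_funB => //.
  exact: measurable_funM.
have -> : \int[dV]_x ((Kev x / (\int[dV]_x Kev x) - (total_area R)^-1) * phi x) =
    \int[dV]_x (- rho^-1 * (bet (s x) * phi x)).
  rewrite IE in mI *.
  rewrite /Rintegral (ae_eq_integral (EFin \o (fun x => - rho^-1 * (bet (s x) * phi x)))) //.
  - exact/measurable_EFinP.
  - by have /measurable_int := integrableZl measurableT (- rho^-1) ib.
  apply: filterS KevE => x E _ /=; rewrite E total_areaE /bet /rho; congr (_%:E).
  rewrite [RHS]mulrA; congr (_ * _).
  move: (W (s x)) (c) (c_gt0) (I1) (I0) (pi : R) pi0 al0 => w c' c'0 J J0 P P0 A0.
  by field; rewrite !gt_eqF.
by rewrite RintegralZl // mulrA mulrN divff // mulN1r.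
Qed.
End solution.

Theorem theorem1p10 (R : realType) (G : S2 R -> S2 R -> R) (fg : S2 R -> R)
    (p1 : S2 R) (hG : green_function G) (hfg : conformal_factor fg) :
  (forall N : nat, (1 <= N)%N ->
    exists C : set (S2 R -> R),
      [/\ C !=set0,
          forall K, C K -> admissible p1 K &
          forall K, C K ->
            exists2 delta : R, 0 < delta &
              forall eps alpha1 : R, 0 < eps < delta ->
                alpha1 = 2 * (N%:R - 1) + eps / (4 * pi) ->
                let p := fun _ : 'I_1 => p1 in
                let alpha := fun _ : 'I_1 => alpha1 in
                [/\ 0 < alpha1,
                    rho_geo alpha = 8 * pi * N%:R + eps &
                    exists v, solution G fg K p alpha (rho_geo alpha) v]])
  /\
  (forall N : nat, (2 <= N)%N ->
    exists C : set (S2 R -> R),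
      [/\ C !=set0,
          forall K, C K -> admissible p1 K &
          forall K, C K ->
            exists2 delta : R, 0 < delta &
              forall eps alpha1 : R, 0 < eps < delta ->
                alpha1 = 2 * (N%:R - 1) - eps / (4 * pi) ->
                let p := fun _ : 'I_1 => p1 in
                let alpha := fun _ : 'I_1 => alpha1 in
                [/\ 0 < alpha1,
                    rho_geo alpha = 8 * pi * N%:R - eps &
                    exists v, solution G fg K p alpha (rho_geo alpha) v]]).
Proof.
have [fg2 _ _] := hfg.
have pi0 : 0 < pi :> R by exact: pi_gt0.
have pi2 : 4 * pi != 0 :> R by rewrite gt_eqF ?mulr_gt0.
have rhoE (al : R) : rho_geo (fun _ : 'I_1 => al) = 4 * pi * (2 + al).
  by rewrite /rho_geo big_ord1.
have key (N : nat) : (1 <= N)%N -> exists K : S2 R -> R, admissible p1 K /\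
    forall al : R, 0 < al -> al <= 2 * (N%:R - 1) + 1 ->
      exists v, solution G fg K (fun _ : 'I_1 => p1) (fun _ => al) (4 * pi * (2 + al)) v.
  move=> N1; have N1' : 1 <= N%:R :> R by rewrite ler1n.
  (* the values of lam = 2 (2 + al) to be treated are at most 4 N + 2 *)
  pose h : R := (1296 * (4 * N%:R + 2))^-1.
  have D0 : 0 < 1296 * (4 * N%:R + 2) :> R by lra.
  have h0 : 0 < h by rewrite invr_gt0.
  have h8 : h <= 8^-1 by rewrite lef_pV2 ?posrE //; lra.
  have b0 : 0 < mass (cutoff (- h) 0) 1 by apply: mass_cutoff_gt0; lra.
  pose eta : R := mass (cutoff (- h) 0) 1 * h / 32.
  have eta0 : 0 < eta by rewrite divr_gt0 ?mulr_gt0.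
  have eta_small : 32 * eta <= mass (cutoff (- h) 0) 1 * h by rewrite /eta; lra.
  exists (curv h eta p1 fg); split; first exact: admissible_curv.
  move=> al al0 alN; apply: mean_field_solution => //; first lra.
  have : 2 * (2 + al) * h <= (4 * N%:R + 2) * h by rewrite ler_pM2r //; lra.
  move=> /le_trans; apply; rewrite /h invfM mulrC -mulrA mulVf ?mulr1 // gt_eqF //; lra.
split=> N N1.
  have [K [aK sK]] := key N N1.
  exists [set K]; split; [by exists K|by move=> _ ->|move=> _ ->].
  (* eps < 4 pi keeps alpha1 in the range allowed by [key] *)
  exists (4 * pi); first by rewrite mulr_gt0.
  move=> eps al /andP[e0 e1] alE p alpha; have N1' : 1 <= N%:R :> R by rewrite ler1n.
  have q0 : 0 < eps / (4 * pi) by rewrite divr_gt0 ?mulr_gt0.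
  have q1 : eps / (4 * pi) <= 1 by rewrite ler_pdivrMr ?mulr_gt0 // mul1r ltW.
  have al0 : 0 < al by lra.
  split=> //.
    by rewrite rhoE alE; move: (pi : R) (pi0) => q q00; field; rewrite gt_eqF.
  by rewrite rhoE; apply: sK => //; lra.
have [K [aK sK]] := key N (ltnW N1).
exists [set K]; split; [by exists K|by move=> _ ->|move=> _ ->].
exists (4 * pi); first by rewrite mulr_gt0.
move=> eps al /andP[e0 e1] alE p alpha; have N1' : 2 <= N%:R :> R by rewrite (ler_nat _ 2).
have q0 : 0 < eps / (4 * pi) by rewrite divr_gt0 ?mulr_gt0.
have q1 : eps / (4 * pi) <= 1 by rewrite ler_pdivrMr ?mulr_gt0 // mul1r ltW.
have al0 : 0 < al by lra.
split=> //.
  by rewrite rhoE alE; move: (pi : R) (pi0) => q q00; field; rewrite gt_eqF.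
by rewrite rhoE; apply: sK => //; lra.
Qed.
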